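(* Let $N\in\mathbb{N}$, $a,b\in\mathbb{R}$ with $a<b$, $P_{1}=P_{1}^{*}\in\mathbb{R}^{N\times N}$ invertible, $P_{0}=-P_{0}^{*}\in\mathbb{R}^{N\times N}$, and $\mathcal{H}\in L^{\infty}([a,b];\mathbb{R}^{N\times N})$ such that for some constants $c_0,c_1>0$ one has $c_0I_{N\times N}\leq\mathcal{H}(\zeta)=\mathcal{H}(\zeta)^{*}\leq c_1I_{N\times N}$ for a.e. $\zeta\in[a,b]$. Let $A\colon\operatorname{dom}(A)\subseteq L_{\mathcal{H}}^{2}(]a,b[)^{N}\to L_{\mathcal{H}}^{2}(]a,b[)^{N}$ be a linear operator acting as $Ax=P_{1}(\mathcal{H}x)'+P_{0}\mathcal{H}x$, where $$\{x\in L^2(]a,b[)^N:\mathcal{H}x\in H^1_0(]a,b[)^N\}\subseteq\operatorname{dom}(A)\subseteq\{x\in L^2(]a,b[)^N:\mathcal{H}x\in H^1(]a,b[)^N\}.$$ Then the following conditions are equivalent: (i) $-A$ generates a $C_0$-semigroup of contractions on $L_{\mathcal{H}}^{2}(]a,b[)^{N}$; that is, $A$ is maximal accretive. (ii) $A$ is accretive and there exists $W_B\in\mathbb{R}^{N\times 2N}$ such that $$\operatorname{dom}(A)=\left\{x\in L^2(]a,b[)^N : \mathcal{H}x\in H^1(]a,b[)^N,\ W_B\begin{pmatrix}(\mathcal{H}x)(b)\\(\mathcal{H}x)(a)\end{pmatrix}=0\right\}.\tag{$*$}$$ (iii) There exists $W_{B}\in\mathbb{R}^{N\times 2N}$ such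 that $\operatorname{dom}(A)$ is given by $( * )$, $W_B$ has rank $N$ and, in the sense of positive (semi)definiteness, $$W_{B}\begin{pmatrix}-P_{1} & P_{1}\\ I_{N\times N} & I_{N\times N}\end{pmatrix}^{-1}\begin{pmatrix}0 & I_{N\times N}\\ I_{N\times N} & 0\end{pmatrix}\left(W_{B}\begin{pmatrix}-P_{1} & P_{1}\\ I_{N\times N} & I_{N\times N}\end{pmatrix}^{-1}\right)^{*}\geq 0.$$ If any one (equivalently, each) of the conditions (i), (ii), (iii) holds, then (for $W_B$ as in $( * )$) there exist an invertible matrix $C\in\mathbb{R}^{2N\times 2N}$ and matrices $M,L\in\mathbb{R}^{N\times N}$ with $M^{*}M\leq 1$ and $L$ invertible such that $$W_{B}C=L\begin{pmatrix}M & 1\end{pmatrix}.$$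
   Context: All function spaces consist of real-valued functions. $L_{\mathcal{H}}^{2}(]a,b[)^{N}$ is the space $L^2(]a,b[)^N$ equipped with the inner product $\langle\cdot,\mathcal{H}\,\cdot\rangle_{L^2(]a,b[)^N}$. $H^1(]a,b[)$ is the usual Sobolev space, whose elements are identified with their continuous representatives on $[a,b]$, and $H^1_0(]a,b[)$ is the closure of the smooth compactly supported functions in $H^1(]a,b[)$. An operator $A$ on a Hilbert space is accretive if $\operatorname{Re}\langle Ax,x\rangle\ge0$ for all $x\in\operatorname{dom}(A)$, and maximal accretive if it is accretive and no accretive linear relation properly extends it. Matrix inequalities are in the sense of positive semidefiniteness. $\begin{pmatrix}M&1\end{pmatrix}\in\mathbb{R}^{N\times 2N}$ is the block matrix with blocks $M$ and the $N\times N$ identity. *)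

(* Defs.v *)
From HB Require Import structures.
From mathcomp Require Import all_boot all_order all_algebra.
From mathcomp Require Import generic_quotient.
From mathcomp Require Import all_classical all_reals all_analysis.
Set Implicit Arguments.
Unset Strict Implicit.
Unset Printing Implicit Defensive.
Import Order.TTheory GRing.Theory Num.Theory.
Import numFieldNormedType.Exports.
Local Open Scope classical_set_scope.
Local Open Scope ring_scope.

(* The library's [LspaceType] carries no vector space structure, whence the
   following quotient of the module [LfunType] by a.e. equality. *)
Section Lp_space.
Context d (T : measurableType d) (R : realType).
Variables (mu : {measure set T -> \bar R}) (p : \bar R) (p1 : (1 <= p)%E).
Local Open Scope quotient_scope.

Definition Lp_eq (f g : LfunType mu p1) : bool :=
  `[< (f : T -> R) = g %[ae mu] >].

Lemma Lp_eq_refl : reflexive Lp_eq.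
Proof. by move=> f; apply/asboolP; exact: ae_eq_refl. Qed.

Lemma Lp_eq_sym : symmetric Lp_eq.
Proof. by move=> f g; apply/idP/idP => /asboolP h; apply/asboolP/ae_eq_sym. Qed.

Lemma Lp_eq_trans : transitive Lp_eq.
Proof.
by move=> f g h /asboolP gf /asboolP fh; apply/asboolP/(ae_eq_trans gf fh).
Qed.

Canonical Lp_eq_equiv := EquivRel Lp_eq Lp_eq_refl Lp_eq_sym Lp_eq_trans.

Definition Lp : Type := {eq_quot Lp_eq}.
HB.instance Definition _ := Choice.on Lp.
HB.instance Definition _ := EqQuotient.on Lp.

(* an arbitrary representative *)
Definition Lp_to_fun (x : Lp) : T -> R := (repr x : LfunType mu p1).

Definition Lp_zero : Lp := \pi_Lp 0.
Definition Lp_opp (x : Lp) : Lp := \pi_Lp (- repr x).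
Definition Lp_add (x y : Lp) : Lp := \pi_Lp (repr x + repr y).
Definition Lp_scale (k : R) (x : Lp) : Lp := \pi_Lp (k *: repr x).

Lemma Lp_piP (f g : LfunType mu p1) :
  (\pi_Lp f = \pi_Lp g) <-> ((f : T -> R) = g %[ae mu]).
Proof.
split=> [/eqP|h]; first by rewrite eqmodE => /asboolP.
by apply/eqP; rewrite eqmodE; exact/asboolP.
Qed.

Lemma Lp_reprK (f : LfunType mu p1) :
  ((repr (\pi_Lp f) : LfunType mu p1) : T -> R) = f %[ae mu].
Proof. by apply/Lp_piP; rewrite reprK. Qed.

Lemma Lp_piD (f g : LfunType mu p1) :
  Lp_add (\pi_Lp f) (\pi_Lp g) = \pi_Lp (f + g).
Proof.
apply/Lp_piP; apply: filterS2 (Lp_reprK f) (Lp_reprK g) => x hf hg _.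
exact: (congr2 +%R (hf I) (hg I)).
Qed.

Lemma Lp_piN (f : LfunType mu p1) : Lp_opp (\pi_Lp f) = \pi_Lp (- f).
Proof.
apply/Lp_piP; apply: filterS (Lp_reprK f) => x hf _.
exact: (congr1 -%R (hf I)).
Qed.

Lemma Lp_piZ (k : R) (f : LfunType mu p1) :
  Lp_scale k (\pi_Lp f) = \pi_Lp (k *: f).
Proof.
apply/Lp_piP; apply: filterS (Lp_reprK f) => x hf _.
exact: (congr1 ( *:%R k) (hf I)).
Qed.

Lemma LpW (P : Lp -> Prop) : (forall f, P (\pi_Lp f)) -> forall x, P x.
Proof. by move=> Pf x; rewrite -[x]reprK. Qed.

Lemma Lp_addA : associative Lp_add.
Proof.
move=> x y z; elim/LpW: x => f; elim/LpW: y => g; elim/LpW: z => h.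
by rewrite !Lp_piD addrA.
Qed.

Lemma Lp_addC : commutative Lp_add.
Proof.
by move=> x y; elim/LpW: x => f; elim/LpW: y => g; rewrite !Lp_piD addrC.
Qed.

Lemma Lp_add0 : left_id Lp_zero Lp_add.
Proof. by move=> x; elim/LpW: x => f; rewrite Lp_piD add0r. Qed.

Lemma Lp_addN : left_inverse Lp_zero Lp_opp Lp_add.
Proof. by move=> x; elim/LpW: x => f; rewrite Lp_piN Lp_piD addNr. Qed.

HB.instance Definition _ :=
  GRing.isZmodule.Build Lp Lp_addA Lp_addC Lp_add0 Lp_addN.

Lemma Lp_scaleA k l x : Lp_scale k (Lp_scale l x) = Lp_scale (k * l) x.
Proof. by elim/LpW: x => f; rewrite !Lp_piZ scalerA. Qed.

Lemma Lp_scale1 : left_id 1 Lp_scale.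
Proof. by move=> x; elim/LpW: x => f; rewrite Lp_piZ scale1r. Qed.

Lemma Lp_scaleDr : right_distributive Lp_scale +%R.
Proof.
move=> k x y; elim/LpW: x => f; elim/LpW: y => g.
change (Lp_scale k (Lp_add (\pi_Lp f) (\pi_Lp g)) =
  Lp_add (Lp_scale k (\pi_Lp f)) (Lp_scale k (\pi_Lp g))).
by rewrite Lp_piD !Lp_piZ Lp_piD scalerDr.
Qed.

Lemma Lp_scaleDl x : {morph Lp_scale^~ x : k l / k + l}.
Proof.
move=> k l; elim/LpW: x => f.
change (Lp_scale (k + l) (\pi_Lp f) =
  Lp_add (Lp_scale k (\pi_Lp f)) (Lp_scale l (\pi_Lp f))).
by rewrite !Lp_piZ Lp_piD scalerDl.
Qed.

HB.instance Definition _ := GRing.Zmodule_isLmodule.Build R Lp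
  Lp_scaleA Lp_scale1 Lp_scaleDr Lp_scaleDl.

End Lp_space.

Section linear_relations.
Context (R : realType) (V : lmodType R) (ip : V -> V -> R).
Implicit Types A B : set (V * V).

(* Operators are identified with their graphs. *)
Definition linear_relation A :=
  A 0 /\ forall (k : R) p q, A p -> A q -> A (k *: p + q).

Definition linear_operator A :=
  linear_relation A /\ forall x y y', A (x, y) -> A (x, y') -> y = y'.

Definition dom A : set V := [set x | exists y, A (x, y)].

Definition opp_rel A : set (V * V) := [set p | A (p.1, - p.2)].

Definition accretive A := forall x y, A (x, y) -> 0 <= ip y x.

Definition maximal_accretive A :=
  accretive A /\
  forall B, linear_relation B -> accretive B -> A `<=` B -> B = A.

Definition ip_norm (x : V) : R := Num.sqrt (ip x x).

(* Only the values T t with t >= 0 matter. *)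
Definition C0_contraction_semigroup (T : R -> V -> V) :=
  [/\ forall t, 0 <= t -> linear (T t),
      forall x, T 0 x = x,
      forall s t x, 0 <= s -> 0 <= t -> T (s + t) x = T s (T t x),
      forall t x, 0 <= t -> ip_norm (T t x) <= ip_norm x &
      forall x, ip_norm (T t x - x) @[t --> 0^'+] --> 0].

Definition generator (T : R -> V -> V) : set (V * V) :=
  [set p | ip_norm (t^-1 *: (T t p.1 - p.1) - p.2) @[t --> 0^'+] --> 0].

Definition generates_C0_contraction_semigroup A :=
  exists2 T, C0_contraction_semigroup T & generator T = A.

End linear_relations.

Section matrices.
Context (R : realType) (n : nat).

(* Over the reals, symmetry does not follow from nonnegativity of the form. *)
Definition psdmx (S : 'M[R]_n) :=
  S^T = S /\ forall v : 'cV[R]_n, 0 <= (v^T *m S *m v) 0 0.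

Definition lemx (S S' : 'M[R]_n) := psdmx (S' - S).

End matrices.

Section interval_spaces.
Context (R : realType) (a b : R).

(* A function on ]a, b[ is represented by a function on R, up to equality a.e.
   for this measure, which charges only ]a, b[. *)
Definition leb_itv : set (measurableTypeR R) -> \bar R :=
  mrestr (@lebesgue_measure R) (measurable_itv `]a, b[).
HB.instance Definition _ := Measure.on leb_itv.

Definition L2 : lmodType R := Lp leb_itv (lee1n 2).

Definition test_function (phi : R -> R) :=
  [/\ forall (n : nat) (z : R), derivable (phi^`(n)%classic) z 1,
      compact (closure [set z | phi z != 0]) &
      closure [set z | phi z != 0] `<=` `]a, b[].

Definition weak_derivative (u v : R -> R) :=
  forall phi, test_function phi ->
    \int[leb_itv]_z (u z * phi^`()%classic z) = - \int[leb_itv]_z (v z * phi z).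

Definition H1_with_derivative (u v : R -> R) :=
  [/\ u \in Lfun leb_itv 2%:E, v \in Lfun leb_itv 2%:E & weak_derivative u v].

Definition H1 (u : R -> R) := exists v, H1_with_derivative u v.

(* sequential closure of the test functions for the norm of H1 *)
Definition H10 (u : R -> R) :=
  exists v, H1_with_derivative u v /\
  exists phi : nat -> R -> R,
    [/\ forall n, test_function (phi n),
        Lnorm leb_itv 2%:E (EFin \o (phi n \- u)) @[n --> \oo] --> 0%E &
        Lnorm leb_itv 2%:E (EFin \o ((phi n)^`()%classic \- v)) @[n --> \oo] --> 0%E].

Definition continuous_representative n (u ut : R -> 'cV[R]_n) :=
  {within `[a, b], continuous ut} /\ ut = u %[ae leb_itv].

End interval_spaces.

Section port_hamiltonian.
Context (R : realType) (N : nat) (a b : R) (P1 P0 : 'M[R]_N)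
  (H : R -> 'M[R]_N).

Definition L2N : lmodType R := 'I_N -> L2 a b.

Definition vec (x : L2N) (z : R) : 'cV[R]_N := \col_i Lp_to_fun (x i) z.

Definition Hmul (x : L2N) (z : R) : 'cV[R]_N := H z *m vec x z.

Definition ipH (x y : L2N) : R :=
  \int[leb_itv a b]_z ((vec x z)^T *m Hmul y z) 0 0.

(* the x such that every component of H x belongs to X *)
Definition Hmul_in (X : (R -> R) -> Prop) : set L2N :=
  [set x | forall i, X (fun z => Hmul x z i 0)].

(* y = P1 (H x)' + P0 H x, where w is the weak derivative of H x *)
Definition acts_as (x y : L2N) :=
  exists w : R -> 'cV[R]_N,
    (forall i, H1_with_derivative a b (fun z => Hmul x z i 0)
                                      (fun z => w z i 0)) /\
    {ae leb_itv a b, forall z, vec y z = P1 *m w z + P0 *m Hmul x z}.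

(* u is the continuous representative of H x *)
Definition boundary_domain (WB : 'M[R]_(N, N + N)) : set L2N :=
  [set x | Hmul_in (H1 a b) x /\
    exists u, continuous_representative a b (Hmul x) u /\
              WB *m col_mx (u b) (u a) = 0].

End port_hamiltonian.

(* Main.v *)
(* Write [u = H x] and let [tau = (u(b), u(a))] be its boundary trace. Integrating
   by parts, [2 <A x, x> = tau^T diag(P1, -P1) tau], and every [tau] is a trace;
   since [A] contains all [x] with trace zero, [A] is the restriction of the maximal
   operator to the traces in a subspace [D], and all conditions become statements
   on [D] and the form [Q = diag(P1, -P1)], which has signature [(N, N)]. Accretivity
   means that [Q >= 0] on [D]; a maximal such [D] has dimension [N], hence is the
   kernel of some [WB] of rank [N]; and the definiteness in the rank condition says
   that [Q <= 0] on the [Q]-orthogonal of [D], which is then equivalent to [Q >= 0]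
   on [D]. A pair orthogonal to the graph of [A] lies in the maximal operator, with
   trace [Q]-orthogonal to [D]; so [A] is closed, and if [Q <= 0] there then each
   [1 + la A] is onto, and the implicit Euler scheme yields the semigroup.
   Conversely, a vector orthogonal to the range of [1 + A], for [-A] a generator, is
   orthogonal to the dense domain of [A]. *)
From HB Require Import structures.
Require Import Defs.
From mathcomp Require Import all_boot all_order all_algebra.
From mathcomp Require Import all_classical all_reals all_analysis.
From mathcomp Require Import measurable_realfun.
From mathcomp Require Import ring lra.
Set Implicit Arguments.
Unset Strict Implicit.
Unset Printing Implicit Defensive.
Import Order.TTheory GRing.Theory Num.Theory.
Import numFieldNormedType.Exports.
Local Open Scope classical_set_scope.
Local Open Scope ring_scope.

(** * Accretive operators and contraction semigroups *)

(** The matrix inverted in the rank condition is a congruence between [swap] and [-2 Q]: this gives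
    the signature of [Q], since [swap] is definite, with opposite signs, on the row spaces of
    [(1 1)] and [(1 -1)]. The same congruence turns the matrix of the rank condition into half of
    [WB bmx^-1 WB^T], where [bmx] stands for [-Q]; nonnegativity of [Q] on traces therefore appears
    below as nonpositivity of [bmx]. Closedness of [A] is needed before the dimension of [D] is
    known, so [D] is first the kernel of a matrix with any number of rows; closedness is then the
    identity [D = D^perp^perp]. The Euler steps are dyadic because one algebraic identity compares a
    step [2d] with two steps [d]; this needs [A^2], and density with contractivity does the rest.
    Sobolev functions are handled as a constant plus a primitive. Integration by parts is then
    Fubini on a triangle, and uniqueness of the representation comes from continuity. *)

Section hilbert.
Context (R : realType) (V : lmodType R) (ip : V -> V -> R).

(** [V] is a bare module, without topology: convergence and completeness are stated by sequences and
    [ip_norm]. *)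
Definition ip_cvg (u : nat -> V) (l : V) := forall e : R, 0 < e ->
  exists n, forall i, (n <= i)%N -> ip_norm ip (u i - l) <= e.

Definition ip_cauchy (u : nat -> V) := forall e : R, 0 < e ->
  exists n, forall i j, (n <= i)%N -> (n <= j)%N -> ip_norm ip (u i - u j) <= e.

Record is_inner_product : Prop := IsInnerProduct {
  ipC : forall x y, ip x y = ip y x;
  ipP : forall k x y z, ip (k *: x + y) z = k * ip x z + ip y z;
  ip_ge0 : forall x, 0 <= ip x x;
  ip_eq0 : forall x, ip x x = 0 -> x = 0 }.

Definition ip_complete := forall u, ip_cauchy u -> exists l, ip_cvg u l.

Context (hip : is_inner_product).
Local Notation nrm := (ip_norm ip).

Lemma ipDl x y z : ip (x + y) z = ip x z + ip y z.
Proof. by have := ipP hip 1 x y z; rewrite scale1r mul1r. Qed.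

Lemma ip0l z : ip 0 z = 0.
Proof. by have := ipDl 0 0 z; rewrite addr0; lra. Qed.

Lemma ipZl k x z : ip (k *: x) z = k * ip x z.
Proof. by have := ipP hip k x 0 z; rewrite ip0l !addr0. Qed.

Lemma ipNl x z : ip (- x) z = - ip x z.
Proof. by rewrite -scaleN1r ipZl mulN1r. Qed.

Lemma ipBl x y z : ip (x - y) z = ip x z - ip y z.
Proof. by rewrite ipDl ipNl. Qed.

Lemma ip0r z : ip z 0 = 0. Proof. by rewrite (ipC hip) ip0l. Qed.
Lemma ipDr x y z : ip x (y + z) = ip x y + ip x z.
Proof. by rewrite !(ipC hip x) ipDl. Qed.
Lemma ipZr k x z : ip x (k *: z) = k * ip x z.
Proof. by rewrite !(ipC hip x) ipZl. Qed.
Lemma ipNr x z : ip x (- z) = - ip x z.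
Proof. by rewrite !(ipC hip x) ipNl. Qed.
Lemma ipBr x y z : ip x (y - z) = ip x y - ip x z.
Proof. by rewrite !(ipC hip x) ipBl. Qed.

Lemma nrm_ge0 x : 0 <= nrm x. Proof. exact: sqrtr_ge0. Qed.

Lemma nrm_sqr x : nrm x ^+ 2 = ip x x.
Proof. by rewrite sqr_sqrtr// (ip_ge0 hip). Qed.

Lemma nrm0 : nrm 0 = 0. Proof. by rewrite /ip_norm ip0l sqrtr0. Qed.

Lemma nrm_eq0 x : nrm x <= 0 -> x = 0.
Proof.
move=> h; apply: (ip_eq0 hip); rewrite -nrm_sqr.
have -> : nrm x = 0 by apply/eqP; rewrite eq_le h nrm_ge0.
by rewrite expr0n.
Qed.

Lemma cauchy_schwarz x y : `|ip x y| <= nrm x * nrm y.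
Proof.
rewrite -[leLHS]sqrtr_sqr -sqrtrM ?(ip_ge0 hip)// ler_wsqrtr//.
(* The square of this vector is [ip y y] times the Gram determinant of [x] and [y]; the case [y = 0]
   is split off only when dividing. *)
have := ip_ge0 hip (ip y y *: x - ip x y *: y).
rewrite ipBl !ipBr !ipZl !ipZr (ipC hip y x) => h.
have h' : 0 <= ip y y * (ip x x * ip y y - ip x y ^+ 2) by nra.
have [y0|y0] := eqVneq (ip y y) 0.
  by rewrite (ip_eq0 hip y0) ip0r ip0l mulr0 expr0n.
have yp : 0 < ip y y by rewrite lt_neqAle eq_sym y0 (ip_ge0 hip).
by rewrite pmulr_rge0// subr_ge0 in h'.
Qed.

(** Reduces an identity between vectors to one between scalars, within reach of [ring], [field] and
    [lra]. *)
Lemma ip_inj x y : (forall z, ip x z = ip y z) -> x = y.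
Proof.
move=> xy; apply/eqP; rewrite -subr_eq0; apply/eqP/(ip_eq0 hip).
by rewrite ipBl xy subrr.
Qed.

Lemma nrmD x y : nrm (x + y) <= nrm x + nrm y.
Proof.
rewrite -(@ler_pXn2r _ 2)// ?nnegrE ?nrm_ge0 ?addr_ge0 ?nrm_ge0//.
rewrite nrm_sqr ipDl !ipDr (ipC hip y x) sqrrD !nrm_sqr.
have := cauchy_schwarz x y; have := ler_norm (ip x y); lra.
Qed.

Lemma nrmZ k x : nrm (k *: x) = `|k| * nrm x.
Proof.
by rewrite /ip_norm ipZl ipZr mulrA -expr2 sqrtrM ?sqr_ge0// sqrtr_sqr.
Qed.

Lemma nrmN x : nrm (- x) = nrm x.
Proof. by rewrite -scaleN1r nrmZ normrN1 mul1r. Qed.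

Lemma nrmBC x y : nrm (x - y) = nrm (y - x).
Proof. by rewrite -nrmN opprB. Qed.

Lemma nrmB_trans y x z : nrm (x - z) <= nrm (x - y) + nrm (y - z).
Proof. by rewrite -{1}[x](subrK y) -addrA nrmD. Qed.

Lemma nrm_le x y : nrm x <= nrm (x - y) + nrm y.
Proof. by rewrite -{1}[x](subrK y) nrmD. Qed.

Lemma ip_cvg_uniq u l l' : ip_cvg u l -> ip_cvg u l' -> l = l'.
Proof.
move=> h h'; apply/eqP; rewrite -subr_eq0; apply/eqP/nrm_eq0.
apply/ler_addgt0Pl => e e0; rewrite addr0.
have e2 : 0 < e / 2 by lra.
have [n hn] := h _ e2; have [m hm] := h' _ e2.
have := hn _ (leq_maxl n m); have := hm _ (leq_maxr n m).
have := nrmB_trans (u (maxn n m)) l l'; rewrite (nrmBC l (u _)); lra.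
Qed.

Lemma ip_cvgP u v l l' (k : R) :
  ip_cvg u l -> ip_cvg v l' -> ip_cvg (fun n => k *: u n + v n) (k *: l + l').
Proof.
move=> h h' e e0.
have k1 : 0 < 2 * (`|k| + 1) by have := normr_ge0 k; lra.
have [n hn] := h (e / (2 * (`|k| + 1))) (divr_gt0 e0 k1).
have [m hm] := h' (e / 2) (divr_gt0 e0 (ltr0n R 2)).
exists (maxn n m) => i; rewrite geq_max => /andP[/hn hni /hm hmi].
rewrite opprD addrACA -scalerBr (le_trans (nrmD _ _))// nrmZ.
have : `|k| * nrm (u i - l) <= e / 2.
  by rewrite ler_pdivlMr// in hni; have := nrm_ge0 (u i - l); nra.
lra.
Qed.

Lemma ip_cvg_cst x : ip_cvg (fun=> x) x.
Proof. by move=> e e0; exists 0%N => i _; rewrite subrr nrm0 ltW. Qed.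

Lemma ip_cvg_ipl u l z : ip_cvg u l -> (forall n, ip (u n) z = 0) -> ip l z = 0.
Proof.
move=> h uz; apply/eqP; rewrite -normr_le0; apply/ler_addgt0Pl => e e0.
have z1 : 0 < nrm z + 1 by have := nrm_ge0 z; lra.
have [n /(_ n (leqnn n)) hn] := h _ (divr_gt0 e0 z1).
have -> : ip l z = - ip (u n - l) z by rewrite ipBl uz; ring.
rewrite normrN addr0 (le_trans (cauchy_schwarz _ _))//.
rewrite ler_pdivlMr// in hn; have := nrm_ge0 z; have := nrm_ge0 (u n - l); nra.
Qed.

Lemma ip_cvg_le u l c : ip_cvg u l -> (forall n, nrm (u n) <= c) -> nrm l <= c.
Proof.
move=> h uc; apply/ler_addgt0Pl => e e0; have [n /(_ n (leqnn n)) hn] := h _ e0.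
by have := nrm_le l (u n); rewrite nrmBC; have := uc n; lra.
Qed.

Lemma ip_cvg_cauchy u l : ip_cvg u l -> ip_cauchy u.
Proof.
move=> h e e0; have [n hn] := h _ (divr_gt0 e0 (ltr0n R 2)).
exists n => i j /hn hi /hn hj; have := nrmB_trans l (u i) (u j); rewrite (nrmBC l (u j)); lra.
Qed.

Lemma inv_succ_lt (e : R) : 0 < e -> exists n, n.+1%:R^-1 < e.
Proof.
move=> e0; exists (Num.truncn e^-1); rewrite -[ltRHS]invrK ltf_pV2 ?posrE ?invr_gt0//.
exact: truncnS_gt.
Qed.

(* Minimizing [|x - s|] over [s] in [S]: by the parallelogram law a minimizing
   sequence is Cauchy, and [x - p] is orthogonal to [S] for its limit [p]. *)
Lemma dense_of_orthogonal (S : set V) (x : V) : ip_complete ->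
  S 0 -> (forall k u v, S u -> S v -> S (k *: u + v)) ->
  (forall v, (forall s, S s -> ip s v = 0) -> ip x v = 0) ->
  exists2 u : nat -> V, (forall n, S (u n)) & ip_cvg u x.
Proof.
move=> cpl S0 SP Sx.
pose E : set R := [set ip (x - s) (x - s) | s in S].
have hE : has_inf E.
  split; first by exists (ip (x - 0) (x - 0)); exists 0.
  by exists 0 => _ [s _ <-]; exact: (ip_ge0 hip).
pose d := inf E.
have dE s : S s -> d <= ip (x - s) (x - s).
  by move=> Ss; apply: ge_inf; [exact: hE.2 | exists s].
have exS (n : nat) : exists s, S s /\ ip (x - s) (x - s) <= d + n.+1%:R^-1.
  have n0 : 0 < n.+1%:R^-1 :> R by rewrite invr_gt0 ltr0n.
  have [_ [s Ss <-] h] := inf_adherent n0 hE.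
  by exists s; split => //; apply: ltW.
have /choice[u uP] := exS.
have uS n : S (u n) by case: (uP n).
have half i j : ip (u i - u j) (u i - u j) <= 2 * i.+1%:R^-1 + 2 * j.+1%:R^-1.
  have Sm : S (2^-1 *: u i + 2^-1 *: u j).
    by apply: (SP) => //; rewrite -[_ *: u j]addr0; exact: (SP).
  have := dE _ Sm; have := (uP i).2; have := (uP j).2.
  rewrite !(ipBl, ipBr, ipDl, ipDr, ipZl, ipZr, ipNl, ipNr) ?(ipC hip x (u i)) ?(ipC hip x (u j)) ?(ipC hip (u j) (u i)).
  set ri := i.+1%:R^-1; set rj := j.+1%:R^-1; clearbody ri rj => h1 h2 h3.
  lra.
have [|p pP] := cpl u.
  move=> e e0; have [n hn] := inv_succ_lt (divr_gt0 (exprn_gt0 2 e0) (ltr0n R 4)).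
  have le_n i : (n <= i)%N -> i.+1%:R^-1 <= n.+1%:R^-1 :> R.
    by move=> ni; rewrite lef_pV2 ?posrE ?ltr0n// ler_nat.
  exists n => i j /le_n hi /le_n hj; rewrite -(@ler_pXn2r _ 2)// ?nnegrE ?nrm_ge0 ?(ltW e0)//.
  rewrite nrm_sqr; move: (half i j) hi hj hn.
  by move: (i.+1%:R^-1) (j.+1%:R^-1) (n.+1%:R^-1) => ri rj rn; lra.
exists u => //.
have orth s : S s -> ip s (x - p) = 0.
  move=> Ss.
  have key n (t : R) : 0 <= n.+1%:R^-1 - 2 * t * ip (x - u n) s + t ^+ 2 * ip s s.
    have := dE _ (SP t _ _ Ss (uS n)); have := (uP n).2.
    rewrite !(ipBl, ipBr, ipDl, ipDr, ipZl, ipZr, ipNl, ipNr) ?(ipC hip x (u n)) ?(ipC hip x s) ?(ipC hip (u n) s).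
    by rewrite expr2; move: (n.+1%:R^-1) => rn; lra.
  (* [key] at a nearly optimal [t]; the denominator [ip s s + 1] in place of [ip s s] covers
     [s = 0]. *)
  have key2 n : ip (x - u n) s ^+ 2 <= n.+1%:R^-1 * (ip s s + 1).
    set w := ip (x - u n) s; set q := ip s s.
    have q0 : 0 < q + 1 by rewrite ltr_pwDr// (ip_ge0 hip).
    move: (key n (w / (q + 1))); rewrite -/w -/q; move: (n.+1%:R^-1) => rn h.
    have h2 : 0 <= rn * (q + 1) ^+ 2 - 2 * w ^+ 2 * (q + 1) + w ^+ 2 * q.
      have -> : rn * (q + 1) ^+ 2 - 2 * w ^+ 2 * (q + 1) + w ^+ 2 * q =
        (rn - 2 * (w / (q + 1)) * w + (w / (q + 1)) ^+ 2 * q) * (q + 1) ^+ 2.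
        by field; rewrite lt0r_neq0.
      by rewrite mulr_ge0// sqr_ge0.
    have q1 : 0 <= q by exact: (ip_ge0 hip).
    have h3 : 0 <= (q + 1) * (rn * (q + 1) - w ^+ 2) by have := sqr_ge0 w; nra.
    by rewrite pmulr_rge0// subr_ge0 in h3.
  rewrite (ipC hip); apply/eqP; rewrite -normr_le0; apply/ler_addgt0Pl => e e0; rewrite addr0.
  set q := ip s s + 1.
  have q0 : 0 < q by rewrite ltr_pwDr// (ip_ge0 hip).
  have [n1 hn1] := inv_succ_lt (divr_gt0 (exprn_gt0 2 (divr_gt0 e0 (ltr0n R 2))) q0).
  have s1 : 0 < nrm s + 1 by have := nrm_ge0 s; lra.
  have [n2 hn2] := pP _ (divr_gt0 (divr_gt0 e0 (ltr0n R 2)) s1).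
  pose n := maxn n1 n2.
  have h1 : `|ip (x - u n) s| <= e / 2.
    rewrite -(@ler_pXn2r _ 2)// ?nnegrE//; last lra.
    rewrite -normrX ger0_norm ?sqr_ge0//; apply: le_trans (key2 n) _.
    rewrite -/q -ler_pdivlMr//; apply: le_trans (ltW hn1).
    by rewrite lef_pV2 ?posrE ?ltr0n// ler_nat ltnS leq_maxl.
  have h2 : `|ip (u n - p) s| <= e / 2.
    apply: le_trans (cauchy_schwarz _ _) _; have := hn2 n (leq_maxr _ _).
    by rewrite ler_pdivlMr//; have := nrm_ge0 s; have := nrm_ge0 (u n - p); nra.
  have -> : ip (x - p) s = ip (x - u n) s + ip (u n - p) s by rewrite !ipBl; ring.
  by apply: le_trans (ler_normD _ _) _; lra.
have xp : x - p = 0.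
  apply: (ip_eq0 hip); rewrite {1}ipBl (Sx _ orth) sub0r.
  by rewrite (@ip_cvg_ipl u p (x - p) pP (fun n => orth _ (uS n))) oppr0.
by move/eqP: xp; rewrite subr_eq0 => /eqP ->.
Qed.

Lemma linear_relationP A (k : R) (x y x' y' : V) : linear_relation A ->
  A (x, y) -> A (x', y') -> A (k *: x + x', k *: y + y').
Proof. by move=> [_ AP]; exact: (AP k (x, y) (x', y')). Qed.

Lemma linear_relationB A (x y x' y' : V) : linear_relation A ->
  A (x, y) -> A (x', y') -> A (x - x', y - y').
Proof.
move=> linA Axy Axy'.
by have := linear_relationP (-1) linA Axy' Axy; rewrite !scaleN1r !(addrC (- _)).
Qed.

Lemma linear_relationZ A (k : R) (x y : V) : linear_relation A ->
  A (x, y) -> A (k *: x, k *: y).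
Proof.
move=> linA Axy; rewrite -[k *: x]addr0 -[k *: y]addr0.
by apply: linear_relationP => //; case: linA.
Qed.

(** The range of [1 + la A] is dense because its orthogonal is zero. It is closed because
    accretivity makes the inverse a contraction, so that preimages of a Cauchy sequence are Cauchy,
    and the graph of [A] is closed. *)
Lemma closed_accretive_onto (A : set (V * V)) (la : R) : ip_complete -> 0 < la ->
  linear_relation A -> accretive ip A ->
  (forall u w x y, (forall n : nat, A (u n, w n)) -> ip_cvg u x -> ip_cvg w y ->
    A (x, y)) ->
  (forall v, (forall x y, A (x, y) -> ip (x + la *: y) v = 0) -> v = 0) ->
  forall z, exists x y, A (x, y) /\ z = x + la *: y.
Proof.
move=> cpl la0 linA accA clA rngA z.
pose S := [set s | exists x y, A (x, y) /\ s = x + la *: y].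
have [||v hv|s sS sz] := @dense_of_orthogonal S z cpl.
- by exists 0, 0; split; [case: linA | rewrite scaler0 addr0].
- move=> k u v [x [y [Axy ->]]] [x' [y' [Axy' ->]]].
  exists (k *: x + x'), (k *: y + y'); split; first exact: linear_relationP.
  by rewrite !scalerDr !scalerA (mulrC la) addrACA.
- by rewrite (rngA v) ?ip0r// => x y Axy; apply: hv; exists x, y.
have /choice[p pP] : forall n, exists p : V * V, A p /\ s n = p.1 + la *: p.2.
  by move=> n; have [x [y [? ?]]] := sS n; exists (x, y).
have pA n : A (p n) by case: (pP n).
have bnd i j : nrm ((p i).1 - (p j).1) <= nrm (s i - s j).
  have /accA a : A ((p i).1 - (p j).1, (p i).2 - (p j).2).
    by have := pA i; have := pA j; case: (p i) (p j) => c1 c2 [d1 d2] /=; exact: (fun h1 h2 => linear_relationB linA h2 h1).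
  rewrite -(@ler_pXn2r _ 2)// ?nnegrE ?nrm_ge0//.
  rewrite !nrm_sqr (pP i).2 (pP j).2.
  set a1 := (p i).1 - (p j).1 in a *; set a2 := (p i).2 - (p j).2 in a.
  have -> : (p i).1 + la *: (p i).2 - ((p j).1 + la *: (p j).2) = a1 + la *: a2.
    by rewrite /a1 /a2 scalerBr opprD addrACA.
  clearbody a1 a2; rewrite !(ipDl, ipDr, ipZl, ipZr) (ipC hip a2 a1).
  by have := ip_ge0 hip a2; rewrite (ipC hip a2 a1) in a; nra.
have [|x xP] := cpl (fun n => (p n).1).
  move=> e e0; have [n hn] := ip_cvg_cauchy sz e0.
  by exists n => i j ni nj; apply: le_trans (bnd i j) (hn _ _ ni nj).
pose y := la^-1 *: (z - x).
exists x, y; split; last by rewrite /y scalerA divff ?lt0r_neq0// scale1r addrC subrK.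
apply: (clA (fun n => (p n).1) (fun n => (p n).2)) => //.
  by move=> n; have := pA n; case: (p n).
have -> : (fun n => (p n).2) = (fun n => - la^-1 *: (p n).1 + la^-1 *: s n).
  apply/funext => n; rewrite (pP n).2 scalerDr scalerA mulVf ?lt0r_neq0// scale1r.
  by rewrite addrA scaleNr addNr add0r.
have -> : y = - la^-1 *: x + la^-1 *: z by rewrite /y scalerBr scaleNr addrC.
apply: ip_cvgP => //.
have -> : (fun n => la^-1 *: s n) = (fun n => la^-1 *: s n + 0) by apply/funext => n; rewrite addr0.
by rewrite -[la^-1 *: z]addr0; apply: ip_cvgP => //; exact: ip_cvg_cst.
Qed.

(** A pair of [B] has the same sum [x + y] as some pair of [A]; their difference is [(d, - d)] in
    [B], and accretivity of [B] gives [- |d|^2 >= 0]. *)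
Lemma onto_maximal_accretive (A : set (V * V)) :
  accretive ip A ->
  (forall z, exists x y, A (x, y) /\ z = x + y) -> maximal_accretive ip A.
Proof.
move=> accA onto; split=> // B linB accB AB.
rewrite eqEsubset; split => // -[x y] Bxy.
have [x' [y' [Axy' e]]] := onto (x + y).
have /accB h := linear_relationB linB Bxy (AB _ Axy').
have exy : y - y' = - (x - x') by apply/eqP; rewrite opprB subr_eq addrAC -e addrAC subrr add0r.
rewrite exy ipNl oppr_ge0 in h.
have /eqP : x - x' = 0 by apply: (ip_eq0 hip); apply/eqP; rewrite eq_le h (ip_ge0 hip).
rewrite subr_eq0 => /eqP xx'; move: exy; rewrite xx' subrr oppr0 => /eqP.
by rewrite subr_eq0 => /eqP ->.
Qed.

Lemma cvg0_rightP (f : R -> R) : (forall t, 0 <= f t) ->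
  f t @[t --> 0^'+] --> 0 <->
  (forall e : R, 0 < e -> exists2 d : R, 0 < d & forall t, 0 < t -> t < d -> f t <= e).
Proof.
move=> f0; split => [/cvgrPdist_le h e /h [d /= d0 hd]|h].
  exists d => // t t0 td; have := hd t; rewrite /ball/= sub0r normrN gtr0_norm//.
  by rewrite sub0r normrN ger0_norm//; apply.
apply/cvgrPdist_le => e /h[d d0 hd]; near=> t.
rewrite sub0r normrN ger0_norm//; apply: hd; near: t.
  exact: nbhs_right_gt.
exact: nbhs_right_lt.
Unshelve. all: by end_near. Qed.

Lemma linear_funB (f : V -> V) x y : linear f -> f (x - y) = f x - f y.
Proof. by move=> lf; rewrite -scaleN1r addrC lf scaleN1r addrC. Qed.

Lemma linear_funZ (f : V -> V) k x : linear f -> f (k *: x) = k *: f x.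
Proof.
move=> lf; have f0 : f 0 = 0 by have := linear_funB 0 0 lf; rewrite !subrr.
by rewrite -[k *: x]addr0 lf f0 addr0.
Qed.

(** * Generators of contraction semigroups *)

Section contraction_semigroup.
Context (T : R -> V -> V) (sgT : C0_contraction_semigroup ip T).

Lemma generatorP x y : generator ip T (x, y) -> forall e : R, 0 < e ->
  exists2 d : R, 0 < d &
    forall t, 0 < t -> t < d -> nrm (t^-1 *: (T t x - x) - y) <= e.
Proof. by move=> /cvg0_rightP; apply => t; exact: nrm_ge0. Qed.

(** [<T t x, x> <= |x|^2] by contractivity, so every difference quotient at [x] has a nonpositive
    product with [x]. *)
Lemma generator_dissipative x y : generator ip T (x, y) -> ip y x <= 0.
Proof.
case: sgT => linT T0 TD Tc _ /generatorP gxy.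
apply/ler_addgt0Pl => e e0; rewrite addr0.
have x1 : 0 < nrm x + 1 by have := nrm_ge0 x; lra.
have [d d0 hd] := gxy _ (divr_gt0 e0 x1).
have t0 : 0 < d / 2 by lra.
have := hd _ t0 ltac:(lra); set t := d / 2 in t0 *.
set w := _ - y => hw.
have -> : y = t^-1 *: (T t x - x) - w by rewrite /w opprB addrC subrK.
rewrite ipBl ipZl ipBl.
have h1 : ip (T t x) x - ip x x <= 0.
  have := cauchy_schwarz (T t x) x; have := ler_norm (ip (T t x) x).
  have := Tc t x (ltW t0); rewrite -nrm_sqr; have := nrm_ge0 x; nra.
have h2 : t^-1 * (ip (T t x) x - ip x x) <= 0.
  by rewrite pmulr_rle0// invr_gt0.
have := cauchy_schwarz w x; have := ler_norm (- ip w x); rewrite normrN.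
rewrite ler_pdivlMr// in hw; have := nrm_ge0 x; have := nrm_ge0 w; nra.
Qed.

Lemma generator_invariant t x y : 0 <= t ->
  generator ip T (x, y) -> generator ip T (T t x, T t y).
Proof.
case: sgT => linT T0 TD Tc _ t0 /generatorP gxy.
apply/cvg0_rightP => [s|e /gxy[d d0 hd]]; first exact: nrm_ge0.
exists d => // s s0 sd /=; apply: le_trans (hd _ s0 sd).
rewrite -TD ?(ltW s0)// (addrC s) TD ?(ltW s0)//; have lT := linT t t0.
by rewrite -linear_funB// -linear_funZ// -linear_funB//; exact: Tc.
Qed.

(* For [v] orthogonal to the range of [1 - G], [phi t = <T t x, v>] satisfies
   [phi' = phi], uniformly in [t]; being bounded, [phi] vanishes. *)
Lemma generator_range_orthogonal v :
  (forall x y, generator ip T (x, y) -> ip (x - y) v = 0) ->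
  forall x y, generator ip T (x, y) -> ip x v = 0.
Proof.
move=> hv x y gxy; case: (sgT) => linT T0 TD Tc _.
have main e : 0 < e -> `|ip x v| <= e * nrm v.
  move=> e0; have [d d0 hd] := generatorP gxy e0.
  have h0 : 0 < d / 2 by lra.
  have := hd _ h0 ltac:(lra); set h := d / 2 in h0 * => hh; clearbody h.
  (* [phi] is sampled at multiples of a step [h] whose difference quotient is within [e] of [y]; the
     contraction [T (n h)] keeps that error from growing with [n]. *)
  pose a n := ip (T (n%:R * h) x) v.
  have nh n : 0 <= n%:R * h by rewrite mulr_ge0// ltW.
  have aB n : `|a n| <= nrm x * nrm v.
    apply: le_trans (cauchy_schwarz _ _) _.
    by rewrite ler_wpM2r ?nrm_ge0//; exact: Tc.
  have step n : (1 + h) * `|a n| - h * (e * nrm v) <= `|a n.+1|.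
    have -> : a n.+1 = (1 + h) * a n + h * ip (T (n%:R * h) (h^-1 *: (T h x - x) - y)) v.
      have /hv := generator_invariant (nh n) gxy.
      rewrite /a -natr1 mulrDl mul1r TD ?(ltW h0)//.
      have lT := linT _ (nh n).
      rewrite linear_funB// linear_funZ// linear_funB// !ipBl ipZl ipBl => r.
      have -> : ip (T (n%:R * h) y) v = ip (T (n%:R * h) x) v by lra.
      by field; rewrite lt0r_neq0.
    set b := ip _ v.
    have bB : `|b| <= e * nrm v.
      apply: le_trans (cauchy_schwarz _ _) _; rewrite ler_wpM2r ?nrm_ge0//.
      exact: le_trans (Tc _ _ (nh n)) hh.
    have := lerB_normD ((1 + h) * a n) (h * b).
    rewrite !normrM (gtr0_norm h0) (gtr0_norm (_ : 0 < 1 + h)) ?addr_gt0//.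
    have : h * `|b| <= h * (e * nrm v) by rewrite ler_pM2l.
    lra.
  rewrite leNgt; apply/negP; set E := e * nrm v => Ex.
  have a0 : a 0%N = ip x v by rewrite /a mul0r T0.
  (* Linear growth, weaker than [(1 + h)^n], already contradicts the bound [aB]. *)
  have grow n : (1 + n%:R * h) * (`|ip x v| - E) <= `|a n| - E.
    elim: n => [|n IH]; first by rewrite mul0r addr0 mul1r a0.
    have := step n; rewrite -/E -natr1.
    have p0 : 0 < `|ip x v| - E by lra.
    have := nh n; set q := n%:R * h in IH *.
    have -> : (n%:R + 1) * h = q + h by rewrite /q; ring.
    move=> q0 s1.
    have q1 : 0 <= q * (`|ip x v| - E) by rewrite mulr_ge0// ltW.
    have : h * (`|ip x v| - E) <= h * (`|a n| - E) by rewrite ler_pM2l//; lra.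
    lra.
  have p0 : 0 < h * (`|ip x v| - E) by rewrite mulr_gt0//; lra.
  have E0 : 0 <= E by rewrite mulr_ge0 ?nrm_ge0// ltW.
  have := truncnS_gt (nrm x * nrm v / (h * (`|ip x v| - E))).
  set n := (Num.truncn _).+1; rewrite ltr_pdivrMr// mulrA => nb.
  by have := grow n; have := aB n; lra.
apply/eqP; rewrite -normr_le0; apply/ler_addgt0Pl => e e0; rewrite addr0.
have v1 : 0 < nrm v + 1 by have := nrm_ge0 v; lra.
have := main _ (divr_gt0 e0 v1); move=> /le_trans; apply.
by rewrite mulrAC ler_pdivrMr//; have := nrm_ge0 v; nra.
Qed.

Lemma generatorB x y x' y' : generator ip T (x, y) -> generator ip T (x', y') ->
  generator ip T (x - x', y - y').
Proof.
case: (sgT) => linT _ _ _ _ /generatorP g /generatorP g'.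
apply/cvg0_rightP => [s|e e0]; first exact: nrm_ge0.
have [d d0 hd] := g _ (divr_gt0 e0 (ltr0n R 2)).
have [d' d'0 hd'] := g' _ (divr_gt0 e0 (ltr0n R 2)).
exists (Num.min d d') => [|t t0]; first by rewrite lt_min d0.
rewrite lt_min => /andP[/(hd _ t0) h /(hd' _ t0) h'] /=.
rewrite (linear_funB _ _ (linT t (ltW t0))).
have -> : t^-1 *: (T t x - T t x' - (x - x')) - (y - y') =
   (t^-1 *: (T t x - x) - y) - (t^-1 *: (T t x' - x') - y').
  by apply: ip_inj => z; rewrite !(ipBl, ipZl); ring.
by apply: le_trans (nrmD _ _) _; rewrite nrmN; lra.
Qed.

End contraction_semigroup.

(** * The implicit Euler scheme and its limit *)

Section generation.
Context (A : set (V * V)) (opA : linear_operator A) (accA : accretive ip A)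
  (cpl : ip_complete)
  (ontoA : forall la z, 0 < la -> exists x y, A (x, y) /\ z = x + la *: y).

Let linA : linear_relation A. Proof. by case: opA. Qed.

(** The operator [(1 + la A)^-1]; for [0 < la] the default [0] is never reached, by [ontoA]. *)
Definition resolvent la z := xget 0 [set x | exists y, A (x, y) /\ z = x + la *: y].

Lemma resolventP la z : 0 < la ->
  exists y, A (resolvent la z, y) /\ z = resolvent la z + la *: y.
Proof.
move=> /ontoA-/(_ z)[x h]; rewrite /resolvent.
by case: xgetP => [_ -> //|/(_ x)]; case.
Qed.

Lemma accretive_nrm la x y : 0 < la -> A (x, y) -> nrm x <= nrm (x + la *: y).
Proof.
move=> la0 /accA a; rewrite -(@ler_pXn2r _ 2)// ?nnegrE ?nrm_ge0//.
rewrite !nrm_sqr !(ipDl, ipDr, ipZl, ipZr) (ipC hip x y).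
by have := ip_ge0 hip y; nra.
Qed.

Lemma resolventE la x y : 0 < la -> A (x, y) -> resolvent la (x + la *: y) = x.
Proof.
move=> la0 Axy; have [y' [h e]] := resolventP (x + la *: y) la0.
set r := resolvent _ _ in h e *.
have := accretive_nrm la0 (linear_relationB linA h Axy).
rewrite scalerBr addrACA -opprD -e subrr nrm0 => /nrm_eq0/eqP.
by rewrite subr_eq0 => /eqP.
Qed.

Lemma resolvent_linear la : 0 < la -> linear (resolvent la).
Proof.
move=> la0 k x y; have [x1 [h1 e1]] := resolventP x la0.
have [y1 [h2 e2]] := resolventP y la0.
have := resolventE la0 (linear_relationP k linA h1 h2).
by rewrite scalerDr scalerA mulrC -scalerA addrACA -scalerDr -e1 -e2.
Qed.

Lemma resolvent_contraction la x : 0 < la -> nrm (resolvent la x) <= nrm x.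
Proof.
by move=> la0; have [y [h {2}->]] := resolventP x la0; exact: accretive_nrm.
Qed.

Lemma resolventB la x y : 0 < la -> A (x, y) ->
  x - resolvent la x = la *: resolvent la y.
Proof.
move=> la0 Axy; have [x1 [h e]] := resolventP x la0.
have := linear_relationZ la^-1 linA (linear_relationB linA Axy h).
have -> : x - resolvent la x = la *: x1 by rewrite {1}e addrAC subrr add0r.
rewrite scalerA mulVf ?lt0r_neq0// scale1r => /(resolventE la0).
by rewrite scalerA divff ?lt0r_neq0// scale1r addrC subrK => ->.
Qed.

Lemma resolvent_A la x y : 0 < la -> A (x, y) -> A (resolvent la x, resolvent la y).
Proof.
move=> la0 Axy; have [x1 [h e]] := resolventP x la0.
suff -> : resolvent la y = x1 by [].
apply: (scalerI (lt0r_neq0 la0)); rewrite -(resolventB la0 Axy).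
by rewrite {1}e addrAC subrr add0r.
Qed.

(** The operator [(1 + la A)^-n], that is, [n] implicit Euler steps of length [la] for
    [x' = - A x]. *)
Definition euler la n := iter n (resolvent la).

Lemma euler_linear la n : 0 < la -> linear (euler la n).
Proof.
by move=> la0 k x y; elim: n => //= n ->; rewrite resolvent_linear.
Qed.

Lemma euler_contraction la n x : 0 < la -> nrm (euler la n x) <= nrm x.
Proof.
move=> la0; elim: n => //= n; apply: le_trans; exact: resolvent_contraction.
Qed.

Lemma euler_nonexpansive la n x y : 0 < la ->
  nrm (euler la n x - euler la n y) <= nrm (x - y).
Proof.
move=> la0; rewrite -linear_funB; last exact: euler_linear.
exact: euler_contraction.
Qed.

Lemma euler_A la n x y : 0 < la -> A (x, y) -> A (euler la n x, euler la n y).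
Proof. by move=> la0 Axy; elim: n => //= n IH; exact: resolvent_A. Qed.

Lemma eulerSB la n x y : 0 < la -> A (x, y) ->
  euler la n x - euler la n.+1 x = la *: euler la n.+1 y.
Proof. by move=> la0 Axy; rewrite /= (resolventB la0 (euler_A n la0 Axy)). Qed.

Lemma euler_step la n x y : 0 < la -> A (x, y) ->
  nrm (euler la n x - euler la n.+1 x) <= la * nrm y.
Proof.
move=> la0 Axy; rewrite (eulerSB n la0 Axy) nrmZ gtr0_norm// ler_pM2l//.
exact: euler_contraction.
Qed.

Lemma euler_dist la n x y : 0 < la -> A (x, y) ->
  nrm (x - euler la n x) <= n%:R * la * nrm y.
Proof.
move=> la0 Axy; elim: n => [|n IH]; first by rewrite subrr nrm0 !mul0r.
have := nrmB_trans (euler la n x) x (euler la n.+1 x).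
have := euler_step n la0 Axy; rewrite -natr1; lra.
Qed.

(** The increments telescope: the step from [k] to [k.+1] is [- la *: euler la k.+1 y], which is
    compared with [- la *: y]. *)
Lemma euler_derivative la n x y c : 0 < la -> A (x, y) ->
  (forall k, (k <= n)%N -> nrm (euler la k y - y) <= c) ->
  nrm (euler la n x - x + (n%:R * la) *: y) <= n%:R * la * c.
Proof.
move=> la0 Axy; elim: n => [|n IH] yc.
  by rewrite subrr !mul0r scale0r addr0 nrm0.
have -> : euler la n.+1 x - x + (n.+1%:R * la) *: y =
   (euler la n x - x + (n%:R * la) *: y) - la *: (euler la n.+1 y - y).
  apply: ip_inj => z; have := congr1 (ip^~ z) (eulerSB n la0 Axy).
  rewrite !(ipBl, ipDl, ipZl, ipNl) -natr1 => r.
  by rewrite -[ip (euler la n x) z](subrK (ip (euler la n.+1 x) z)) r; ring.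
apply: le_trans (nrmD _ _) _; rewrite nrmN nrmZ gtr0_norm//.
have : la * nrm (euler la n.+1 y - y) <= la * c by rewrite ler_pM2l// yc.
have := IH (fun k kn => yc k (leqW kn)); rewrite -natr1; lra.
Qed.

(* [(1 + 2dA)^-1 - (1 + dA)^-2 = d^2 (1 + 2dA)^-1 (1 + dA)^-2 A^2] *)
Lemma resolvent_doubling d x y z : 0 < d -> A (x, y) -> A (y, z) ->
  nrm (resolvent (2 * d) x - euler d 2 x) <= d ^+ 2 * nrm z.
Proof.
move=> d0 Axy Ayz; have d20 : 0 < 2 * d by rewrite mulr_gt0.
have es := euler_A 2 d0 Axy.
(* This expands [x = (1 + d A)^2 (euler d 2 x)]; [resolvent (2 * d)] takes the first two terms back
   to [euler d 2 x]. *)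
have ex : x = euler d 2 x + (2 * d) *: euler d 2 y + d ^+ 2 *: euler d 2 z.
  have e1 : x = euler d 1 x + d *: euler d 1 y.
    by rewrite -(eulerSB 0 d0 Axy) addrC subrK.
  have e2 : euler d 1 x = euler d 2 x + d *: euler d 2 y.
    by rewrite -(eulerSB 1 d0 Axy) addrC subrK.
  have e3 : euler d 1 y = euler d 2 y + d *: euler d 2 z.
    by rewrite -(eulerSB 1 d0 Ayz) addrC subrK.
  rewrite {1}e1 e2 e3 scalerDr scalerA -expr2 !addrA; congr (_ + _).
  by rewrite -addrA -scalerDl; congr (_ + _ *: _); ring.
have -> : resolvent (2 * d) x = d ^+ 2 *: resolvent (2 * d) (euler d 2 z) + euler d 2 x.
  by rewrite {1}ex addrC (resolvent_linear d20) (resolventE d20 es).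
rewrite addrK nrmZ ger0_norm ?sqr_ge0//.
rewrite ler_wpM2l ?sqr_ge0//; apply: le_trans (resolvent_contraction _ d20) _.
exact: euler_contraction.
Qed.

(** One long step at a time is replaced by two short ones. The remaining long steps are
    nonexpansive, so the [n] errors of [resolvent_doubling] merely add up. *)
Lemma euler_doubling d n x y z : 0 < d -> A (x, y) -> A (y, z) ->
  nrm (euler (2 * d) n x - euler d n.*2 x) <= n%:R * d ^+ 2 * nrm z.
Proof.
move=> d0; have d20 : 0 < 2 * d by rewrite mulr_gt0.
elim: n x y z => [|n IH] x y z Axy Ayz; first by rewrite subrr nrm0 !mul0r.
have -> : euler (2 * d) n.+1 x = euler (2 * d) n (resolvent (2 * d) x) by rewrite /euler iterSr.
have -> : euler d n.+1.*2 x = euler d n.*2 (euler d 2 x).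
  by rewrite /euler doubleS -addn2 iterD.
apply: le_trans (nrmB_trans (euler (2 * d) n (euler d 2 x)) _ _) _.
have := IH _ _ _ (euler_A 2 d0 Axy) (euler_A 2 d0 Ayz).
have := euler_nonexpansive n (resolvent (2 * d) x) (euler d 2 x) d20.
have := resolvent_doubling d0 Axy Ayz.
have := euler_contraction 2 z d0.
have : 0 <= n%:R * d ^+ 2 by rewrite mulr_ge0 ?sqr_ge0.
set q := n%:R * d ^+ 2 => q0 ec; have := ler_wpM2l q0 ec.
have -> : n.+1%:R * d ^+ 2 = q + d ^+ 2 by rewrite /q -natr1; ring.
lra.
Qed.

(** A [v] orthogonal to the domain is [p + q] with [A (p, q)]. Then [|p|^2 + <q, p> = 0] and
    accretivity give [p = 0], and [q = 0] because [A] is single-valued. *)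
Lemma domain_dense x (e : R) : 0 < e ->
  exists y z, A (y, z) /\ nrm (x - y) <= e.
Proof.
move=> e0; have [||v hv|u uS ux] := @dense_of_orthogonal (dom A) x cpl.
- by exists 0; case: linA.
- by move=> k u v [y Auy] [y' Avy]; exists (k *: y + y'); exact: linear_relationP.
- have [p [q [Apq vpq]]] := @ontoA 1 v ltr01.
  have p0 : p = 0.
    apply: (ip_eq0 hip); have := hv p (ex_intro _ q Apq).
    rewrite vpq scale1r ipDr (ipC hip p q); have := accA Apq; have := ip_ge0 hip p; lra.
  have q0 : q = 0 by rewrite p0 in Apq; case: opA => _; apply; [exact: Apq | case: linA].
  by rewrite vpq p0 q0 scaler0 addr0 ip0r.
have [n /(_ n (leqnn n)) hn] := ux _ e0; have [y Auy] := uS n.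
by exists (u n), y; rewrite nrmBC.
Qed.

(** A point [y] of the domain is moved into the domain of [A^2] by [resolvent la], at distance at
    most [la * nrm z]; this dictates [la]. *)
Lemma domain2_dense x (e : R) : 0 < e ->
  exists y z w, [/\ A (y, z), A (z, w) & nrm (x - y) <= e].
Proof.
move=> e0; have [y [z [Ayz xy]]] := domain_dense x (divr_gt0 e0 (ltr0n R 2)).
have z1 : 0 < nrm z + 1 by have := nrm_ge0 z; lra.
pose la := e / 2 / (nrm z + 1).
have la0 : 0 < la by rewrite !divr_gt0.
have [w [h _]] := resolventP z la0.
exists (resolvent la y), (resolvent la z), w; split => //; first exact: resolvent_A.
have := nrmB_trans y x (resolvent la y).
have := euler_step 0 la0 Ayz; rewrite /=.
have : la * nrm z <= e / 2.
  by rewrite /la mulrAC ler_pdivrMr//; have := nrm_ge0 z; nra.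
lra.
Qed.

(** Steps are halved so that [euler_doubling] compares consecutive schemes, with summable
    differences. *)
Let dk k : R := 2^-1 ^+ k.
Let dk0 k : 0 < dk k. Proof. by rewrite exprn_gt0. Qed.
Let dkS k : dk k = 2 * dk k.+1. Proof. by rewrite /dk exprS; lra. Qed.

Lemma half_expr_lt (e : R) : 0 < e -> exists n, forall i, (n <= i)%N -> dk i < e.
Proof.
move=> /inv_succ_lt[n hn]; exists n => i ni; apply: le_lt_trans hn.
rewrite /dk exprVn lef_pV2 ?posrE ?exprn_gt0// -natrX ler_nat.
by apply: (leq_trans (ni : (n.+1 <= i.+1)%N)); exact: ltn_expl.
Qed.

Lemma geometric_cvg (u : nat -> V) (C : R) :
  (forall k, nrm (u k - u k.+1) <= C * dk k) -> exists l, ip_cvg u l.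
Proof.
move=> uC; apply: cpl => e e0.
have C0 : 0 <= C by have := le_trans (nrm_ge0 _) (uC 0%N); rewrite /dk expr0 mulr1.
have tail i j : nrm (u i - u (i + j)%N) <= 2 * C * (dk i - dk (i + j)%N).
  elim: j => [|j IH]; first by rewrite addn0 !subrr nrm0 mulr0.
  have := nrmB_trans (u (i + j)%N) (u i) (u (i + j.+1)%N).
  by rewrite !addnS; have := uC (i + j)%N; have := dkS (i + j)%N; nra.
have C4 : 0 < 4 * C + 1 by lra.
have [n hn] := half_expr_lt (divr_gt0 e0 C4).
have one i : (n <= i)%N -> nrm (u n - u i) <= e / 2.
  move=> ni; have := tail n (i - n)%N; rewrite subnKC// => /le_trans; apply.
  have := hn _ (leqnn n); rewrite ltr_pdivlMr//.
  by have := dk0 i; have := dk0 n; nra.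
exists n => i j /one hi /one hj; have := nrmB_trans (u n) (u i) (u j).
by rewrite (nrmBC (u i) (u n)); lra.
Qed.

Let stepk k (t : R) := Num.truncn (t * 2 ^+ k).
Let S k t x := euler (dk k) (stepk k t) x.

Let stepP k t : 0 <= t -> (stepk k t)%:R * dk k <= t < (stepk k t)%:R * dk k + dk k.
Proof.
move=> t0; have tk : 0 <= t * 2 ^+ k by rewrite mulr_ge0 ?exprn_ge0.
have e : t = t * 2 ^+ k * dk k by rewrite /dk exprVn mulfK// lt0r_neq0// exprn_gt0.
have := truncn_itv tk; rewrite -/(stepk k t) => /andP[h1 h2].
rewrite -[X in _ + X]mul1r -mulrDl natr1; apply/andP; split.
  by rewrite {2}e ler_pM2r.
by rewrite {1}e ltr_pM2r.
Qed.

(** In the constant, [t * nrm z] pays for halving the steps and [nrm y] for rounding [t] to a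
    multiple of the step. *)
Let S_cvg_domain2 t x y z : 0 <= t -> A (x, y) -> A (y, z) ->
  exists l, ip_cvg (fun k => S k t x) l.
Proof.
move=> t0 Axy Ayz; apply: (@geometric_cvg _ (t * nrm z + nrm y)) => k.
have d0 := dk0 k.+1; set n := stepk k t.
have /andP[h1 h2] := stepP k t0; have /andP[h3 h4] := stepP k.+1 t0.
rewrite -/n dkS in h1 h2; set m := stepk k.+1 t in h3 h4.
have dbl := euler_doubling n d0 Axy Ayz.
(* The finer scheme makes [n.*2] or [n.*2.+1] steps up to time [t], hence at most one more. *)
have dist : nrm (euler (dk k.+1) n.*2 x - S k.+1 t x) <= dk k.+1 * nrm y.
  have a1 : (n.*2 <= m)%N.
    rewrite -ltnS -(ltr_nat R) -natr1 -muln2 natrM -(ltr_pM2r d0); nra.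
  have a2 : (m <= n.*2.+1)%N.
    rewrite -ltnS -(ltr_nat R) -!natr1 -muln2 natrM -(ltr_pM2r d0); nra.
  rewrite /S -/m; move: a1; rewrite leq_eqVlt => /orP[/eqP <-|a1].
    by rewrite subrr nrm0 mulr_ge0 ?nrm_ge0// ltW.
  have -> : m = n.*2.+1 by apply/eqP; rewrite eqn_leq a1 a2.
  exact: euler_step.
have := nrmB_trans (euler (dk k.+1) n.*2 x) (S k t x) (S k.+1 t x).
have -> : S k t x = euler (2 * dk k.+1) n x by rewrite /S -dkS.
rewrite [X in _ <= _ * X]dkS.
have z0 := nrm_ge0 z; have y0 := nrm_ge0 y.
have : n%:R * dk k.+1 ^+ 2 * nrm z <= t * nrm z * (2 * dk k.+1).
  rewrite expr2 mulrA [leRHS]mulrAC ler_wpM2r// mulrA ler_pM2r//.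
  have := mulr_ge0 (ler0n R n) (ltW d0); nra.
have := mulr_ge0 (mulr_ge0 t0 z0) (ltW d0); nra.
Qed.

(** Convergence on the dense domain of [A^2] spreads to all [x], since every scheme is
    nonexpansive. *)
Lemma exponential_formula t x : 0 <= t -> exists l, ip_cvg (fun k => S k t x) l.
Proof.
move=> t0; apply: cpl => e e0.
have [y [z [w [Ayz Azw xy]]]] := domain2_dense x (divr_gt0 e0 (ltr0n R 4)).
have [l /ip_cvg_cauchy yl] := S_cvg_domain2 t0 Ayz Azw.
have [n hn] := yl _ (divr_gt0 e0 (ltr0n R 2)); exists n => i j ni nj.
have := hn _ _ ni nj; have := nrmB_trans (S i t y) (S i t x) (S j t x).
have := nrmB_trans (S j t y) (S i t y) (S j t x).
have := euler_nonexpansive (stepk i t) x y (dk0 i).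
have := euler_nonexpansive (stepk j t) y x (dk0 j).
by rewrite (nrmBC y x) /S; lra.
Qed.

Section limit.
Context (T : R -> V -> V)
  (T_cvg : forall t x, 0 <= t -> ip_cvg (fun k => S k t x) (T t x)).

(** The term [dk k * C] leaves room for the rounding of times, which disappears in the limit. *)
Let lim_le u l c (B C : R) : ip_cvg u l ->
  (forall k, nrm (u k - c) <= B + dk k * C) -> nrm (l - c) <= B.
Proof.
move=> ul uc; apply/ler_addgt0Pl => e e0.
have C1 : 0 < `|C| + 1 by have := normr_ge0 C; lra.
have [n hn] := ul _ (divr_gt0 e0 (ltr0n R 2)).
have [m hm] := half_expr_lt (divr_gt0 (divr_gt0 e0 (ltr0n R 2)) C1).
have := hn _ (leq_maxl n m); have := hm _ (leq_maxr n m).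
set k := maxn n m; rewrite ltr_pdivlMr// => h1 h2.
have := nrmB_trans (u k) l c; rewrite (nrmBC l (u k)); have := uc k.
have := dk0 k; have := ler_norm C; nra.
Qed.

Let T_linear t : 0 <= t -> linear (T t).
Proof.
move=> t0 k x y; apply: (@ip_cvg_uniq (fun k => S k t _)); first exact: T_cvg.
have := ip_cvgP k (T_cvg x t0) (T_cvg y t0); congr ip_cvg; apply/funext => i.
by rewrite /S euler_linear.
Qed.

Let T_contraction t x : 0 <= t -> nrm (T t x) <= nrm x.
Proof.
by move=> t0; apply: (ip_cvg_le (T_cvg x t0)) => n; exact: euler_contraction.
Qed.

Let T_nonexpansive t x y : 0 <= t -> nrm (T t x - T t y) <= nrm (x - y).
Proof.
by move=> t0; rewrite -linear_funB; [exact: T_contraction | exact: T_linear].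
Qed.

(** The numbers of steps for [s] and [t] add up to that for [s + t], or to one less. On the domain
    of [A] this costs a single step, and density gives the rest. *)
Let T_add s t x : 0 <= s -> 0 <= t -> T (s + t) x = T s (T t x).
Proof.
move=> s0 t0; have st0 := addr_ge0 s0 t0.
have onA y z : A (y, z) -> T (s + t) y = T s (T t y).
  move=> Ayz; apply/eqP; rewrite -subr_eq0; apply/eqP/nrm_eq0.
  apply/ler_addgt0Pl => e e0; rewrite addr0.
  have [n1 h1] := T_cvg y t0 (divr_gt0 e0 (ltr0n R 2)).
  have [n2 h2] := T_cvg (T t y) s0 (divr_gt0 e0 (ltr0n R 2)).
  pose v k := S k (s + t) y.
  suff h k : (maxn n1 n2 <= k)%N -> nrm (v k - T s (T t y)) <= e + dk k * nrm z.
    (* [lim_le] asks for the bound at every index, hence the shifted sequence. *)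
    apply: (@lim_le (fun k => v (maxn n1 n2 + k)%N) _ _ e (nrm z)) => [|k].
      move=> e' e'0; have [n hn] := T_cvg y st0 e'0.
      by exists n => i ni; apply: hn; rewrite (leq_trans ni)// leq_addl.
    apply: le_trans (h _ (leq_addr _ _)) _; rewrite lerD2l ler_wpM2r ?nrm_ge0//.
    by rewrite /dk ler_wiXn2l ?leq_addl//; lra.
  rewrite geq_max => /andP[/h1 h1k /h2 h2k].
  have d0 := dk0 k.
  have comp : nrm (v k - S k s (S k t y)) <= dk k * nrm z.
    have /andP[a1 a2] := stepP k s0; have /andP[b1 b2] := stepP k t0.
    have /andP[c1 c2] := stepP k st0; rewrite /v /S.
    set m := stepk k s in a1 a2 *; set n := stepk k t in b1 b2 *.
    set q := stepk k (s + t) in c1 c2 *.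
    have q1 : (m + n <= q)%N.
      by rewrite -ltnS -(ltr_nat R) -natr1 natrD -(ltr_pM2r d0); nra.
    have q2 : (q <= (m + n).+1)%N.
      by rewrite -ltnS -(ltr_nat R) -!natr1 natrD -(ltr_pM2r d0); nra.
    rewrite /euler -iterD; move: q1; rewrite leq_eqVlt => /orP[/eqP <-|q1].
      by rewrite subrr nrm0 mulr_ge0 ?nrm_ge0// ltW.
    have -> : q = (m + n).+1 by apply/eqP; rewrite eqn_leq q1 q2.
    by rewrite nrmBC; exact: euler_step.
  have := nrmB_trans (S k s (S k t y)) (v k) (T s (T t y)).
  have := nrmB_trans (S k s (T t y)) (S k s (S k t y)) (T s (T t y)).
  have := euler_nonexpansive (stepk k s) (S k t y) (T t y) d0.
  by rewrite -!/(S k s _); lra.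
apply/eqP; rewrite -subr_eq0; apply/eqP/nrm_eq0.
apply/ler_addgt0Pl => e e0; rewrite addr0.
have [y [z [Ayz xy]]] := domain_dense x (divr_gt0 e0 (ltr0n R 2)).
have := nrmB_trans (T (s + t) y) (T (s + t) x) (T s (T t x)).
rewrite (onA _ _ Ayz); have := T_nonexpansive x y st0.
rewrite (onA _ _ Ayz).
have := T_nonexpansive (T t y) (T t x) s0; have := T_nonexpansive y x t0.
by rewrite (nrmBC y x); lra.
Qed.

Let T_dist t x y : 0 <= t -> A (x, y) -> nrm (T t x - x) <= t * nrm y.
Proof.
move=> t0 Axy; apply: (lim_le (C := 0) (T_cvg x t0)) => k.
rewrite mulr0 addr0 nrmBC; apply: le_trans (euler_dist _ (dk0 k) Axy) _.
by rewrite ler_wpM2r ?nrm_ge0//; case/andP: (stepP k t0).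
Qed.

(** The vector [y = A x] may lie outside the domain, where the scheme has no rate; it is compared
    with a nearby [w] of the domain, once before and once after the steps, whence the factor [2]. *)
Let T_derivative t x y w w' : 0 <= t -> A (x, y) -> A (w, w') ->
  nrm (T t x - (x - t *: y)) <= t * (2 * nrm (y - w) + t * nrm w').
Proof.
move=> t0 Axy Aww; apply: (lim_le (C := nrm y) (T_cvg x t0)) => k.
have /andP[h1 h2] := stepP k t0; have d0 := dk0 k.
rewrite /S; set n := stepk k t in h1 h2 *; clearbody n.
have := @euler_derivative (dk k) n x y (2 * nrm (y - w) + t * nrm w') d0 Axy.
have w0 := nrm_ge0 w'; have y0 := nrm_ge0 y; have yw0 := nrm_ge0 (y - w).
move=> /(_ _)/le_trans step.
have {}step : nrm (euler (dk k) n x - x + (n%:R * dk k) *: y) <= t * (2 * nrm (y - w) + t * nrm w').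
  apply: step => [i ni|]; last first.
    by rewrite ler_wpM2r// addr_ge0 ?mulr_ge0.
  have := nrmB_trans (euler (dk k) i w) (euler (dk k) i y) y.
  have := nrmB_trans w (euler (dk k) i w) y.
  have := euler_nonexpansive i y w d0; have := euler_dist i d0 Aww.
  rewrite (nrmBC w y) (nrmBC w); have : i%:R * dk k * nrm w' <= t * nrm w'.
    by rewrite ler_wpM2r//; apply: le_trans h1; rewrite ler_pM2r// ler_nat.
  lra.
have -> : euler (dk k) n x - (x - t *: y) =
   (euler (dk k) n x - x + (n%:R * dk k) *: y) + (t - n%:R * dk k) *: y.
  by apply: ip_inj => z; rewrite !(ipBl, ipDl, ipZl, ipNl); ring.
apply: le_trans (nrmD _ _) _; rewrite nrmZ ger0_norm ?subr_ge0//.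
by apply: lerD => //; rewrite ler_wpM2r//; lra.
Qed.

Let T_semigroup : C0_contraction_semigroup ip T.
Proof.
split => //.
  move=> x; apply: (@ip_cvg_uniq (fun k => S k 0 x)); first exact: T_cvg.
  have -> : (fun k => S k 0 x) = fun=> x; last exact: ip_cvg_cst.
  by apply/funext => k; rewrite /S /stepk mul0r truncn0.
move=> x; apply/cvg0_rightP => [t|e e0]; first exact: nrm_ge0.
have [y [z [Ayz xy]]] := domain_dense x (divr_gt0 e0 (ltr0n R 4)).
have z1 : 0 < nrm z + 1 by have := nrm_ge0 z; lra.
exists (e / 2 / (nrm z + 1)) => [|t t0 td]; first by rewrite !divr_gt0.
have := nrmB_trans (T t y) (T t x) x; have := nrmB_trans y (T t y) x.
have := T_dist (ltW t0) Ayz; have := T_nonexpansive x y (ltW t0).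
rewrite (nrmBC y x); rewrite ltr_pdivlMr// in td.
by have := nrm_ge0 z; nra.
Qed.

Lemma semigroup_generates : generates_C0_contraction_semigroup ip (opp_rel A).
Proof.
exists T => //.
have sub x y : A (x, y) -> generator ip T (x, - y).
  move=> Axy; apply/cvg0_rightP => [t|e e0]; first exact: nrm_ge0.
  have [w [w' [Aww yw]]] := domain_dense y (divr_gt0 e0 (ltr0n R 4)).
  have w1 : 0 < nrm w' + 1 by have := nrm_ge0 w'; lra.
  exists (e / 2 / (nrm w' + 1)) => [|t t0 td /=]; first by rewrite !divr_gt0.
  have -> : t^-1 *: (T t x - x) - - y = t^-1 *: (T t x - (x - t *: y)).
    by apply: ip_inj => z; rewrite !(ipBl, ipZl, ipNl); field; rewrite lt0r_neq0.
  rewrite nrmZ gtr0_norm ?invr_gt0// ler_pdivrMl//.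
  apply: le_trans (T_derivative (ltW t0) Axy Aww) _; rewrite ler_pM2l//.
  rewrite ltr_pdivlMr// in td; have := nrm_ge0 w'; nra.
rewrite eqEsubset; split => -[x y] /=; last first.
  by move=> /sub; rewrite opprK.
(* For the converse inclusion, [z + A z = x - y] is solved. Then [(x - z, y + w)] belongs to the
   generator and has equal components, so dissipativity gives [x = z]. *)
move=> gxy; have [z [w [Azw e]]] := @ontoA 1 (x - y) ltr01.
have := generatorB T_semigroup gxy (sub _ _ Azw).
move=> /(generator_dissipative T_semigroup).
have yw : y - - w = x - z.
  apply: ip_inj => u; have := congr1 (ip^~ u) e.
  by rewrite !(ipBl, ipDl, ipZl, ipNl); lra.
rewrite yw => xz; have /eqP : x - z = 0.
  by apply: (ip_eq0 hip); apply/eqP; rewrite eq_le xz (ip_ge0 hip).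
rewrite subr_eq0 => /eqP xz0; move: yw; rewrite xz0 subrr opprK => /eqP.
by rewrite addr_eq0 /opp_rel/= => /eqP ->; rewrite opprK.
Qed.

End limit.

Lemma lumer_phillips : generates_C0_contraction_semigroup ip (opp_rel A).
Proof.
have /choice[T Tc] : forall tx : R * V, exists l,
    0 <= tx.1 -> ip_cvg (fun k => S k tx.1 tx.2) l.
  move=> [t x]; have [t0|t0] := leP 0 t; last by exists 0.
  by have [l h] := exponential_formula x t0; exists l.
by apply: (@semigroup_generates (fun t x => T (t, x))) => t x; exact: (Tc (t, x)).
Qed.

End generation.

End hilbert.

(** * Square-integrable functions *)

Section square_integrable.
Context d (T : measurableType d) (R : realType) (mu : {measure set T -> \bar R}).

Lemma Lfun_measurable (p : \bar R) (f : T -> R) : f \in Lfun mu p -> measurable_fun setT f.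
Proof. by move=> /sub_Lfun_mfun; rewrite inE. Qed.

Lemma Lfun2P (f : T -> R) : f \in Lfun mu 2%:E <->
  measurable_fun setT f /\ mu.-integrable setT (EFin \o (fun x => f x ^+ 2)).
Proof.
split=> [fL|[mf intf]].
  by split; [exact: Lfun_measurable fL | exact: Lfun2_integrable_sqr].
rewrite inE; apply/andP; split; rewrite inE//= /finite_norm unlock poweR_lty//.
case/integrableP : intf => _; apply: le_lt_trans.
rewrite le_eqVlt; apply/orP; left; apply/eqP/eq_integral => x _.
by rewrite /= powR_mulrn// -normrX.
Qed.

Lemma Lfun2_lin (k : R) (f g : T -> R) : f \in Lfun mu 2%:E ->
  g \in Lfun mu 2%:E -> (fun x => k * f x + g x) \in Lfun mu 2%:E.
Proof.
move=> fL gL.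
exact: (LfunP (k *: Lfun_Sub (lee1n 2) fL + Lfun_Sub (lee1n 2) gL)).
Qed.

Lemma Lfun2_cst0 : (fun _ : T => 0 : R) \in Lfun mu 2%:E.
Proof. exact: (LfunP (0 : LfunType mu (lee1n 2))). Qed.

Lemma Lfun2Z (k : R) (f : T -> R) : f \in Lfun mu 2%:E ->
  (fun x => k * f x) \in Lfun mu 2%:E.
Proof.
move=> fL; have := Lfun2_lin k fL Lfun2_cst0.
by under eq_fun do rewrite addr0.
Qed.

Lemma Lfun2D (f g : T -> R) : f \in Lfun mu 2%:E -> g \in Lfun mu 2%:E ->
  (fun x => f x + g x) \in Lfun mu 2%:E.
Proof.
by move=> fL gL; have := Lfun2_lin 1 fL gL; under eq_fun do rewrite mul1r.
Qed.

Lemma Lfun2B (f g : T -> R) : f \in Lfun mu 2%:E -> g \in Lfun mu 2%:E ->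
  (fun x => f x - g x) \in Lfun mu 2%:E.
Proof.
move=> fL gL; have := Lfun2_lin (-1) gL fL.
by under eq_fun do rewrite mulN1r addrC.
Qed.

Lemma Lfun2_sum (I : Type) (s : seq I) (f : I -> T -> R) :
  (forall i, f i \in Lfun mu 2%:E) -> (fun x => \sum_(i <- s) f i x) \in Lfun mu 2%:E.
Proof.
move=> fL; elim: s => [|i s IH].
  by under eq_fun do rewrite big_nil; exact: Lfun2_cst0.
by under eq_fun do rewrite big_cons; exact: Lfun2D.
Qed.

Lemma Lfun2_integrableM (f g : T -> R) : f \in Lfun mu 2%:E ->
  g \in Lfun mu 2%:E -> mu.-integrable setT (EFin \o (fun x => f x * g x)).
Proof. by move=> fL gL; apply/Lfun1_integrable; exact: Lfun2_mul_Lfun1. Qed.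

Lemma ae_eq_Rintegral (f g : T -> R) : measurable_fun setT f ->
  measurable_fun setT g -> {ae mu, forall x, f x = g x} ->
  \int[mu]_x f x = \int[mu]_x g x.
Proof.
move=> mf mg fg; congr fine; apply: ae_eq_integral => //.
- exact/measurable_EFinP.
- exact/measurable_EFinP.
- by apply: filterS fg => x fgx _; rewrite fgx.
Qed.

Lemma ae_Lfun2 (f g : T -> R) : f \in Lfun mu 2%:E -> measurable_fun setT g ->
  {ae mu, forall x, f x = g x} -> g \in Lfun mu 2%:E.
Proof.
move=> /Lfun2P[mf /integrableP[_ fi]] mg fg; apply/Lfun2P; split=> //.
have mg2 : measurable_fun setT (EFin \o (fun x => g x ^+ 2)).
  by apply/measurable_EFinP; exact: measurable_funX.
apply/integrableP; split => //; apply: le_lt_trans fi.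
rewrite le_eqVlt; apply/orP; left; apply/eqP; apply: ae_eq_integral => //.
- exact: measurableT_comp.
- by apply: measurableT_comp => //; apply/measurable_EFinP; exact: measurable_funX.
- by apply: filterS fg => x fgx _; rewrite /= fgx.
Qed.

Lemma Rintegral_sum (I : Type) (s : seq I) (f : I -> T -> R) :
  (forall i, mu.-integrable setT (EFin \o f i)) ->
  mu.-integrable setT (EFin \o (fun x => \sum_(i <- s) f i x)) /\
  \int[mu]_x (\sum_(i <- s) f i x) = \sum_(i <- s) \int[mu]_x f i x.
Proof.
move=> fi; elim: s => [|i s [IHi IH]].
  under eq_fun do rewrite big_nil; split; first exact: integrable0.
  by rewrite big_nil /Rintegral integral0.
split.
  under eq_fun do rewrite big_cons.
  exact: (integrableD measurableT (fi i) IHi).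
under eq_Rintegral do rewrite big_cons.
by rewrite RintegralD// big_cons IH.
Qed.

(** Each term is at most the sum, so the weights [4 ^+ k] force increments of order [2 ^- k]. This
    is the pointwise criterion behind the completeness of [L^2]. *)
Lemma sqr_summable_cvg (v : nat -> R) :
  (\sum_(k <oo) (4 ^+ k * (v k.+1 - v k) ^+ 2)%:E < +oo)%E -> cvgn v.
Proof.
have t0 k : (0 <= (4 ^+ k * (v k.+1 - v k) ^+ 2)%:E)%E.
  by rewrite lee_fin mulr_ge0 ?sqr_ge0 ?exprn_ge0.
set S := (\sum_(k <oo) _)%E => Soo.
have S0 : (0 <= S)%E by apply: nneseries_ge0.
have Sf : S \is a fin_num by rewrite ge0_fin_numE.
set M := fine S; have M0 : 0 <= M by exact: fine_ge0.
have bnd k : `|v k.+1 - v k| <= (M + 1) * 2^-1 ^+ k.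
  have h : 4 ^+ k * (v k.+1 - v k) ^+ 2 <= M.
    rewrite -lee_fin fineK//; apply: le_trans (nneseries_lim_ge k.+1 _) => //.
    by rewrite big_nat_recr//= leeDr// sume_ge0.
  (* Bounding [M] by [(M + 1) ^+ 2] avoids a square root. *)
  have h2 : (2 ^+ k * `|v k.+1 - v k|) ^+ 2 <= (M + 1) ^+ 2.
    rewrite exprMn -normrX ger0_norm ?sqr_ge0// -exprM mulnC exprM.
    have -> : 2 ^+ 2 = 4 :> R by ring.
    by apply: le_trans h _; nra.
  rewrite ler_pXn2r ?nnegrE ?addr_ge0 ?mulr_ge0 ?exprn_ge0// in h2.
  by rewrite exprVn ler_pdivlMr ?exprn_gt0// mulrC.
have cs : cvgn (series (telescope v)).
  apply: normed_cvg; apply: (@series_le_cvg _ _ (geometric (M + 1) 2^-1)) => [n|n|n|].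
  - by rewrite /=.
  - by rewrite mulr_ge0 ?addr_ge0 ?exprn_ge0.
  - exact: bnd.
  - by apply: is_cvg_geometric_series; rewrite gtr0_norm// invf_lt1// ltr1n.
have -> : v = (fun n => v 0%N + series (telescope v) n).
  by apply/funext => n; exact: eq_sum_telescope.
by apply: is_cvgD => //; exact: is_cvg_cst.
Qed.

Lemma limn_einf_le (v : nat -> \bar R) (e : \bar R) n :
  (forall k, (n <= k)%N -> (v k <= e)%E) -> (limn_einf v <= e)%E.
Proof.
move=> ve; rewrite limn_einf_lim; apply: lime_le; first exact: is_cvg_einfs.
apply: nearW => m; apply: le_trans (ve (maxn n m) (leq_maxl _ _)).
by apply: ereal_inf_lbound; exists (maxn n m) => //=; exact: leq_maxr.
Qed.

(** Riesz-Fischer: a rapidly Cauchy subsequence converges almost everywhere, and Fatou's lemma along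
    it bounds the distance of [u i] to the limit. *)
Lemma Lfun2_complete (u : nat -> T -> R) : (forall n, u n \in Lfun mu 2%:E) ->
  (forall e : R, 0 < e -> exists n, forall i j, (n <= i)%N -> (n <= j)%N ->
    \int[mu]_x (u i x - u j x) ^+ 2 <= e) ->
  exists l, l \in Lfun mu 2%:E /\ forall e : R, 0 < e ->
    exists n, forall i, (n <= i)%N -> \int[mu]_x (u i x - l x) ^+ 2 <= e.
Proof.
move=> uL cauchy.
have int_sqr f g : f \in Lfun mu 2%:E -> g \in Lfun mu 2%:E ->
    mu.-integrable setT (EFin \o (fun x => (f x - g x) ^+ 2)).
  by move=> fL gL; case: ((Lfun2P _).1 (Lfun2B fL gL)).
have intE f g : f \in Lfun mu 2%:E -> g \in Lfun mu 2%:E ->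
    (\int[mu]_x ((f x - g x) ^+ 2)%:E)%E = (\int[mu]_x (f x - g x) ^+ 2)%:E.
  by move=> fL gL; rewrite /Rintegral fineK//; apply: integrable_fin_num => //; exact: int_sqr.
(* The division by [4 ^+ k] cancels the weight in [D]; what remains sums to at most [1]. *)
have e0 k : 0 < (2 ^ k.+1)%:R^-1 / 4 ^+ k :> R.
  by rewrite divr_gt0 ?exprn_gt0// invr_gt0 ltr0n expn_gt0.
have /choice[N NP] : forall k, exists n, forall i j, (n <= i)%N -> (n <= j)%N ->
    \int[mu]_x (u i x - u j x) ^+ 2 <= (2 ^ k.+1)%:R^-1 / 4 ^+ k.
  by move=> k; exact: cauchy.
(* A sum, rather than [N k], makes the indices strictly increasing. *)
pose phi k := (\sum_(j < k.+1) (N j).+1)%N.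
have phiS k : phi k.+1 = (phi k + (N k.+1).+1)%N by rewrite /phi big_ord_recr.
have phiN k : (N k <= phi k)%N by rewrite /phi big_ord_recr/=; apply: leq_trans (leq_addl _ _).
have phik k : (k <= phi k)%N.
  by elim: k => // k IH; rewrite phiS addnS ltnS (leq_trans IH)// leq_addr.
pose D k x := 4 ^+ k * (u (phi k.+1) x - u (phi k) x) ^+ 2.
have mD k : measurable_fun setT (EFin \o D k).
  apply/measurable_EFinP; apply: measurable_funM => //.
  by apply: measurable_funX; apply: measurable_funB; exact: Lfun_measurable.
have D0 k x : (0 <= (EFin \o D k) x)%E.
  by rewrite lee_fin mulr_ge0 ?sqr_ge0 ?exprn_ge0.
have G0 x : (0 <= \sum_(k <oo) (D k x)%:E)%E.
  by apply: nneseries_ge0 => k _ _; exact: D0.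
have sumD : {ae mu, forall x, (\sum_(k <oo) (D k x)%:E < +oo)%E}.
  have mG : measurable_fun setT (fun x => \sum_(k <oo) (D k x)%:E)%E.
    apply: ge0_emeasurable_sum => [k x _ _|k _]; [exact: D0 | exact: mD].
  suff : mu.-integrable setT (fun x => \sum_(k <oo) (D k x)%:E)%E.
    move=> /(integrable_ae measurableT); apply: filterS => x /(_ I).
    by rewrite ge0_fin_numE.
  apply/integrableP; split => //.
  under eq_integral => x _ do rewrite gee0_abs//.
  rewrite integral_nneseries//; last by move=> k x _; exact: D0.
  apply: (@le_lt_trans _ _ (\sum_(0 <= i <oo) (1 / (2 ^ i.+1)%:R)%:E)%E); last first.
    by apply: le_lt_trans (epsilon_trick0 xpredT ler01) _; rewrite ltry.
  apply: lee_nneseries => [k _ _|k _]; first by apply: integral_ge0 => x _; exact: D0.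
  rewrite /= (_ : (fun x => (D k x)%:E) =
      fun x => ((4 ^+ k)%:E * ((u (phi k.+1) x - u (phi k) x) ^+ 2)%:E)%E)//.
  rewrite integralZl//; last exact: int_sqr.
  rewrite intE// -EFinM lee_fin -ler_pdivlMl ?exprn_gt0// mul1r mulrC.
  by apply: NP; [rewrite phiS (leq_trans (phiN k))// leq_addr | exact: phiN].
(* The upper limit is measurable without any convergence; [fine] supplies a real value where it is
   infinite. *)
pose l x := fine (limn_esup (fun k => (u (phi k) x)%:E)).
have ml : measurable_fun setT l.
  apply: measurableT_comp; first exact: fine_measurable.
  apply: measurable_fun_limn_esup => k.
  by apply/measurable_EFinP; exact: Lfun_measurable.
have ul : {ae mu, forall x, u (phi k) x @[k --> \oo] --> l x}.
  apply: filterS sumD => x /sqr_summable_cvg cx.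
  rewrite /l; suff -> : limn_esup (fun k => (u (phi k) x)%:E) =
    (limn (fun k => u (phi k) x))%:E by [].
  have h : (u (phi k) x)%:E @[k --> \oo] --> (limn (fun k => u (phi k) x))%:E.
    by apply: cvg_EFin; [exact: nearW | exact: cx].
  by have [_ ->] := cvg_limn_einf_sup h.
have main e : 0 < e -> exists n, forall i, (n <= i)%N ->
    (\int[mu]_x ((u i x - l x) ^+ 2)%:E <= e%:E)%E.
  move=> /cauchy[n hn]; exists n => i ni.
  pose F k x := ((u i x - u (phi k) x) ^+ 2)%:E.
  have mF k : measurable_fun setT (F k).
    apply/measurable_EFinP; apply: measurable_funX; apply: measurable_funB;
    exact: Lfun_measurable.
  have F0 k x : setT x -> (0 <= F k x)%E by rewrite lee_fin sqr_ge0.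
  have -> : (\int[mu]_x ((u i x - l x) ^+ 2)%:E = \int[mu]_x limn_einf (F^~ x))%E.
    apply: ae_eq_integral => //.
    - apply/measurable_EFinP; apply: measurable_funX; apply: measurable_funB => //.
      exact: Lfun_measurable.
    - have -> : (fun x => limn_einf (F^~ x)) = (fun x => - limn_esup (fun k => - F k x))%E.
        by [].
      apply: measurableT_comp => //; apply: measurable_fun_limn_esup => k.
      exact: measurableT_comp.
    - apply: filterS ul => x ulx _; apply/esym.
      suff h : F k x @[k --> \oo] --> ((u i x - l x) ^+ 2)%:E.
        by have [-> _] := cvg_limn_einf_sup h.
      apply: cvg_EFin; first exact: nearW.
      have c : (u i x - u (phi k) x) @[k --> \oo] --> u i x - l x.
        by apply: cvgB => //; exact: cvg_cst.
      exact: (cvgM c c).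
  apply: le_trans (fatou mu measurableT mF F0) _.
  apply: (@limn_einf_le _ _ n) => k nk; rewrite /F intE// lee_fin.
  by apply: hn => //; apply: leq_trans nk (phik k).
have sub i e : (\int[mu]_x ((u i x - l x) ^+ 2)%:E <= e%:E)%E ->
    (fun x => u i x - l x) \in Lfun mu 2%:E.
  move=> h; have mul : measurable_fun setT (fun x => u i x - l x).
    by apply: measurable_funB => //; exact: Lfun_measurable.
  apply/Lfun2P; split => //; apply/integrableP; split.
    by apply/measurable_EFinP; exact: measurable_funX.
  apply: (@le_lt_trans _ _ e%:E); last by rewrite ltry.
  by under eq_integral do rewrite gee0_abs ?lee_fin ?sqr_ge0//.
exists l; split.
  have [n /(_ n (leqnn n)) /sub h] := main _ ltr01.
  by have := Lfun2B (uL n) h; under eq_fun do rewrite subKr.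
move=> e /main[n hn]; exists n => i /hn.
by move=> /[dup] /sub h; rewrite -lee_fin /Rintegral fineK//; apply: integrable_fin_num => //; case: ((Lfun2P _).1 h).
Qed.

End square_integrable.

(** * Sobolev functions on an interval *)

Section smooth_functions.
Context (R : realType).

Definition smooth (f : R -> R) := forall n z, derivable (f^`(n)%classic) z 1.

(** Coinduction for smoothness: a class of derivable functions stable under derivation replaces
    formulas for the iterated derivatives. *)
Lemma smooth_stable (K : set (R -> R)) : (forall f, K f -> forall z, derivable f z 1) ->
  (forall f, K f -> K f^`()%classic) -> forall f, K f -> smooth f.
Proof.
move=> dK K1 f Kf n z; elim: n f Kf => [|n IH] f Kf; first by rewrite derive1n0; exact: dK.
by rewrite derive1Sn; exact/IH/K1.
Qed.

Lemma smooth_derivable f : smooth f -> forall z, derivable f z 1.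
Proof. by move=> /(_ 0%N); rewrite derive1n0. Qed.

Lemma smooth_derive1 f : smooth f -> smooth f^`()%classic.
Proof. by move=> sf n z; rewrite -derive1Sn; exact: sf. Qed.

Lemma derivable_continuous (f : R -> R) : (forall z, derivable f z 1) -> continuous f.
Proof. by move=> df z; exact/differentiable_continuous/derivable1_diffP. Qed.

Lemma smooth_continuous f : smooth f -> continuous f.
Proof. by move=> /smooth_derivable; exact: derivable_continuous. Qed.

Lemma is_derive_lin (k l df dg : R) (f g : R -> R) (z : R) : is_derive z 1 f df ->
  is_derive z 1 g dg ->
  is_derive z 1 (fun x => k * f x + l * g x) (k * df + l * dg).
Proof.
by move=> hf hg; exact: (is_deriveD (is_deriveZ k hf) (is_deriveZ l hg)).
Qed.

Lemma is_derive_congr (f g : R -> R) (z df dg : R) : is_derive z 1 f df ->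
  f =1 g -> df = dg -> is_derive z 1 g dg.
Proof. by move=> h /funext <- <-. Qed.

Lemma derivable_is_derive1 (f : R -> R) (z : R) : derivable f z 1 -> is_derive z 1 f (f^`()%classic z).
Proof. by move=> df; rewrite derive1E; exact: derivableP. Qed.

Lemma is_derive_funE (f df : R -> R) : (forall z : R, is_derive z 1 f (df z)) ->
  f^`()%classic = df.
Proof. by move=> h; apply/funext => z; rewrite derive1E; case: (h z). Qed.

Lemma smooth_lin k l f g : smooth f -> smooth g -> smooth (fun x => k * f x + l * g x).
Proof.
move=> sf sg.
pose K : set (R -> R) := [set h | exists p q, [/\ smooth p, smooth q & h = fun x => k * p x + l * q x]].
have dK p q (z : R) : smooth p -> smooth q -> is_derive z 1 (fun x => k * p x + l * q x)
    (k * p^`()%classic z + l * q^`()%classic z).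
  by move=> sp sq; apply: is_derive_lin; apply: derivable_is_derive1; exact: smooth_derivable.
apply: (@smooth_stable K); last by exists f, g.
  by move=> _ [p [q [sp sq ->]]] z; case: (dK p q z sp sq).
move=> _ [p [q [sp sq ->]]]; exists p^`()%classic, q^`()%classic.
split; [exact: smooth_derive1 | exact: smooth_derive1 |].
by apply: is_derive_funE => z; exact: dK.
Qed.

(** The powers [x^-k] make the span of this family stable under derivation. The parameter [s] later
    tends to [0], to turn bumps into indicator functions. *)
Definition flat_exp (s : R) k (x : R) : R :=
  if 0 < x then x^-1 ^+ k * expR (- (s / x)) else 0.

(** The exponential series gives [exp y >= y^(k+2) / (k+2)!] at [y = s / x], whence [C]. The
    exponent [2] on the right makes the derivative at [0] vanish. *)
Lemma flat_exp_le s k : 0 < s ->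
  exists2 C : R, 0 < C & forall x, `|flat_exp s k x| <= C * x ^+ 2.
Proof.
move=> s0; pose C := (k.+2)`!%:R / s ^+ k.+2.
exists C => [|x]; first by rewrite divr_gt0 ?exprn_gt0// ltr0n fact_gt0.
have C0 : 0 <= C by rewrite divr_ge0 ?exprn_ge0 ?(ltW s0)// ler0n.
rewrite /flat_exp; case: ifPn => x0; last by rewrite normr0 mulr_ge0 ?sqr_ge0.
rewrite ger0_norm; last by rewrite mulr_ge0 ?expR_ge0 ?exprn_ge0// invr_ge0 ltW.
have sx : 0 <= s / x by rewrite divr_ge0// ltW.
have h : (s / x) ^+ k.+2 / (k.+2)`!%:R <= expR (s / x).
  by apply: le_trans (expR_ge1Dxn k.+1 sx); rewrite lerDr.
have f0 : 0 < (k.+2)`!%:R :> R by rewrite ltr0n fact_gt0.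
rewrite expRN ler_pdivrMr ?expR_gt0//; apply: le_trans (_ : _ <= C * x ^+ 2 * ((s / x) ^+ k.+2 / (k.+2)`!%:R)) _; last first.
  by rewrite ler_wpM2l// mulr_ge0 ?sqr_ge0.
rewrite le_eqVlt; apply/orP; left; apply/eqP.
rewrite /C !exprMn !exprS; field.
by rewrite !lt0r_neq0// ?exprn_gt0.
Qed.

Lemma is_derive0_sqr_bound (C : R) (f : R -> R) : 0 < C -> (forall x, `|f x| <= C * x ^+ 2) ->
  is_derive (0 : R) 1 f 0.
Proof.
move=> C0 fC; have f0 : f 0 = 0.
  by apply/eqP; rewrite -normr_le0; apply: le_trans (fC 0) _; rewrite expr0n mulr0.
have cv : h^-1 *: ((f \o shift 0) (h *: 1) - f 0) @[h --> 0^'] --> (0 : R).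
  apply/cvgrPdist_le => e e0; near=> h.
  have h0 : 0 < `|h| by rewrite normr_gt0; near: h; exact: nbhs_dnbhs_neq.
  rewrite /= f0 subr0 addr0 sub0r normrN normrM normfV ler_pdivrMl//.
  rewrite [h *: 1]mulr1; apply: le_trans (fC h) _.
  rewrite -real_normK ?num_real// expr2 mulrA [leRHS]mulrC ler_pM2r//.
  rewrite -ler_pdivlMl// mulrC ltW//; near: h; apply: dnbhs0_lt.
  by rewrite divr_gt0.
by apply: DeriveDef; [apply/cvg_ex; exists 0 | exact/cvg_lim].
Unshelve. all: by end_near. Qed.

Lemma is_derive_flat_exp s k (x : R) : 0 < s ->
  is_derive x 1 (flat_exp s k) (s * flat_exp s k.+2 x + (- k%:R) * flat_exp s k.+1 x).
Proof.
move=> s0; have [x0|x0|<-] := ltgtP 0 x.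
- have xn : x != 0 by rewrite lt0r_neq0.
  apply: (@near_eq_is_derive R R R (fun x => x^-1 ^+ k * expR (- (s / x))) _ x 1).
    near=> y; rewrite /flat_exp ifT//; near: y; exact: lt_nbhsr.
  rewrite /flat_exp x0.
  have dV : is_derive x 1 (fun y : R => y^-1) (- x ^- 2).
    by apply: is_derive_congr (is_deriveV xn (is_derive_id x 1)) _ (mulr1 _).
  have dX : is_derive x 1 (fun y : R => y^-1 ^+ k) (k%:R * x^-1 ^+ k.-1 * - x ^- 2).
    by apply: is_derive_congr (is_deriveX k dV) _ _ => // y; rewrite exprfctE.
  have dE : is_derive x 1 (fun y : R => expR (- (s / y))) (expR (- (s / x)) * - (s * - x ^- 2)).
    apply: (@is_derive1_comp _ expR (fun y : R => - (s / y))).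
  apply: is_derive_congr (is_deriveM dX dE) _ _ => //.
  case: k {dX} => [|k] /=; rewrite /GRing.scale/= ?exprS ?expr0; field; rewrite //.
- apply: (@near_eq_is_derive R R R (fun=> 0) _ x 1).
    by near=> y; rewrite /flat_exp ltNge ltW//; near: y; exact: lt_nbhsl.
  by rewrite /flat_exp ltNge (ltW x0)/= !mulr0 addr0; exact: is_derive_cst.
have [C C0 hC] := flat_exp_le k s0.
rewrite /flat_exp ltxx !mulr0 addr0; exact: is_derive0_sqr_bound hC.
Unshelve. all: by end_near. Qed.

Context (s c d : R) (s0 : 0 < s).

(** The class to which [smooth_stable] is applied: it contains [bump] and the derivatives of its
    members. *)
Inductive bump_span : (R -> R) -> Prop :=
| bump_gen k l : bump_span (fun x => flat_exp s k (x - c) * flat_exp s l (d - x))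
| bump_lin p q f g : bump_span f -> bump_span g ->
    bump_span (fun x => p * f x + q * g x).

Lemma bump_span_derive f : bump_span f -> exists2 g, bump_span g &
  forall z : R, is_derive z 1 f (g z).
Proof.
elim=> {f} [k l|p q f g _ [f' sf df] _ [g' sg dg]]; last first.
  exists (fun x => p * f' x + q * g' x); first exact: bump_lin.
  by move=> z; exact: is_derive_lin.
pose G k l x := flat_exp s k (x - c) * flat_exp s l (d - x).
exists (fun x => 1 * (s * G k.+2 l x + (- k%:R) * G k.+1 l x) +
                 1 * ((- s) * G k l.+2 x + l%:R * G k l.+1 x)).
  by apply: bump_lin; apply: bump_lin; exact: bump_gen.
move=> z.
have d1 : is_derive z 1 (fun x => flat_exp s k (x - c))
    ((s * flat_exp s k.+2 (z - c) + (- k%:R) * flat_exp s k.+1 (z - c)) * 1).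
  apply: (@is_derive1_comp _ (flat_exp s k) (fun x => x - c)).
    exact: is_derive_flat_exp.
  by have := is_deriveB (is_derive_id z 1) (is_derive_cst c z 1); rewrite subr0.
have d2 : is_derive z 1 (fun x => flat_exp s l (d - x))
    ((s * flat_exp s l.+2 (d - z) + (- l%:R) * flat_exp s l.+1 (d - z)) * - 1).
  apply: (@is_derive1_comp _ (flat_exp s l) (fun x => d - x)).
    exact: is_derive_flat_exp.
  by have := is_deriveB (is_derive_cst d z 1) (is_derive_id z 1); rewrite sub0r.
apply: is_derive_congr (is_deriveM d1 d2) _ _ => //.
by rewrite /GRing.scale/= /G; ring.
Qed.

(** Values lie in [[0, 1]] and tend to the indicator of []c, d[] as [s] tends to [0]. *)
Definition bump x := flat_exp s 0 (x - c) * flat_exp s 0 (d - x).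

Lemma smooth_bump : smooth bump.
Proof.
apply: (@smooth_stable bump_span) => [f /bump_span_derive[g _ fg] z|f /bump_span_derive[g sg fg]|].
- by case: (fg z).
- by rewrite (is_derive_funE fg).
- exact: bump_gen.
Qed.

Lemma bump_out x : ~~ (c < x < d) -> bump x = 0.
Proof.
rewrite /bump /flat_exp !subr_gt0; case: ifP => _; last by rewrite mul0r.
by case: ifP => //; rewrite mulr0.
Qed.

Lemma bump_in x : c < x < d -> bump x = expR (- (s * ((x - c)^-1 + (d - x)^-1))).
Proof.
move=> /andP[cx xd]; rewrite /bump /flat_exp !subr_gt0 cx xd !expr0 !mul1r -expRD.
by congr expR; rewrite mulrDr opprD.
Qed.

Lemma bump_itv01 x : 0 <= bump x <= 1.
Proof.
have [cxd|ncxd] := boolP (c < x < d); last by rewrite bump_out// lexx ler01.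
rewrite bump_in// expR_ge0/= -expR0 ler_expR oppr_le0 mulr_ge0 ?(ltW s0)//.
by case/andP: cxd => cx xd; rewrite addr_ge0// invr_ge0 subr_ge0 ltW.
Qed.

End smooth_functions.

(** * Integration over the interval *)

Section leb_itv_measure.
Context (R : realType) (a b : R).
Local Notation mu := (leb_itv a b).
Local Notation leb := (@lebesgue_measure R).
Local Notation I := [set` `]a, b[].

Lemma leb_itvT_fin : fin_num_fun mu.
Proof.
apply: lty_fin_num_fun; rewrite -[X in (X < _)%E]/(leb (setT `&` I)) setTI.
by rewrite lebesgue_measure_itv/=; case: ifP => _; rewrite ?ltry// -EFinD ltry.
Qed.

HB.instance Definition _ := Measure_isFinite.Build _ _ _ mu leb_itvT_fin.

Lemma leb_itvT : a < b -> mu setT = (b - a)%:E.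
Proof. by move=> ab; rewrite /leb_itv /mrestr setTI lebesgue_measure_itv/= lte_fin ab. Qed.

Lemma ae_imp (P Q : R -> Prop) : (forall x, P x -> Q x) ->
  {ae mu, forall x, P x} -> {ae mu, forall x, Q x}.
Proof.
move=> PQ; apply: filterS; first exact: (ae_filter_ringOfSetsType mu).
exact: PQ.
Qed.

Lemma ae_imp2 (P Q S : R -> Prop) : (forall x, P x -> Q x -> S x) ->
  {ae mu, forall x, P x} -> {ae mu, forall x, Q x} -> {ae mu, forall x, S x}.
Proof.
move=> PQ; apply: filterS2; first exact: (ae_filter_ringOfSetsType mu).
exact: PQ.
Qed.

Lemma ae_leb_itv (P : R -> Prop) : {ae leb, forall x, I x -> P x} -> {ae mu, forall x, P x}.
Proof.
move=> [A [mA A0 AP]]; exists (A `|` ~` I); split.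
- by apply: measurableU => //; exact: measurableC.
- rewrite /leb_itv /mrestr setIUl setICl setU0; apply/eqP; rewrite -measure_le0 -A0.
  by apply: le_measure; rewrite ?inE//; exact: measurableI.
- move=> x /= nP; have [xI|xI] := pselect (I x); last by right.
  by left; apply: AP => /= h; exact/nP/h.
Qed.

Lemma ae_leb_itv_in : {ae mu, forall x, I x}.
Proof. by apply: ae_leb_itv; exact: aeW. Qed.

Lemma integral_leb_itv (f : R -> \bar R) : measurable_fun setT f ->
  (\int[mu]_x f x = \int[leb]_(x in I) f x)%E.
Proof.
move=> mf; have mI : measurable I by exact: measurable_itv.
have -> : (\int[mu]_x f x = \int[mu]_(x in I) f x)%E.
  rewrite [RHS]integral_mkcond; apply: ae_eq_integral => //.
    by apply/(measurable_restrictT _ mI); exact: measurable_funTS.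
  by apply: ae_imp ae_leb_itv_in => x xI _; rewrite patchE mem_set.
apply: eq_measure_integral => A mA AI; suff h : mu A = leb A by [].
by rewrite -[LHS]/(leb (A `&` I)) setIidl.
Qed.

Lemma integrable_leb_itv (f : R -> \bar R) : measurable_fun setT f ->
  mu.-integrable setT f <-> leb.-integrable I f.
Proof.
move=> mf; have maf : measurable_fun setT (fun x => `|f x|%E) by exact: measurableT_comp.
split=> /integrableP[_ fi]; apply/integrableP; split => //.
- exact: measurable_funTS.
- by rewrite -integral_leb_itv.
- by rewrite integral_leb_itv.
Qed.

Lemma Rintegral_leb_itv (f : R -> R) : measurable_fun setT f ->
  \int[mu]_x f x = \int[leb]_(x in I) f x.
Proof. by move=> mf; rewrite /Rintegral integral_leb_itv//; exact/measurable_EFinP. Qed.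

Lemma bounded_integrable (f : R -> R) (C : R) : measurable_fun setT f ->
  (forall x, I x -> `|f x| <= C) -> mu.-integrable setT (EFin \o f).
Proof.
move=> mf fC; apply/integrable_leb_itv; first exact/measurable_EFinP.
apply: (@le_integrable _ _ _ _ _ _ _ (EFin \o cst C)) => //.
- by apply/measurable_EFinP; exact: measurable_funTS.
- by move=> x /= xI; rewrite lee_fin (le_trans (fC _ xI))// ler_norm.
- apply: measurable_bounded_integrable => //.
    rewrite -[X in (X < _)%E]/(leb I).
    by rewrite lebesgue_measure_itv/=; case: ifP => _; rewrite ?ltry// -EFinD ltry.
  exact: bounded_cst.
Qed.

Lemma bounded_Lfun2 (f : R -> R) (C : R) : measurable_fun setT f ->
  (forall x, I x -> `|f x| <= C) -> f \in Lfun mu 2%:E.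
Proof.
move=> mf fC; apply/Lfun2P; split => //.
apply: (@bounded_integrable _ (C ^+ 2)); first exact: measurable_funX.
move=> x /fC h; rewrite normrX ler_pXn2r ?nnegrE//; exact: le_trans h.
Qed.

Lemma Lfun2_integrable (f : R -> R) : f \in Lfun mu 2%:E -> mu.-integrable setT (EFin \o f).
Proof.
move=> fL; apply/Lfun1_integrable; apply: Lfun_subset12 fL.
exact: leb_itvT_fin.
Qed.

Lemma continuous_Lfun2 (f : R -> R) : a < b -> continuous f -> f \in Lfun mu 2%:E.
Proof.
move=> ab cf; have mf := continuous_measurable_fun cf.
have [c _ hc] : exists2 c, c \in [set` `[a, b]] &
    forall t, t \in [set` `[a, b]] -> `|f t| <= `|f c|.
  apply: compact_EVT_max; first by exists a; rewrite /= in_itv/= lexx ltW.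
    exact: segment_compact.
  by apply: continuous_subspaceT => x; apply: continuous_comp; [exact: cf | exact: norm_continuous].
apply: (@bounded_Lfun2 _ `|f c|) => // x xI; apply: hc.
by rewrite inE; apply: subset_itv_oo_cc xI.
Qed.

End leb_itv_measure.

(** * Primitives and integration by parts *)

Section primitive.
Context (R : realType) (a b : R).
Local Notation mu := (leb_itv a b).
Local Notation leb := (@lebesgue_measure R).
Local Notation I := [set` `]a, b[].

Implicit Types u v : R -> R.

(** Cutting [v] off outside []a, b[] yields the primitive that vanishes at [a], defined on the whole
    line and constant on either side of the interval. *)
Definition prim (v : R -> R) (x : R) : R := \int[leb]_(z in `]-oo, x]) (v \_ I) z.

Lemma restrict_integrable (v : R -> R) : mu.-integrable setT (EFin \o v) ->
  leb.-integrable setT (EFin \o (v \_ I)).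
Proof.
move=> vi; have mv : measurable_fun setT (EFin \o v) by case/integrableP : vi.
move/(integrable_leb_itv a b mv) : vi; rewrite integrable_mkcond; last exact: measurable_itv.
by congr (integrable _ _ _); apply/funext => x; rewrite /= !patchE; case: ifP.
Qed.

Lemma primE v x : mu.-integrable setT (EFin \o v) ->
  prim v x = \int[mu]_z (v z * \1_(`]-oo, x]) z).
Proof.
move=> vi; have mv : measurable_fun setT v by case/integrableP : vi => /measurable_EFinP.
rewrite Rintegral_leb_itv; last by apply: measurable_funM => //; exact: measurable_indic.
rewrite /prim [LHS]Rintegral_mkcond [RHS]Rintegral_mkcond; apply: eq_Rintegral => z _.
rewrite !patchE indicE; case: (z \in I); case: (z \in _); by rewrite ?mulr1 ?mulr0.
Qed.

Lemma prim_a v : prim v a = 0.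
Proof.
rewrite /prim Rintegral_mkcond (_ : _ \_ _ = cst 0) ?Rintegral_cst ?mul0r//.
apply/funext => z; rewrite !patchE; case: ifPn => // /set_mem/=; rewrite in_itv/= => za.
by case: ifPn => // /set_mem/=; rewrite in_itv/= ltNge za.
Qed.

Lemma prim_b v : mu.-integrable setT (EFin \o v) -> prim v b = \int[mu]_z v z.
Proof.
move=> vi; have mv : measurable_fun setT v by case/integrableP : vi => /measurable_EFinP.
rewrite primE//; apply: ae_eq_Rintegral => //.
  by apply: measurable_funM => //; exact: measurable_indic.
apply: (ae_imp _ (ae_leb_itv_in a b)) => z /=; rewrite in_itv/= => /andP[_ zb].
by rewrite indicE mem_set ?mulr1//= in_itv/= ltW.
Qed.

Lemma prim_integrable v x : mu.-integrable setT (EFin \o v) ->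
  mu.-integrable setT (EFin \o (fun z => v z * \1_(`]-oo, x]) z)).
Proof.
move=> vi; have mv : measurable_fun setT v by case/integrableP : vi => /measurable_EFinP.
apply: le_integrable vi => //.
  by apply/measurable_EFinP; apply: measurable_funM => //; exact: measurable_indic.
move=> z _ /=; rewrite lee_fin normrM ler_piMr// indicE.
by case: (_ \in _); rewrite ?normr1 ?normr0.
Qed.

Lemma integrable_lin k l u v : mu.-integrable setT (EFin \o u) ->
  mu.-integrable setT (EFin \o v) ->
  mu.-integrable setT (EFin \o (fun z => k * u z + l * v z)).
Proof.
move=> ui vi.
have := integrableD measurableT (integrableZl measurableT k ui) (integrableZl measurableT l vi).
by apply: eq_integrable => // x _; rewrite /= EFinD !EFinM.
Qed.

Lemma integrable_scale k u : mu.-integrable setT (EFin \o u) ->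
  mu.-integrable setT (EFin \o (fun z => k * u z)).
Proof.
move=> ui; have := integrableZl measurableT k ui.
by apply: eq_integrable => // x _; rewrite /= EFinM.
Qed.

Lemma prim_lin k l u v x : mu.-integrable setT (EFin \o u) ->
  mu.-integrable setT (EFin \o v) ->
  prim (fun z => k * u z + l * v z) x = k * prim u x + l * prim v x.
Proof.
move=> ui vi; have kl := integrable_lin k l ui vi.
rewrite !primE//.
rewrite -!RintegralZl//; [|exact: prim_integrable..].
rewrite -RintegralD//; [|exact/integrable_scale/prim_integrable..].
by apply: eq_Rintegral => z _; ring.
Qed.

Lemma prim_bound v x : mu.-integrable setT (EFin \o v) ->
  `|prim v x| <= \int[mu]_z `|v z|.
Proof.
move=> vi; rewrite primE//; apply: le_trans (le_normr_Rintegral _ _) _ => //.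
  exact: prim_integrable.
apply: le_Rintegral => //.
- exact/integrable_norm/prim_integrable.
- exact: integrable_norm.
- move=> z _; rewrite normrM ler_piMr// indicE.
  by case: (_ \in _); rewrite ?normr1 ?normr0.
Qed.

Lemma prim_continuous v : mu.-integrable setT (EFin \o v) -> continuous (prim v).
Proof.
move=> /restrict_integrable vi x.
(* [A] is left of [a], so integrals from [A] agree with [prim], and [x] is interior to [[A, B]]. *)
pose A := Num.min x a - 1; pose B := x + 1.
have xA : A < x by rewrite /A ltrBlDr gt_min ltrDl ltr01.
have Aa : A < a by rewrite /A ltrBlDr gt_min [a < a + 1]ltrDl ltr01 orbT.
have xB : x < B by rewrite /B ltrDl.
have AB : A <= B by apply: ltW; exact: lt_trans xB.
have viAB : leb.-integrable `[A, B] (EFin \o (v \_ I)).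
  by apply: integrableS vi.
have := parameterized_integral_continuous AB viAB.
have -> : (parameterized_integral leb A)^~ (v \_ I) = prim v.
  apply/funext => y; rewrite /parameterized_integral /prim.
  rewrite Rintegral_mkcond [RHS]Rintegral_mkcond; apply: eq_Rintegral => z _.
  rewrite !patchE; case: (boolP (z \in I)) => zI; last by rewrite !if_same.
  suff -> : (z \in `[A, y]%classic) = (z \in `]-oo, y]%classic) by [].
  move/set_mem : zI; rewrite /= in_itv/= => /andP[az _].
  by apply/idP/idP => /set_mem/=; rewrite in_itv/= => h; apply/mem_set; rewrite /= in_itv/= ?(ltW (lt_trans Aa az))//; case/andP: h.
move=> /(continuous_within_itvP _ (lt_trans xA xB))[c _ _].
by apply: c; rewrite in_itv/= xA.
Qed.

Lemma prim_derive_ae v : mu.-integrable setT (EFin \o v) ->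
  {ae mu, forall x : R, is_derive x 1 (prim v) (v x)}.
Proof.
move=> /restrict_integrable vi; apply: ae_leb_itv.
have := @FTC1Ny R (v \_ I).
have i1 y : leb.-integrable `]-oo, y] (EFin \o (v \_ I)) by apply: integrableS vi.
move=> /(_ i1 (open_integrable_locally openT vi)).
apply: filterS; first exact: (ae_filter_ringOfSetsType leb).
move=> x [h1 h2] xI.
rewrite patchE (mem_set xI) in h2; rewrite -h2 derive1E.
exact: (derivableP h1).
Qed.

Lemma prim_derive v (x : R) : mu.-integrable setT (EFin \o v) ->
  {for x, continuous (v \_ I)} -> is_derive x 1 (prim v) ((v \_ I) x).
Proof.
move=> /restrict_integrable vi cx.
have xu : x < x + 1 by rewrite ltrDl.
have iu : leb.-integrable `]-oo, (x + 1)] (EFin \o (v \_ I)) by apply: integrableS vi.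
have [h1 h2] := continuous_FTC1 xu iu (ltNyr x) cx.
rewrite -h2 derive1E; exact: (derivableP h1).
Qed.

Lemma prim_mul_integrable u v : mu.-integrable setT (EFin \o u) ->
  mu.-integrable setT (EFin \o v) ->
  mu.-integrable setT (EFin \o (fun x => u x * prim v x)).
Proof.
move=> ui vi; have mu_ : measurable_fun setT u by case/integrableP : ui => /measurable_EFinP.
have := integrable_scale (\int[mu]_z `|v z|) ui.
apply: le_integrable => //.
  apply/measurable_EFinP/measurable_funM => //.
  exact: continuous_measurable_fun (prim_continuous vi).
move=> x _ /=; rewrite lee_fin !normrM mulrC ler_wpM2r//.
by apply: le_trans (prim_bound x vi) _; exact: ler_norm.
Qed.

(** Fubini for [u x * v s] on the triangle [s <= x]: integrating in [s] first gives [u * prim v], in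
    [x] first [v * (\int u - prim u)]. *)
Lemma integral_prim_mul u v : mu.-integrable setT (EFin \o u) ->
  mu.-integrable setT (EFin \o v) ->
  \int[mu]_x (u x * prim v x) + \int[mu]_x (v x * prim u x) =
  (\int[mu]_x u x) * (\int[mu]_x v x).
Proof.
move=> ui vi.
have mu_ : measurable_fun setT u by case/integrableP : ui => /measurable_EFinP.
have mv : measurable_fun setT v by case/integrableP : vi => /measurable_EFinP.
pose D := [set p : measurableTypeR R * measurableTypeR R | p.2 <= p.1].
have mD : measurable D.
  have := measurable_fun_ler (measurable_snd : measurable_fun setT (@snd (measurableTypeR R) (measurableTypeR R))) (measurable_fst : measurable_fun setT (@fst (measurableTypeR R) (measurableTypeR R))).
  move=> /(_ measurableT [set true] Logic.I); rewrite setTI.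
  by congr measurable; apply/seteqP; split => p.
pose K (p : measurableTypeR R * measurableTypeR R) := u p.1 * (v p.2 * \1_D p).
have mK : measurable_fun setT (EFin \o K).
  apply/measurable_EFinP; apply: measurable_funM.
    exact: (measurableT_comp mu_ measurable_fst).
  apply: measurable_funM; last exact: measurable_indic.
  exact: (measurableT_comp mv measurable_snd).
have D1 x : (fun s => \1_D (x, s)) = \1_(`]-oo, x]) :> (R -> R).
  apply/funext => s; rewrite !indicE.
  suff -> : ((x, s) \in D) = (s \in `]-oo, x]%classic) by [].
  by apply/idP/idP => /set_mem/= h; apply/mem_set; rewrite /= in_itv/= in h *.
have D2 s : (fun x => \1_D (x, s)) = \1_(`[s, +oo[) :> (R -> R).
  apply/funext => x; rewrite !indicE.
  suff -> : ((x, s) \in D) = (x \in `[s, +oo[%classic) by [].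
  by apply/idP/idP => /set_mem/= h; apply/mem_set; rewrite /= in_itv/= andbT in h *.
have KE x s : K (x, s) = u x * (v s * \1_(`]-oo, x]) s) by rewrite /K/= -D1.
have iKx x : mu.-integrable setT (fun s => (K (x, s))%:E).
  have := integrable_scale (u x) (prim_integrable x vi).
  by apply: eq_integrable => // s _; rewrite /= KE.
have e1 x : (\int[mu]_s (K (x, s))%:E = (u x * prim v x)%:E)%E.
  rewrite -[LHS]fineK; last exact: integrable_fin_num (iKx x).
  congr EFin; rewrite -[LHS]/(\int[mu]_s K (x, s)) primE// -RintegralZl//; last exact: prim_integrable.
have uD s : mu.-integrable setT (EFin \o (fun x => u x * \1_D (x, s))).
  apply: le_integrable ui => //.
    apply/measurable_EFinP/measurable_funM => //.
    rewrite D2; exact: measurable_indic.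
  move=> z _ /=; rewrite lee_fin normrM ler_piMr// indicE.
  by case: (_ \in _); rewrite ?normr1 ?normr0.
have e3 s : \int[mu]_x (u x * \1_D (x, s)) = \int[mu]_x u x - prim u s.
  rewrite primE// -RintegralB//; last exact: prim_integrable.
  apply: ae_eq_Rintegral.
  - by case/integrableP : (uD s) => /measurable_EFinP.
  - by apply: measurable_funB => //; apply: measurable_funM => //; exact: measurable_indic.
  (* At [x = s] both half-lines contain the point, so the diagonal has to be discarded. *)
  have xs : {ae mu, forall x, x != s}.
    apply: ae_leb_itv; exists [set s]; split => //; first exact: lebesgue_measure_set1.
    by move=> x /= /not_implyP[_ /negP]; rewrite negbK => /eqP.
  apply: (ae_imp _ xs) => x {}xs; rewrite !indicE.
  have -> : ((x, s) \in D) = ~~ (x \in `]-oo, s]%classic).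
    apply/idP/idP => [/set_mem h|].
      apply/negP => /set_mem/=; rewrite in_itv/= => h'.
      by move/negP: xs; apply; rewrite eq_le h'.
    move=> /negP h; apply/mem_set; rewrite /D/= leNgt; apply/negP => h'; apply: h.
    by apply/mem_set; rewrite /= in_itv/= ltW.
  by case: (x \in _); rewrite /= ?mulr0 ?mulr1 ?subr0 ?subrr.
have iKs s : mu.-integrable setT (fun x => (K (x, s))%:E).
  have := integrable_scale (v s) (uD s).
  by apply: eq_integrable => // x _; rewrite /= /K/= mulrCA.
have e2 s : (\int[mu]_x (K (x, s))%:E = (v s * (\int[mu]_x u x - prim u s))%:E)%E.
  rewrite -[LHS]fineK; last exact: integrable_fin_num (iKs s).
  congr EFin; rewrite -[LHS]/(\int[mu]_x K (x, s)) -e3 -RintegralZl//.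
  by apply: eq_Rintegral => x _; rewrite /K/= mulrCA.
pose M := \int[mu]_z `|v z|.
have iK : (mu \x mu)%E.-integrable setT (EFin \o K).
  apply/(integrable12ltyP mu mu mK).
  have uM : mu.-integrable setT (EFin \o (fun x => M * `|u x|)).
    exact/integrable_scale/integrable_norm.
  apply: (@le_lt_trans _ _ (\int[mu]_x (M * `|u x|)%:E)%E); last first.
    case/integrableP: uM => _; apply: le_lt_trans; apply: ge0_le_integral => //.
    - by move=> x _; rewrite lee_fin mulr_ge0// Rintegral_ge0.
    - apply/measurable_EFinP/measurable_funM => //; exact: measurableT_comp.
    - apply: measurableT_comp => //; apply/measurable_EFinP/measurable_funM => //; exact: measurableT_comp.
    - by move=> x _; rewrite lee_fin ler_norm.
  apply: ge0_le_integral => //.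
  - by move=> x _; exact: integral_ge0.
  - have mKa : measurable_fun setT (fun p => `|(EFin \o K) p|%E) by exact: measurableT_comp.
    exact: (measurable_fun_fubini_tonelli_F (m2 := mu) _ mKa (fun=> abse_ge0 _)).
  - apply/measurable_EFinP/measurable_funM => //; exact: measurableT_comp.
  move=> x _ /=; have -> : (M * `|u x|)%:E = (\int[mu]_s (`|u x| * `|v s|)%:E)%E.
    have i1 := integrable_scale `|u x| (integrable_norm vi).
    rewrite -[RHS]fineK; last exact: integrable_fin_num i1.
    congr EFin; rewrite -[RHS]/(\int[mu]_s (`|u x| * `|v s|)).
    by rewrite mulrC /M -RintegralZl//; exact: integrable_norm.
  have mKx : measurable_fun setT (fun s => (K (x, s))%:E) by case/integrableP: (iKx x).
  have maKx : measurable_fun setT (fun s => `|(K (x, s))%:E|%E) by exact: measurableT_comp.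
  apply: ge0_le_integral => //.
  - by apply/measurable_EFinP/measurable_funM => //; exact: measurableT_comp.
  move=> s _; rewrite KE lee_fin !normrM ler_wpM2l// ler_piMr// indicE.
  by case: (_ \in _); rewrite ?normr1 ?normr0.
have := Fubini iK; rewrite /=.
under eq_integral do rewrite e1.
under [in X in _ = X -> _]eq_integral do rewrite e2.
move=> /(congr1 fine); rewrite -[LHS]/(\int[mu]_x (u x * prim v x)).
rewrite -[RHS]/(\int[mu]_x (v x * (\int[mu]_x0 u x0 - prim u x))) => ->.
have ivu := prim_mul_integrable vi ui.
rewrite (_ : \int[mu]_x (v x * (\int[mu]_x0 u x0 - prim u x)) =
   \int[mu]_x u x * \int[mu]_x v x - \int[mu]_x (v x * prim u x)) ?subrK//.
rewrite -RintegralZl// -RintegralB//; last exact: integrable_scale.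
by apply: eq_Rintegral => x _; rewrite mulrBr (mulrC (v x)).
Qed.

End primitive.

(** * Test functions and weak derivatives of primitives *)

Section test_functions.
Context (R : realType) (a b : R).
Local Notation mu := (leb_itv a b).
Local Notation leb := (@lebesgue_measure R).
Local Notation I := [set` `]a, b[].
Implicit Types (u v w phi : R -> R).

(** Integration by parts for two functions given by their derivatives and by their values [c], [e]
    at [a]. *)
Lemma prim_parts u v c e : mu.-integrable setT (EFin \o u) -> mu.-integrable setT (EFin \o v) ->
  \int[mu]_x (u x * (e + prim a b v x)) + \int[mu]_x (v x * (c + prim a b u x)) =
  (c + prim a b u b) * (e + prim a b v b) - c * e.
Proof.
move=> ui vi; rewrite !prim_b//; have := integral_prim_mul ui vi.
have split k p q : mu.-integrable setT (EFin \o p) -> mu.-integrable setT (EFin \o q) ->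
    \int[mu]_x (p x * (k + prim a b q x)) = k * \int[mu]_x p x + \int[mu]_x (p x * prim a b q x).
  move=> pi qi; rewrite -RintegralZl// -RintegralD//.
  - by apply: eq_Rintegral => x _; rewrite mulrDr (mulrC k).
  - exact: integrable_scale.
  - exact: prim_mul_integrable.
rewrite !split//.
move: (\int[mu]_x (u x * _)) (\int[mu]_x (v x * _)) (\int[mu]_x u x) (\int[mu]_x v x).
by move=> p q r s h; rewrite addrACA h; ring.
Qed.

Lemma test_function_out phi (x : R) : test_function a b phi -> ~ I x -> \near x, phi x = 0.
Proof.
move=> [_ _ sub] xI.
have oc : open (~` closure [set z | phi z != 0]) by apply: closed_openC; exact: closed_closure.
have xc : (~` closure [set z | phi z != 0]) x by move=> /sub.
have := open_nbhs_nbhs (conj oc xc); apply: filterS => y /= yc.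
by apply/eqP/negPn/negP => h; apply: yc; exact: subset_closure.
Qed.

Lemma test_function_smooth phi : test_function a b phi -> smooth phi.
Proof. by case. Qed.

Lemma test_function_out0 phi x : test_function a b phi -> ~ I x -> phi x = 0.
Proof. by move=> tf /(test_function_out tf)/nbhs_singleton. Qed.

Lemma test_function_derive_out phi x : test_function a b phi -> ~ I x ->
  phi^`()%classic x = 0.
Proof.
move=> tf xI; have [_ h] : is_derive x 1 phi 0; last by rewrite derive1E h.
apply: (@near_eq_is_derive R R R (fun=> 0) phi x 1).
by have := test_function_out tf xI; apply: filterS => y ->.
Qed.

Lemma test_function_Lfun2 phi : a < b -> test_function a b phi -> phi \in Lfun mu 2%:E.
Proof.
by move=> ab tf; apply: continuous_Lfun2 => //; exact/smooth_continuous/test_function_smooth.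
Qed.

Lemma test_function_derive_Lfun2 phi : a < b -> test_function a b phi ->
  phi^`()%classic \in Lfun mu 2%:E.
Proof.
move=> ab tf; apply: continuous_Lfun2 => //.
exact/smooth_continuous/smooth_derive1/test_function_smooth.
Qed.

Lemma restrict_out v : (forall x, ~ I x -> v x = 0) -> v \_ I = v.
Proof.
move=> v0; apply/funext => x; rewrite patchE; case: ifPn => // /negP xI.
by rewrite v0// => h; apply: xI; exact: mem_set.
Qed.

Lemma test_function_prim phi : a < b -> test_function a b phi ->
  phi = prim a b phi^`()%classic.
Proof.
move=> ab tf; have di := Lfun2_integrable (test_function_derive_Lfun2 ab tf).
have dr : phi^`()%classic \_ I = phi^`()%classic.
  by apply: restrict_out => x; exact: test_function_derive_out.
have d0 (x : R) : is_derive x 1 (phi - prim a b phi^`()%classic) 0.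
  have h1 := derivable_is_derive1 (smooth_derivable (test_function_smooth tf) (z := x)).
  have h2 : is_derive x 1 (prim a b phi^`()%classic) (phi^`()%classic x).
    have h : {for x, continuous (phi^`()%classic \_ I)}.
      by rewrite dr; apply: smooth_continuous; exact/smooth_derive1/test_function_smooth.
    by have := prim_derive di h; rewrite dr.
  by apply: is_derive_congr (is_deriveB h1 h2) _ _ => //; rewrite subrr.
apply/funext => x; have := is_derive_0_is_cst x a d0.
rewrite /= !fctE prim_a subr0 (@test_function_out0 phi a)//; last by rewrite /= in_itv/= ltxx.
by move=> /eqP; rewrite subr_eq0 => /eqP.
Qed.

Lemma test_function_b phi : test_function a b phi -> phi b = 0.
Proof. by move=> tf; apply: (test_function_out0 tf); rewrite /= in_itv/= ltxx andbF. Qed.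

Lemma test_function_of_support phi c d : smooth phi -> a < c -> d < b ->
  (forall x, ~~ (c < x < d) -> phi x = 0) -> test_function a b phi.
Proof.
move=> sphi ac db out.
have sub : closure [set z | phi z != 0] `<=` [set` `[c, d]].
  have clcd : closed [set` `[c, d]] by exact: itv_closed.
  rewrite [X in _ `<=` X](iffLR (closure_id _) clcd).
  apply: closure_subset => z /= z0; rewrite in_itv/=.
  have [/andP[h1 h2]|/out z0'] := boolP (c < z < d); first by rewrite !ltW.
  by rewrite z0' eqxx in z0.
split => //.
  apply: subclosed_compact sub; first exact: closed_closure.
  exact: segment_compact.
move=> z /sub/=; rewrite !in_itv/= => /andP[cz zd].
by rewrite (lt_le_trans ac cz) (le_lt_trans zd db).
Qed.

Lemma weak_derivative_prim v c : a < b -> v \in Lfun mu 2%:E ->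
  weak_derivative a b (fun z => c + prim a b v z) v.
Proof.
move=> ab vL phi tf; have vi := Lfun2_integrable vL.
have di := Lfun2_integrable (test_function_derive_Lfun2 ab tf).
have := prim_parts c 0 vi di; rewrite mulr0 subr0 add0r -(test_function_prim ab tf).
rewrite (test_function_b tf) mulr0 => /eqP; rewrite addrC addr_eq0 => /eqP.
under [in X in X = _ -> _]eq_Rintegral do rewrite mulrC.
by move=> ->; congr (- _); apply: eq_Rintegral => x _; rewrite add0r.
Qed.

Lemma prim_Lfun2 v c : a < b -> v \in Lfun mu 2%:E ->
  (fun z => c + prim a b v z) \in Lfun mu 2%:E.
Proof.
move=> ab /Lfun2_integrable vi; apply: continuous_Lfun2 => // x.
by apply: cvgD; [exact: cvg_cst | exact: prim_continuous].
Qed.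

Lemma H1_prim u v c : a < b -> measurable_fun setT u -> v \in Lfun mu 2%:E ->
  {ae mu, forall x, u x = c + prim a b v x} -> H1_with_derivative a b u v.
Proof.
move=> ab mu_ vL uE; have pL := prim_Lfun2 c ab vL.
split => //.
  apply: (ae_Lfun2 pL) => //; exact: ae_imp uE.
move=> phi tf; rewrite -(weak_derivative_prim c ab vL tf).
have md : measurable_fun setT phi^`()%classic.
  exact: Lfun_measurable (test_function_derive_Lfun2 ab tf).
apply: ae_eq_Rintegral.
- exact: measurable_funM.
- by apply: measurable_funM => //; exact: Lfun_measurable pL.
- by apply: (ae_imp _ uE) => x ->.
Qed.

End test_functions.

(** * Functions of [H1] are primitives *)

Section fundamental_lemma.
Context (R : realType) (a b : R) (ab : a < b).
Local Notation mu := (leb_itv a b).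
Local Notation leb := (@lebesgue_measure R).
Local Notation I := [set` `]a, b[].
Implicit Types (u v w phi : R -> R).

Lemma bump_Lfun2 s c d : 0 < s -> bump s c d \in Lfun mu 2%:E.
Proof. by move=> s0; apply: continuous_Lfun2 => //; exact/smooth_continuous/smooth_bump. Qed.

(* The test function [phi] with [phi' = K2 b1 - K1 b2], where [Ki] is the
   integral of the bump function [bi]. *)
Lemma bump_difference_prim s c1 d1 c2 d2 w : 0 < s -> a < c1 -> d1 < b -> a < c2 -> d2 < b ->
  w \in Lfun mu 2%:E ->
  (forall phi, test_function a b phi -> \int[mu]_z (w z * phi^`()%classic z) = 0) ->
  (\int[mu]_z bump s c2 d2 z) * \int[mu]_z (w z * bump s c1 d1 z) =
  (\int[mu]_z bump s c1 d1 z) * \int[mu]_z (w z * bump s c2 d2 z).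
Proof.
move=> s0 ac1 db1 ac2 db2 wL w0.
have bL1 := bump_Lfun2 c1 d1 s0; have bL2 := bump_Lfun2 c2 d2 s0.
set K1 := \int[mu]_z bump s c1 d1 z; set K2 := \int[mu]_z bump s c2 d2 z.
pose th z := K2 * bump s c1 d1 z + (- K1) * bump s c2 d2 z.
have sth : smooth th by apply: smooth_lin; exact: smooth_bump.
have thi : mu.-integrable setT (EFin \o th).
  by apply: integrable_lin; exact: Lfun2_integrable.
pose c := Num.min c1 c2; pose d := Num.max d1 d2.
have ac : a < c by rewrite lt_min ac1.
have db : d < b by rewrite gt_max db1.
have th0 z : ~~ (c < z < d) -> th z = 0.
  move=> h; rewrite /th !bump_out// ?mulr0 ?addr0//.
  - by apply: contra h => /andP[h1 h2]; rewrite gt_min lt_max h1 h2 orbT orbT.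
  - by apply: contra h => /andP[h1 h2]; rewrite gt_min lt_max h1 h2.
have thr : th \_ I = th.
  apply: restrict_out => x xI; apply: th0; apply/negP => /andP[h1 h2]; apply: xI.
  by rewrite /= in_itv/= (lt_trans ac h1) (lt_trans h2 db).
have dphi (x : R) : is_derive x 1 (prim a b th) (th x).
  have h : {for x, continuous (th \_ I)} by rewrite thr; exact: smooth_continuous.
  by have := prim_derive thi h; rewrite thr.
have phiE := is_derive_funE dphi.
have tphi : test_function a b (prim a b th).
  apply: (@test_function_of_support _ _ _ _ c d) => //.
    move=> n z; case: n => [|n]; first by rewrite derive1n0; case: (dphi z).
    by rewrite derive1Sn phiE; exact: sth.
  move=> x; rewrite negb_and -!leNgt primE// => /orP[xc|dx].
    rewrite (_ : (fun z => _) = cst 0) ?Rintegral_cst ?mul0r//.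
    apply/funext => z; rewrite indicE; case: (boolP (z \in _)); last by rewrite mulr0.
    move=> /set_mem/=; rewrite in_itv/= => zx; rewrite th0 ?mul0r//.
    by rewrite ltNge (le_trans zx xc).
  (* To the right of [d] the primitive is the whole integral of [th], which the coefficients [K2]
     and [- K1] make zero. *)
  rewrite (_ : (fun z => _) = th); last first.
    apply/funext => z; rewrite indicE; case: (boolP (z \in _)); first by rewrite mulr1.
    move=> /negP zx; rewrite th0 ?mul0r//; apply/negP => /andP[_ zd]; apply: zx.
    by apply/mem_set; rewrite /= in_itv/= ltW// (lt_le_trans zd dx).
  rewrite /th RintegralD//; [|exact/integrable_scale/Lfun2_integrable..].
  rewrite !RintegralZl//; [|exact/Lfun2_integrable..].
  by rewrite -/K1 -/K2 mulNr mulrC subrr.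
have := w0 _ tphi; rewrite phiE /th.
have wb1 := Lfun2_integrableM wL bL1; have wb2 := Lfun2_integrableM wL bL2.
have -> : \int[mu]_z (w z * (K2 * bump s c1 d1 z + (- K1) * bump s c2 d2 z)) =
    K2 * \int[mu]_z (w z * bump s c1 d1 z) + (- K1) * \int[mu]_z (w z * bump s c2 d2 z).
  rewrite -!RintegralZl// -RintegralD//; [|exact/integrable_scale..].
  by apply: eq_Rintegral => z _; rewrite mulrDr !(mulrCA (w z)).
by move=> /eqP; rewrite mulNr subr_eq0 => /eqP.
Qed.

Lemma bump_cvg c d (x : R) : bump (n.+1%:R^-1) c d x @[n --> \oo] --> (\1_(`]c, d[) x : R).
Proof.
rewrite indicE; have [cxd|ncxd] := boolP (c < x < d).
  rewrite mem_set ?in_itv//=; have s0 n : 0 < n.+1%:R^-1 :> R by [].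
  rewrite (_ : (fun n => _) = (fun n => expR (- (n.+1%:R^-1 * ((x - c)^-1 + (d - x)^-1))))); last first.
    by apply/funext => n; rewrite bump_in.
  set k := _ + _; have h : (n.+1%:R^-1 * k) @[n --> \oo] --> (0 : R).
    by rewrite -[X in _ --> X](mul0r k); apply: cvgMl; exact: cvg_harmonic.
  have h' : (- (n.+1%:R^-1 * k)) @[n --> \oo] --> (0 : R).
    by rewrite -[X in _ --> X]oppr0; exact: cvgN.
  by rewrite -[X in _ --> X](expR0 R); apply: continuous_cvg h'; exact: continuous_expR.
rewrite memNset/= ?in_itv//=; last exact/negP.
rewrite (_ : (fun n => _) = cst 0); first exact: cvg_cst.
by apply/funext => n; rewrite bump_out.
Qed.

Lemma integral_bump_cvg c d w : w \in Lfun mu 2%:E ->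
  \int[mu]_z (w z * bump (n.+1%:R^-1) c d z) @[n --> \oo] -->
  \int[mu]_z (w z * \1_(`]c, d[) z).
Proof.
move=> wL; have wi := Lfun2_integrable wL; have mw := Lfun_measurable wL.
have mf n : measurable_fun setT (fun z => (w z * bump (n.+1%:R^-1) c d z)%:E).
  apply/measurable_EFinP/measurable_funM => //.
  by apply: (@Lfun_measurable _ _ R mu 2%:E); exact: bump_Lfun2.
have [||||h1 _ h3] := @dominated_convergence _ _ R mu setT measurableT
  (fun n z => (w z * bump (n.+1%:R^-1) c d z)%:E)
  (fun z => (w z * \1_(`]c, d[) z)%:E) (fun z => `|w z|%:E) mf.
- by apply/measurable_EFinP/measurable_funM => //; exact: measurable_indic.
- apply: aeW => x _; apply: cvg_EFin; first exact: nearW.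
  by apply: cvgMr; exact: bump_cvg.
- exact: integrable_norm.
- apply: aeW => x n _; rewrite /= lee_fin normrM ler_piMr//.
  have /andP[b0 b1] := @bump_itv01 R n.+1%:R^-1 c d (ltac:(by [])) x.
  by rewrite ger0_norm.
have := fine_cvg (_ : _ --> (\int[mu]_z (w z * \1_(`]c, d[) z))%:E); apply.
by rewrite /Rintegral fineK//; exact: integrable_fin_num h1.
Qed.

Lemma integral_indic_itv c d w : c <= d -> mu.-integrable setT (EFin \o w) ->
  \int[mu]_z (w z * \1_(`]c, d[) z) = prim a b w d - prim a b w c.
Proof.
move=> cd wi; have mw : measurable_fun setT w by case/integrableP : wi => /measurable_EFinP.
rewrite !primE// -RintegralB//; [|exact: prim_integrable..].
apply: ae_eq_Rintegral.
- by apply: measurable_funM => //; exact: measurable_indic.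
- by apply: measurable_funB; apply: measurable_funM => //; exact: measurable_indic.
have xd : {ae mu, forall x, x != d}.
  apply: ae_leb_itv; exists [set d]; split => //; first exact: lebesgue_measure_set1.
  by move=> x /= /not_implyP[_ /negP]; rewrite negbK => /eqP.
apply: (ae_imp _ xd) => x {}xd; rewrite !indicE.
have itvE i : (x \in [set` i]) = (x \in i) by apply/idP/idP => [/set_mem|/mem_set].
rewrite !itvE !in_itv/= (lt_neqAle x d) xd/=.
case: (ltP c x) => cx /=; first by rewrite mulr0 subr0.
by rewrite (le_trans cx cd) mulr0 subrr.
Qed.

(** As [s] tends to [0] in [bump_difference_prim], all intervals inside []a, b[] give [w] the same
    mean value. So [prim w] is affine, and its derivative, almost everywhere [w], is constant. *)
Lemma du_Bois_Reymond w : w \in Lfun mu 2%:E ->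
  (forall phi, test_function a b phi -> \int[mu]_z (w z * phi^`()%classic z) = 0) ->
  exists k, {ae mu, forall x, w x = k}.
Proof.
move=> wL w0; have wi := Lfun2_integrable wL.
have oL : (fun=> 1 : R) \in Lfun mu 2%:E.
  by apply: continuous_Lfun2 => // x; exact: cvg_cst.
have oi := Lfun2_integrable oL.
have prim1 c d : a < c -> c < d -> d < b -> prim a b (fun=> 1) d - prim a b (fun=> 1) c = d - c.
  move=> ac cd db; rewrite -integral_indic_itv// ?(ltW cd)//.
  under eq_Rintegral do rewrite mul1r.
  rewrite /Rintegral integral_indic// setIT -[X in fine X]/(leb ([set` `]c, d[] `&` I)).
  rewrite setIidl; last first.
    by move=> x /=; rewrite !in_itv/= => /andP[h1 h2]; rewrite (lt_trans ac h1) (lt_trans h2 db).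
  by rewrite lebesgue_measure_itv/= lte_fin cd.
have W c1 d1 c2 d2 : a < c1 -> c1 < d1 -> d1 < b -> a < c2 -> c2 < d2 -> d2 < b ->
    (d2 - c2) * (prim a b w d1 - prim a b w c1) = (d1 - c1) * (prim a b w d2 - prim a b w c2).
  move=> ac1 cd1 db1 ac2 cd2 db2.
  rewrite -(prim1 c2 d2 ac2 cd2 db2) -(prim1 c1 d1 ac1 cd1 db1).
  rewrite -(integral_indic_itv (ltW cd1) wi) -(integral_indic_itv (ltW cd2) wi).
  rewrite -(integral_indic_itv (ltW cd1) oi) -(integral_indic_itv (ltW cd2) oi).
  have l1 := cvgM (integral_bump_cvg (c := c2) (d := d2) oL) (integral_bump_cvg (c := c1) (d := d1) wL).
  have l2 := cvgM (integral_bump_cvg (c := c1) (d := d1) oL) (integral_bump_cvg (c := c2) (d := d2) wL).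
  have uniq (f g : nat -> R) (p q : R) : f =1 g -> f @ \oo --> p -> g @ \oo --> q -> p = q.
    by move=> /funext -> fp gq; exact: (cvg_unique (@Rhausdorff R) fp gq).
  apply: uniq (l1 _) (l2 _) => n.
  have one c0 d0 : \int[mu]_z (1 * bump n.+1%:R^-1 c0 d0 z) = \int[mu]_z bump n.+1%:R^-1 c0 d0 z.
    by apply: eq_Rintegral => z _; rewrite mul1r.
  by rewrite /GRing.mul/= !one; exact: bump_difference_prim.
have [c [d [ac cd db]]] : exists c d : R, [/\ a < c, c < d & d < b].
  by have := ab; exists ((2 * a + b) / 3), ((a + 2 * b) / 3); split; lra.
pose k := (prim a b w d - prim a b w c) / (d - c).
have dc0 : d - c != 0 by rewrite subr_eq0 gt_eqF.
have kE c' d' : a < c' -> c' < d' -> d' < b -> prim a b w d' - prim a b w c' = k * (d' - c').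
  move=> ac' cd' db'; apply: (mulfI dc0); rewrite -W// /k.
  by rewrite mulrA (mulrC (d - c)) divfK// mulrC.
have aff y : I y -> prim a b w y = prim a b w c + k * (y - c).
  rewrite /= in_itv/= => /andP[ay yb]; have [yc|cy|->] := ltgtP y c.
  - have := kE y c ay yc (lt_trans cd db); rewrite -(opprB c y) mulrN => <-.
    by rewrite opprB addrC subrK.
  - by have := kE c y ac cy yb => <-; rewrite addrC subrK.
  - by rewrite subrr mulr0 addr0.
exists k; apply: ae_imp2 (prim_derive_ae wi) (ae_leb_itv_in a b) => x dx xI.
have : is_derive x 1 (prim a b w) k.
  apply: (@near_eq_is_derive R R R (fun y => prim a b w c + k * (y - c)) _ x 1).
    have xn : nbhs x I by apply: open_nbhs_nbhs; split => //; exact: itv_open.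
    by apply: filterS xn => y yI; apply: esym; exact: aff.
  have h : is_derive x 1 (fun y : R => y - c) 1.
    by have := is_deriveB (is_derive_id x 1) (is_derive_cst c x 1); rewrite subr0.
  apply: is_derive_congr (is_deriveD (is_derive_cst (prim a b w c) x 1) (is_deriveZ k h)) _ _ => //.
  by rewrite add0r; exact: mulr1.
by case: dx => _ <- [].
Qed.

(** The difference [u - prim v] has weak derivative zero, hence is constant. *)
Lemma H1_is_prim u v : H1_with_derivative a b u v ->
  exists c, {ae mu, forall x, u x = c + prim a b v x}.
Proof.
move=> [uL vL wd]; have pL := prim_Lfun2 0 ab vL.
have [phi tphi|c hc] := @du_Bois_Reymond (fun z => u z - (0 + prim a b v z)) (Lfun2B uL pL).
  have dL := test_function_derive_Lfun2 ab tphi.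
  under eq_Rintegral do rewrite mulrBl.
  rewrite RintegralB//; [|exact: Lfun2_integrableM..].
  by rewrite wd// (weak_derivative_prim 0 ab vL tphi) subrr.
by exists c; apply: (ae_imp _ hc) => x /eqP; rewrite subr_eq add0r => /eqP.
Qed.

(** A nonzero value, even at an endpoint, persists on an open subinterval []p, q[] of positive
    measure. *)
Lemma continuous_ae_eq0 (h : R -> R) : {within `[a, b], continuous h} ->
  {ae mu, forall x, h x = 0} -> forall x, x \in `[a, b] -> h x = 0.
Proof.
move=> /subspace_continuousP hc h0 x xab; apply: contrapT => /eqP hx.
have : \forall y \near within [set` `[a, b]] (nbhs x), h y != 0.
  by apply: cvgr_neq0 hx; exact: hc.
move=> [e /= e0 he]; pose p := Num.max a (x - e); pose q := Num.min b (x + e).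
move: xab; rewrite in_itv/= => /andP[ax xb].
have pq : p < q by rewrite gt_max !lt_min ab /=; apply/and3P; split; lra.
have sub : [set` `]p, q[] `<=` [set y | ~ h y = 0].
  move=> y /=; rewrite in_itv/= gt_max lt_min => /andP[/andP[ay xy] /andP[yb yx]].
  apply/eqP/he; last by rewrite /= in_itv/= !ltW.
  by rewrite /ball/= ltr_norml; apply/andP; split; lra.
case: h0 => A [mA A0 AP].
have : (mu [set` `]p, q[] <= mu A)%E.
  apply: (le_measure mu (mem_set (measurable_itv _)) (mem_set mA)).
  by move=> y /sub yh; exact: AP.
rewrite A0 measure_le0 => /eqP; rewrite -[X in X = _]/(leb ([set` `]p, q[] `&` I)) setIidl; last first.
  move=> y /=; rewrite !in_itv/= gt_max lt_min => /andP[/andP[ay _] /andP[yb _]].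
  by rewrite ay yb.
by rewrite lebesgue_measure_itv/= lte_fin pq => /eqP; rewrite -EFinD eqe subr_eq0 gt_eqF.
Qed.

(** Such a [v] is a weak derivative of [0], so its primitive is constant and can be differentiated
    almost everywhere. *)
Lemma weak_derivative0 v : v \in Lfun mu 2%:E ->
  (forall phi, test_function a b phi -> \int[mu]_z (v z * phi z) = 0) ->
  {ae mu, forall x, v x = 0}.
Proof.
move=> vL v0; have z0 : (fun=> 0 : R) \in Lfun mu 2%:E by exact: Lfun2_cst0.
have [|c hc] := @H1_is_prim (fun=> 0) v.
  split => // phi tphi; rewrite (v0 _ tphi) oppr0.
  under eq_Rintegral do rewrite mul0r.
  by rewrite Rintegral_cst ?mul0r.
have vi := Lfun2_integrable vL.
have cp x : x \in `[a, b] -> c + prim a b v x = 0.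
  move: x; apply: (@continuous_ae_eq0 (fun x => c + prim a b v x)); last first.
    by apply: (ae_imp _ hc) => y ->.
  apply: continuous_subspaceT => y.
  by apply: cvgD; [exact: cvg_cst | exact: prim_continuous].
apply: ae_imp2 (prim_derive_ae vi) (ae_leb_itv_in a b) => x dx xI.
have : is_derive x 1 (prim a b v) 0.
  apply: (@near_eq_is_derive R R R (fun=> - c) _ x 1).
  have xn : nbhs x I by apply: open_nbhs_nbhs; split => //; exact: itv_open.
  apply: filterS xn => y yI; apply: esym; apply/eqP; rewrite -addr_eq0 addrC cp//.
  exact: subset_itv_oo_cc yI.
by case: dx => _ <- [].
Qed.

End fundamental_lemma.

(** * Indefinite quadratic forms *)

Section quadratic_forms.
Context (R : realType) (n : nat).
Implicit Types (S : 'M[R]_n) (v w y : 'rV[R]_n).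

(** Row vectors, so that subspaces are row spaces of matrices; traces are columns and get
    transposed. *)
Definition rform S v w : R := (v *m S *m w^T) 0 0.

Lemma rform_linl S k v w y : rform S (k *: v + w) y = k * rform S v y + rform S w y.
Proof. by rewrite /rform !mulmxDl -!scalemxAl !mxE. Qed.

Lemma rform_linr S k v w y : rform S y (k *: v + w) = k * rform S y v + rform S y w.
Proof. by rewrite /rform linearP/= mulmxDr -scalemxAr !mxE. Qed.

Lemma rform_sym S v w : S^T = S -> rform S v w = rform S w v.
Proof.
move=> symS; rewrite /rform -[in LHS](trmxK (v *m S *m w^T)) mxE.
by rewrite !trmx_mul trmxK symS mulmxA.
Qed.

Lemma rform_opp S v w : rform (- S) v w = - rform S v w.
Proof. by rewrite /rform mulmxN mulNmx mxE. Qed.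

Lemma rform0 S v : rform S 0 v = 0.
Proof. by rewrite /rform !mul0mx mxE. Qed.

Lemma rform_perp m S (D : 'M[R]_(m, n)) v w :
  w *m S *m D^T = 0 -> (v <= D)%MS -> rform S w v = 0.
Proof.
by move=> wD /submxP[c ->]; rewrite /rform trmx_mul mulmxA wD mul0mx mxE.
Qed.

Lemma nonpos_extend m S (D : 'M[R]_(m, n)) y : S^T = S ->
  (forall v, (v <= D)%MS -> rform S v v <= 0) -> y *m S *m D^T = 0 ->
  rform S y y <= 0 -> forall v, (v <= D + y)%MS -> rform S v v <= 0.
Proof.
move=> symS Dle yD yle v /sub_addsmxP[[c e]] ->.
have -> : e *m y = e 0 0 *: y by rewrite [e]mx11_scalar mul_scalar_mx mxE eqxx mulr1n.
set d := c *m D; have dD : (d <= D)%MS by exact: submxMl.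
rewrite addrC rform_linl !rform_linr (rform_sym d) // (rform_perp yD dD).
rewrite mulr0 addr0 add0r.
have := Dle d dD; have := mulr_ge0_le0 (sqr_ge0 (e 0 0)) yle.
by rewrite expr2 -mulrA -!oppr_ge0 opprD => h1 h2; exact: addr_ge0.
Qed.

End quadratic_forms.

Section signature.
Context (R : realType) (N : nat) (S : 'M[R]_(N + N)) (symS : S^T = S).
Implicit Types (v w y : 'rV[R]_(N + N)).

Lemma definite_row_free (P : 'M[R]_(N, N + N)) :
  (forall c : 'rV_N, c != 0 -> rform S (c *m P) (c *m P) != 0) -> row_free P.
Proof.
move=> Pd; rewrite -kermx_eq0; apply/eqP/row_matrixP => i; rewrite row0.
apply/eqP/negPn/negP => /Pd; rewrite -row_mul mulmx_ker row0 rform0.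
by rewrite eqxx.
Qed.

(** The row space of [P] is positive definite of dimension [N] and meets [D] only in [0]. *)
Lemma nonpos_rank m (P : 'M[R]_(N, N + N)) (D : 'M[R]_(m, N + N)) :
  (forall c : 'rV_N, c != 0 -> 0 < rform S (c *m P) (c *m P)) ->
  (forall v, (v <= D)%MS -> rform S v v <= 0) -> (\rank D <= N)%N.
Proof.
move=> Pp Dle.
have rP : \rank P = N.
  by apply/eqP/definite_row_free => c /Pp /gt_eqF ->.
have cap0 : \rank (P :&: D)%MS = 0%N.
  apply/eqP; rewrite mxrank_eq0; apply/eqP/row_matrixP => i; rewrite row0.
  have : (row i (P :&: D) <= P :&: D)%MS by exact: row_sub.
  rewrite sub_capmx => /andP[/submxP[c ec] /Dle]; rewrite {}ec.
  have [->|/Pp c0] := eqVneq c 0; first by rewrite mul0mx.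
  by rewrite leNgt c0.
have := mxrank_sum_cap P D; rewrite cap0 addn0 rP => e.
by rewrite -(leq_add2l N) -e rank_leq_col.
Qed.

(* Otherwise a vector orthogonal to [D] with negative square would extend [D]
   to a nonpositive subspace of dimension [N.+1]. *)
Lemma nonpos_perp m (P : 'M[R]_(N, N + N)) (D : 'M[R]_(m, N + N)) y :
  (forall c : 'rV_N, c != 0 -> 0 < rform S (c *m P) (c *m P)) ->
  (forall v, (v <= D)%MS -> rform S v v <= 0) -> \rank D = N ->
  y *m S *m D^T = 0 -> 0 <= rform S y y.
Proof.
move=> Pp Dle rD yD; rewrite leNgt; apply/negP => ylt.
have := nonpos_rank Pp (nonpos_extend symS Dle yD (ltW ylt)).
move=> rle; have : (y <= D)%MS.
  have := mxrank_leqif_sup (addsmxSl D y) => -[_ /esym].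
  have le2 : (\rank (D + y) <= \rank D)%N by rewrite rD.
  by rewrite eqn_leq le2 mxrankS ?addsmxSl// addsmx_sub => /andP[].
by move=> /(rform_perp yD) y0; rewrite y0 ltxx in ylt.
Qed.

(** Orthogonality to [D] imposes fewer than [N] conditions on the [N]-dimensional negative row space
    of [P]. *)
Lemma nonpos_not_maximal m (P : 'M[R]_(N, N + N)) (D : 'M[R]_(m, N + N)) :
  (forall c : 'rV_N, c != 0 -> rform S (c *m P) (c *m P) < 0) ->
  (\rank D < N)%N ->
  exists y, y *m S *m D^T = 0 /\ rform S y y < 0.
Proof.
move=> Pn rD.
have rP : \rank P = N.
  by apply/eqP/definite_row_free => c /Pn /lt_eqF ->.
have : (0 < \rank (kermx (P *m S *m D^T)))%N.
  rewrite mxrank_ker subn_gt0; apply: leq_ltn_trans rD.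
  by rewrite -[\rank D]mxrank_tr; exact: mxrankM_maxr.
rewrite lt0n mxrank_eq0 => /rowV0Pn[c /sub_kermxP cD c0].
exists (c *m P); split; last exact: Pn.
by rewrite -!mulmxA in cD *.
Qed.

Context (uS : S \in unitmx).

Lemma rform_inv (WB : 'M[R]_(N, N + N)) (c : 'rV[R]_N) :
  rform S (c *m WB *m invmx S) (c *m WB *m invmx S) =
  (c *m (WB *m invmx S *m WB^T) *m c^T) 0 0.
Proof. by rewrite /rform mulmxKV// !trmx_mul trmx_inv symS !mulmxA. Qed.

(** The kernel has dimension at least [N], and at most [N] by [nonpos_rank]. The rows of [WB S^-1]
    are [S]-orthogonal to it, so [nonpos_perp] applies to them. *)
Lemma nonpos_kernel (P : 'M[R]_(N, N + N)) (WB : 'M[R]_(N, N + N)) :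
  (forall c : 'rV_N, c != 0 -> 0 < rform S (c *m P) (c *m P)) ->
  (forall v, v *m WB^T = 0 -> rform S v v <= 0) ->
  \rank WB = N /\ forall c : 'rV_N, 0 <= (c *m (WB *m invmx S *m WB^T) *m c^T) 0 0.
Proof.
move=> Pp Dle; pose D := kermx WB^T.
have {}Dle v : (v <= D)%MS -> rform S v v <= 0 by move=> /sub_kermxP /Dle.
have rD : (\rank D + \rank WB)%N = (N + N)%N.
  by rewrite mxrank_ker mxrank_tr subnK// rank_leq_col.
have rW : \rank WB = N.
  apply/eqP; rewrite eqn_leq rank_leq_row/=.
  have := nonpos_rank Pp Dle; rewrite -(leq_add2r (\rank WB)) rD.
  by rewrite leq_add2l.
split => // c; rewrite -rform_inv; apply: nonpos_perp Pp Dle _ _.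
  by move: rD; rewrite rW => /addIn.
rewrite mulmxKV// -mulmxA -[WB]trmxK -trmx_mul mulmx_ker trmx0 mulmx0//.
Qed.

(** If [y] is [S]-orthogonal to the kernel, then [y S] lies in the row space of [WB], so [y] is a
    combination of the rows of [WB S^-1]. *)
Lemma nonneg_inv_perp (WB : 'M[R]_(N, N + N)) y :
  (forall c : 'rV_N, 0 <= (c *m (WB *m invmx S *m WB^T) *m c^T) 0 0) ->
  (forall v, v *m WB^T = 0 -> rform S v y = 0) -> 0 <= rform S y y.
Proof.
move=> Wp yp.
have : (y *m S <= WB)%MS.
  rewrite submxE; apply/eqP/matrixP => i j; rewrite ord1 [RHS]mxE.
  have h : (row j (cokermx WB)^T) *m WB^T = 0.
    by rewrite -row_mul -trmx_mul mulmx_coker trmx0 row0.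
  have := yp _ h; rewrite rform_sym// /rform => e; rewrite -[RHS]e.
  by rewrite tr_row trmxK [LHS]mxE [RHS]mxE; apply: eq_bigr => k _; rewrite !mxE.
move=> /submxP[c ycW].
have -> : y = c *m WB *m invmx S by rewrite -ycW mulmxK.
by rewrite rform_inv.
Qed.

End signature.

Section subspaces.
Context (R : realType).

(** Take [M] of maximal rank with row space inside [D]: a vector of [D] outside that space would
    raise the rank. *)
Lemma subspace_matrix n (D : set 'rV[R]_n) : D 0 ->
  (forall k v w, D v -> D w -> D (k *: v + w)) ->
  exists M : 'M[R]_n, forall v, D v <-> (v <= M)%MS.
Proof.
move=> D0 Dlin.
pose p r := `[< exists M : 'M[R]_n, \rank M = r /\ forall v, (v <= M)%MS -> D v >].
have [||r /asboolP[M [rM DM]] rmax] := @ex_maxnP p n.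
- by exists 0%N; apply/asboolP; exists 0; rewrite mxrank0; split => // v; rewrite submx0 => /eqP ->.
- by move=> r /asboolP[M [<- _]]; exact: rank_leq_row.
exists M => v; split=> [Dv|/DM//].
have /rmax : p (\rank (M + v)%MS).
  apply/asboolP; exists (M + v)%MS; split => // w /sub_addsmxP[[c e]] ->/=.
  have -> : e *m v = e 0 0 *: v by rewrite [e]mx11_scalar mul_scalar_mx mxE eqxx mulr1n.
  by rewrite addrC; apply: Dlin => //; apply: DM; exact: submxMl.
rewrite -rM => rle; have := mxrank_leqif_sup (addsmxSl M v) => -[_ /esym].
by rewrite eqn_leq rle mxrankS ?addsmxSl// addsmx_sub => /andP[].
Qed.

(** The codimension is a variable [k], so that [K] can have the type ['M_(N, N + N)] as soon as the
    rank is known. *)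
Lemma subspace_kernel n k (M : 'M[R]_n) : (n - \rank M)%N = k ->
  exists K : 'M[R]_(k, n), forall v : 'rV_n, (v <= M)%MS <-> v *m K^T = 0.
Proof.
move=> rk; have : \rank (cokermx M)^T = k by rewrite mxrank_tr mxrank_coker.
move: (row_base _) (eq_row_base (cokermx M)^T); move=> B eB rkB.
move: B eB; rewrite rkB => B eB; exists B => v.
rewrite submxE; split=> [/eqP h|h].
  have /submxP[c ->] : (B <= (cokermx M)^T)%MS by rewrite eB.
  by rewrite trmx_mul trmxK mulmxA h mul0mx.
have : ((cokermx M)^T <= B)%MS by rewrite eB.
by move=> /submxP[c] /(congr1 trmx); rewrite trmxK trmx_mul => ->; rewrite mulmxA h mul0mx.
Qed.

End subspaces.

Section signature_kernel.
Context (R : realType) (N : nat) (S : 'M[R]_(N + N)) (symS : S^T = S) (uS : S \in unitmx).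

(** This is [nonpos_perp] for [- S] and the [N]-dimensional row space of [WB S^-1], to which the
    kernel of [WB] is [S]-orthogonal. *)
Lemma nonneg_inv_kernel (P : 'M[R]_(N, N + N)) (WB : 'M[R]_(N, N + N)) v :
  (forall c : 'rV_N, c != 0 -> rform S (c *m P) (c *m P) < 0) ->
  \rank WB = N ->
  (forall c : 'rV_N, 0 <= (c *m (WB *m invmx S *m WB^T) *m c^T) 0 0) ->
  v *m WB^T = 0 -> rform S v v <= 0.
Proof.
move=> Pn rW Wp vW; rewrite -oppr_ge0 -rform_opp.
apply: (@nonpos_perp _ _ (- S) _ _ P (WB *m invmx S)).
- by rewrite linearN/= symS.
- by move=> c /Pn; rewrite rform_opp oppr_gt0.
- by move=> _ /submxP[c ->]; rewrite rform_opp oppr_le0 mulmxA rform_inv.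
- by rewrite mxrankMfree// row_free_unit unitmx_inv.
- by rewrite mulmxN mulNmx trmx_mul trmx_inv symS mulmxA mulmxK// vW oppr0.
Qed.

(* A maximal nonpositive subspace has dimension [N]. *)
Lemma maximal_nonpos_kernel (P P' : 'M[R]_(N, N + N)) (D : set 'rV[R]_(N + N)) :
  (forall c : 'rV_N, c != 0 -> 0 < rform S (c *m P) (c *m P)) ->
  (forall c : 'rV_N, c != 0 -> rform S (c *m P') (c *m P') < 0) ->
  D 0 -> (forall k v w, D v -> D w -> D (k *: v + w)) ->
  (forall v, D v -> rform S v v <= 0) ->
  (forall y, (forall v, D v -> rform S v y = 0) -> rform S y y < 0 -> D y) ->
  exists WB : 'M[R]_(N, N + N), forall v, D v <-> v *m WB^T = 0.
Proof.
move=> Pp Pn D0 Dlin Dle Dmax; have [M DM] := subspace_matrix D0 Dlin.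
have {}Dle v : (v <= M)%MS -> rform S v v <= 0 by move=> /DM /Dle.
have : (\rank M == N).
  rewrite eqn_leq (nonpos_rank Pp Dle) leqNgt; apply/negP.
  move=> /(nonpos_not_maximal Pn)[y [yM y0]].
  have yD v : D v -> rform S v y = 0 by move=> /DM vM; rewrite rform_sym// (rform_perp yM).
  by have := yD _ (Dmax _ yD y0) => h; rewrite h ltxx in y0.
move=> /eqP rM; have [|K hK] := @subspace_kernel _ _ N M; first by rewrite rM addnK.
by exists K => v; rewrite DM hK.
Qed.

End signature_kernel.

(** * The energy space *)

Section vector_L2.
Context (R : realType) (a b : R).
Local Notation mu := (leb_itv a b).

Definition Lfun2v n (f : R -> 'cV[R]_n) := forall i, (fun z => f z i 0) \in Lfun mu 2%:E.

Definition dot n (f g : R -> 'cV[R]_n) := \int[mu]_z ((f z)^T *m g z) 0 0.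

Lemma ae_forall (I : finType) (P : I -> R -> Prop) :
  (forall i, {ae mu, forall z, P i z}) -> {ae mu, forall z, forall i, P i z}.
Proof. by move=> h; apply: filter_forall. Qed.

Lemma Lfun2v_lin n k (f g : R -> 'cV[R]_n) : Lfun2v f -> Lfun2v g ->
  Lfun2v (fun z => k *: f z + g z).
Proof.
move=> fL gL i; under eq_fun do rewrite !mxE.
exact: Lfun2_lin.
Qed.

Lemma Lfun2v_add n (f g : R -> 'cV[R]_n) : Lfun2v f -> Lfun2v g ->
  Lfun2v (fun z => f z + g z).
Proof.
by move=> fL gL i; under eq_fun do rewrite !mxE; exact: Lfun2D.
Qed.

Lemma Lfun2v_mulmx n m (M : 'M[R]_(m, n)) (f : R -> 'cV[R]_n) : Lfun2v f ->
  Lfun2v (fun z => M *m f z).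
Proof.
move=> fL i; under eq_fun do rewrite mxE.
by apply: Lfun2_sum => j; exact: Lfun2Z.
Qed.

Lemma dot_integrable n (f g : R -> 'cV[R]_n) : Lfun2v f -> Lfun2v g ->
  mu.-integrable setT (EFin \o (fun z => ((f z)^T *m g z) 0 0)).
Proof.
move=> fL gL; have [h _] := @Rintegral_sum _ _ R mu 'I_n (index_enum 'I_n)
  (fun i z => f z i 0 * g z i 0) (fun i => Lfun2_integrableM (fL i) (gL i)).
apply: eq_integrable h => // z _; rewrite /= mxE; congr EFin.
by apply: eq_bigr => i _; rewrite mxE.
Qed.

Lemma dotE n (f g : R -> 'cV[R]_n) : Lfun2v f -> Lfun2v g ->
  dot f g = \sum_i \int[mu]_z (f z i 0 * g z i 0).
Proof.
move=> fL gL; have [_ <-] := @Rintegral_sum _ _ R mu 'I_n (index_enum 'I_n)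
  (fun i z => f z i 0 * g z i 0) (fun i => Lfun2_integrableM (fL i) (gL i)).
by apply: eq_Rintegral => z _; rewrite mxE; apply: eq_bigr => i _; rewrite mxE.
Qed.

Lemma dotC n (f g : R -> 'cV[R]_n) : dot f g = dot g f.
Proof.
apply: eq_Rintegral => z _.
by rewrite -[in LHS](trmxK ((f z)^T *m g z)) mxE trmx_mul trmxK.
Qed.

Lemma dot_lin n k (f g h : R -> 'cV[R]_n) : Lfun2v f -> Lfun2v g -> Lfun2v h ->
  dot (fun z => k *: f z + g z) h = k * dot f h + dot g h.
Proof.
move=> fL gL hL; rewrite /dot -RintegralZl//; last exact: dot_integrable.
rewrite -RintegralD//; [|exact/integrable_scale/dot_integrable|exact: dot_integrable].
by apply: eq_Rintegral => z _; rewrite linearP mulmxDl -scalemxAl !mxE.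
Qed.

Lemma dot_mulmx n m (M : 'M[R]_(m, n)) (f : R -> 'cV[R]_n) (g : R -> 'cV[R]_m) :
  dot (fun z => M *m f z) g = dot f (fun z => M^T *m g z).
Proof. by apply: eq_Rintegral => z _; rewrite trmx_mul mulmxA. Qed.

Lemma dot_ae n (f f' g g' : R -> 'cV[R]_n) : Lfun2v f -> Lfun2v g ->
  Lfun2v f' -> Lfun2v g' ->
  {ae mu, forall z, f z = f' z} -> {ae mu, forall z, g z = g' z} ->
  dot f g = dot f' g'.
Proof.
move=> fL gL fL' gL' ff' gg'; apply: ae_eq_Rintegral.
- by case/integrableP : (dot_integrable fL gL) => /measurable_EFinP.
- by case/integrableP : (dot_integrable fL' gL') => /measurable_EFinP.
- by apply: ae_imp2 ff' gg' => z -> ->.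
Qed.

Lemma ae_Rintegral_ge0 (f : R -> R) : measurable_fun setT f ->
  {ae mu, forall z, 0 <= f z} -> 0 <= \int[mu]_z f z.
Proof.
move=> mf f0; rewrite (@ae_eq_Rintegral _ _ R mu f (fun z => `|f z|))//.
- by apply: Rintegral_ge0.
- exact: measurableT_comp.
- by apply: ae_imp f0 => z f0; rewrite ger0_norm.
Qed.

Lemma Rintegral_sqr_eq0 (f : R -> R) : f \in Lfun mu 2%:E ->
  \int[mu]_z (f z ^+ 2) = 0 -> {ae mu, forall z, f z = 0}.
Proof.
move=> /Lfun2P[mf fi] f0.
have mf2 : measurable_fun (setT : set (measurableTypeR R)) (EFin \o (fun z => f z ^+ 2)).
  by case/integrableP : fi.
have e : (\int[mu]_z `|(f z ^+ 2)%:E| = 0)%E.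
  transitivity (\int[mu]_z (f z ^+ 2)%:E)%E.
    by apply: eq_integral => z _; rewrite /= ger0_norm ?sqr_ge0.
  by rewrite -[LHS]fineK; [congr EFin | exact: integrable_fin_num].
have [/(_ e) h _] := ae_eq_integral_abs mu measurableT mf2.
by apply: (@ae_imp _ _ _ _ _ _ h) => z /(_ Logic.I) [] /eqP; rewrite sqrf_eq0 => /eqP.
Qed.

Lemma norm_clamp_le (C x : R) : `|Num.max (- C) (Num.min C x)| <= `|C|.
Proof.
rewrite ler_norml le_max ge_max ge_min ler_norm.
have -> : - C <= `|C| by rewrite -normrN ler_norm.
by rewrite lerN2 ler_norm.
Qed.

Lemma norm_sqrM_le (x y c : R) : `|x| <= `|y| -> `|(x * c) ^+ 2| <= `|y ^+ 2 * c ^+ 2|.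
Proof.
by move=> xy; rewrite exprMn (normrM (x ^+ 2)) (normrM (y ^+ 2)) !normrX ler_wpM2r ?exprn_ge0// lerXn2r ?nnegrE.
Qed.

Lemma Lfun2_bounded_mul (h f : R -> R) (C : R) : measurable_fun setT h ->
  {ae mu, forall z, `|h z| <= C} -> f \in Lfun mu 2%:E ->
  (fun z => h z * f z) \in Lfun mu 2%:E.
Proof.
move=> mh hC fL; have mf := Lfun_measurable fL.
(* Clamping makes the bound hold at every point, as the comparison of integrands requires. *)
pose h' z := Num.max (- C) (Num.min C (h z)).
have mh' : measurable_fun setT h'.
  by apply: measurable_funTS; apply: measurable_maxr => //; apply: measurable_minr.
apply: (@ae_Lfun2 _ _ R mu (fun z => h' z * f z)).
- apply/Lfun2P; split; first exact: measurable_funM.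
  have /Lfun2P[_ fi] := fL.
  apply: (le_integrable measurableT _ _ (integrable_scale (C ^+ 2) fi)) => //.
    by apply/measurable_EFinP; apply/measurable_funX/measurable_funM.
  move=> z _; have hC' : `|h' z| <= `|C|.
    exact: norm_clamp_le.
  by rewrite /= lee_fin; exact: norm_sqrM_le.
- exact: measurable_funM.
- apply: (ae_imp _ hC) => z; rewrite ler_norml => /andP[h1 h2].
  by rewrite /h' min_r// max_r.
Qed.

Lemma Lfun2v_lift n (f : R -> 'cV[R]_n) : Lfun2v f ->
  exists x : L2N n a b, {ae mu, forall z, vec x z = f z}.
Proof.
move=> fL; exists (fun i => (\pi_(Lp mu (lee1n 2)) (Lfun_Sub (lee1n 2) (fL i)))%qT).
have h i := Lp_reprK (Lfun_Sub (lee1n 2) (fL i)).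
have : {ae mu, forall z, forall i, Lp_to_fun (\pi_(Lp mu (lee1n 2)) (Lfun_Sub (lee1n 2) (fL i)))%qT z = f z i 0}.
  apply: ae_forall => i; apply: ae_imp (h i) => z /(_ Logic.I) hz.
  by rewrite /Lp_to_fun hz.
by apply: ae_imp => z hz; apply/colP => i; rewrite mxE hz.
Qed.

Lemma Lfun2v_vec n (x : L2N n a b) : Lfun2v (vec x).
Proof.
by move=> i; under eq_fun do rewrite mxE; exact: LfunP.
Qed.

(** Only almost everywhere, since [vec] picks arbitrary representatives. *)
Lemma vec_lin n k (x y : L2N n a b) :
  {ae mu, forall z, vec (k *: x + y) z = k *: vec x z + vec y z}.
Proof.
have : {ae mu, forall z, forall i, Lp_to_fun (k *: x i + y i) z = k * Lp_to_fun (x i) z + Lp_to_fun (y i) z}.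
  apply: ae_forall => i; elim/LpW: (x i) => f; elim/LpW: (y i) => g.
  change ({ae mu, forall z, Lp_to_fun (Lp_add (Lp_scale k (\pi_(Lp mu (lee1n 2)) f)%qT) (\pi_(Lp mu (lee1n 2)) g)%qT) z = k * Lp_to_fun (\pi_(Lp mu (lee1n 2)) f)%qT z + Lp_to_fun (\pi_(Lp mu (lee1n 2)) g)%qT z}).
  rewrite Lp_piZ Lp_piD.
  apply: filterS3 (Lp_reprK f) (Lp_reprK g) (Lp_reprK (k *: f + g)) => z h1 h2 h3.
  rewrite /Lp_to_fun (h1 Logic.I) (h2 Logic.I) (h3 Logic.I).
  by [].
by apply: ae_imp => z h; apply/colP => i; rewrite !mxE h.
Qed.

Lemma vec_inj n (x y : L2N n a b) : {ae mu, forall z, vec x z = vec y z} -> x = y.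
Proof.
move=> h; apply/funext => i; rewrite -[x i]reprK -[y i]reprK.
apply/Lp_piP; apply: ae_imp h => z /colP/(_ i); rewrite !mxE.
by [].
Qed.

End vector_L2.

(** * Entrywise bounds for [H] and its inverse *)

Section matrix_bounds.
Context (R : realType) (n : nat).
Implicit Types (M : 'M[R]_n) (v : 'cV[R]_n).

Definition sqnorm m (v : 'cV[R]_m) : R := (v^T *m v) 0 0.

Lemma sqnormE v : sqnorm v = \sum_i v i 0 ^+ 2.
Proof. by rewrite /sqnorm mxE; apply: eq_bigr => i _; rewrite mxE. Qed.

Lemma sqnorm_ge0 v : 0 <= sqnorm v.
Proof. by rewrite sqnormE sumr_ge0// => i _; rewrite sqr_ge0. Qed.

Lemma sqnorm_entry v i : v i 0 ^+ 2 <= sqnorm v.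
Proof. by rewrite sqnormE (bigD1 i)//= lerDl sumr_ge0// => j _; rewrite sqr_ge0. Qed.

Lemma sqnorm_eq0 v : sqnorm v <= 0 -> v = 0.
Proof.
move=> v0; apply/colP => i; rewrite mxE; apply/eqP; rewrite -sqrf_eq0.
by rewrite eq_le sqr_ge0 andbT (le_trans (sqnorm_entry v i)).
Qed.

Lemma form_diff M M' v : (v^T *m (M - M') *m v) 0 0 = (v^T *m M *m v) 0 0 - (v^T *m M' *m v) 0 0.
Proof. by rewrite mulmxBr mulmxBl !mxE. Qed.

Lemma form_scalar c v : (v^T *m c%:M *m v) 0 0 = c * sqnorm v.
Proof. by rewrite mul_mx_scalar -scalemxAl mxE. Qed.

Lemma lemx_lower c M v : lemx c%:M M -> c * sqnorm v <= (v^T *m M *m v) 0 0.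
Proof. by move=> [_ /(_ v)]; rewrite form_diff form_scalar subr_ge0. Qed.

Lemma lemx_upper c M v : lemx M c%:M -> (v^T *m M *m v) 0 0 <= c * sqnorm v.
Proof. by move=> [_ /(_ v)]; rewrite form_diff form_scalar subr_ge0. Qed.

Lemma sqnorm_delta i : sqnorm (delta_mx i 0 : 'cV[R]_n) = 1.
Proof. by rewrite /sqnorm trmx_delta mul_delta_mx mxE !eqxx. Qed.

Lemma form_delta M i j : ((delta_mx i 0 : 'cV[R]_n)^T *m M *m (delta_mx j 0 : 'cV[R]_n)) 0 0 = M i j.
Proof. by rewrite trmx_delta -rowE -colE !mxE. Qed.

(** Positivity on [e_i + e_j] and [e_i - e_j] bounds the entry by the mean of two diagonal entries,
    which are at most [c1]. *)
Lemma lemx_entry c0 c1 M i j : 0 < c0 -> lemx c0%:M M -> M = M^T -> lemx M c1%:M ->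
  `|M i j| <= c1.
Proof.
move=> c00 low sym up.
have Mii k : M k k <= c1.
  by have := lemx_upper (delta_mx k 0) up; rewrite form_delta sqnorm_delta mulr1.
have q s : 0 <= s * (s * M j j + M j i) + (s * M i j + M i i).
  have := lemx_lower (s *: delta_mx 0 j + delta_mx 0 i)^T low.
  rewrite trmxK -/(rform _ _ _) rform_linl !rform_linr.
  have rd k l : rform M (delta_mx 0 k) (delta_mx 0 l) = M k l.
    by rewrite /rform trmx_delta -rowE -colE !mxE.
  by rewrite !rd; apply: le_trans; exact: mulr_ge0 (ltW c00) (sqnorm_ge0 _).
have e : M j i = M i j by rewrite [in LHS]sym mxE.
have := q 1; have := q (-1); rewrite e; have := Mii i; have := Mii j.
move: (M i i) (M j j) (M i j) => x y z.
by rewrite ler_norml => *; apply/andP; split; lra.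
Qed.

Lemma lemx_unit c M : 0 < c -> lemx c%:M M -> M \in unitmx.
Proof.
move=> c0 low; rewrite -unitmx_tr -row_free_unit -kermx_eq0; apply/eqP/row_matrixP => i.
rewrite row0; set w := row i _.
have wM : w *m M^T = 0 by rewrite /w -row_mul mulmx_ker row0.
have := lemx_lower w^T low; rewrite -mulmxA -(trmxK (M *m w^T)) trmx_mul trmxK wM trmx0 mulmx0 mxE.
rewrite pmulr_rle0// => /sqnorm_eq0 /(congr1 trmx).
by rewrite trmxK trmx0.
Qed.

Lemma lemx_inv_entry c M i j : 0 < c -> lemx c%:M M -> `|invmx M i j| <= c^-1.
Proof.
move=> c0 low; have uM := lemx_unit c0 low.
set v : 'cV[R]_n := delta_mx j 0; set w := invmx M *m v.
have -> : invmx M i j = w i 0 by rewrite /w /v -colE mxE.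
have rform1 (x : 'cV[R]_n) : sqnorm x = rform 1%:M x^T x^T.
  by rewrite /rform mulmx1 trmxK.
have wv : c * sqnorm w <= rform 1%:M w^T v^T.
  have := lemx_lower w low; rewrite /rform mulmx1 trmxK -mulmxA {3}/w.
  by rewrite (mulmxA M) mulmxV// mul1mx.
(* With [wv], the expansion of this square gives [c^2 |w|^2 <= 1], in place of Cauchy-Schwarz. *)
have : 0 <= sqnorm (- c *: w + v) by exact: sqnorm_ge0.
rewrite rform1 linearP/= rform_linl !rform_linr -rform1 (rform_sym v^T)// ?trmx1//.
rewrite -rform1 sqnorm_delta => h.
have cw : (c * w i 0) ^+ 2 <= 1.
  rewrite exprMn; apply: le_trans (ler_wpM2l (sqr_ge0 c) (sqnorm_entry w i)) _.
  move: h (ler_wpM2l (ltW c0) wv); rewrite expr2.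
  by move: (rform _ _ _) (sqnorm w) => x y; nra.
rewrite -[_^-1]mul1r ler_pdivlMr// mulrC -{1}(gtr0_norm c0) -normrM.
by rewrite -(ler_pXn2r (ltn0Sn 1)) ?nnegrE// expr1n real_normK ?num_real.
Qed.

End matrix_bounds.

Section measurable_matrices.
Context (R : realType).
Lemma measurable_det n (F : R -> 'M[R]_n) :
  (forall i j, measurable_fun setT (fun z => F z i j)) ->
  measurable_fun setT (fun z => \det (F z)).
Proof.
move=> mF; apply: measurable_sum => s.
apply: measurable_funM; first exact: measurable_cst.
apply: measurable_prod => i _; exact: mF.
Qed.

(** The rewriting through [powR], whose measurability is available, is an identity also where [f]
    vanishes. *)
Lemma measurable_invr (f : R -> R) : measurable_fun setT f ->
  measurable_fun setT (fun z => (f z)^-1).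
Proof.
move=> mf; have -> : (fun z => (f z)^-1) = (fun z => f z * powR (f z ^+ 2) (-1)).
  apply/funext => z; rewrite powR_inv1 ?sqr_ge0// expr2.
  by have [->|f0] := eqVneq (f z) 0; rewrite ?invr0 ?mul0r// invfM mulVKf.
apply: measurable_funM => //.
by apply: (measurableT_comp (measurable_powR _)); exact: measurable_funX.
Qed.

Lemma measurable_adj n (F : R -> 'M[R]_n) i j :
  (forall i j, measurable_fun setT (fun z => F z i j)) ->
  measurable_fun setT (fun z => \adj (F z) i j).
Proof.
move=> mF; under eq_fun do rewrite mxE.
apply: measurable_funM; first exact: measurable_cst.
apply: measurable_det => k l; under eq_fun do rewrite !mxE.
exact: mF.
Qed.
End measurable_matrices.

(** * The inner product weighted by [H] *)

Section energy_space.
Context (R : realType) (N : nat) (a b : R) (H : R -> 'M[R]_N).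
Local Notation mu := (leb_itv a b).
Context (mH : forall i j, measurable_fun setT (fun z => H z i j)).
Context (c0 c1 : R) (c00 : 0 < c0) (c10 : 0 < c1)
  (hH : {ae mu, forall z, [/\ lemx c0%:M (H z), H z = (H z)^T & lemx (H z) c1%:M]}).
Local Notation L2N := (L2N N a b).
Implicit Types (x y : L2N) (f g u : R -> 'cV[R]_N).

Lemma Lfun2v_H f : Lfun2v a b f -> Lfun2v a b (fun z => H z *m f z).
Proof.
move=> fL i; under eq_fun do rewrite mxE.
apply: Lfun2_sum => j; apply: (@Lfun2_bounded_mul _ _ _ _ _ c1) => //.
by apply: (ae_imp _ hH) => z [h1 h2 h3]; exact: lemx_entry c00 h1 h2 h3.
Qed.

(** Cramer's formula rather than [invmx], whose case distinction would obscure measurability. *)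
Definition Hinv z := (\det (H z))^-1 *: \adj (H z).

Lemma HinvE : {ae mu, forall z, H z \in unitmx /\ Hinv z = invmx (H z)}.
Proof.
apply: (ae_imp _ hH) => z [h1 _ _]; have uH := lemx_unit c00 h1.
by split => //; rewrite /invmx uH.
Qed.

Lemma Lfun2v_Hinv f : Lfun2v a b f -> Lfun2v a b (fun z => Hinv z *m f z).
Proof.
move=> fL i; under eq_fun do rewrite mxE.
apply: Lfun2_sum => j; apply: (@Lfun2_bounded_mul _ _ _ _ _ c0^-1) => //.
  under eq_fun do rewrite mxE.
  exact: measurable_funM (measurable_invr (measurable_det mH)) (measurable_adj _ _ mH).
by apply: ae_imp2 HinvE hH => z [_ ->] [h1 _ _]; exact: lemx_inv_entry.
Qed.

Lemma Lfun2v_Hmul x : Lfun2v a b (Hmul H x).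
Proof. exact/Lfun2v_H/Lfun2v_vec. Qed.

Lemma Hmul_lift u : Lfun2v a b u -> exists x, {ae mu, forall z, Hmul H x z = u z}.
Proof.
move=> uL; have [x xE] := Lfun2v_lift (Lfun2v_Hinv uL); exists x.
apply: ae_imp2 xE HinvE => z xz [uH hE].
by rewrite /Hmul xz hE mulKVmx.
Qed.

Lemma Hmul_lin k x y :
  {ae mu, forall z, Hmul H (k *: x + y) z = k *: Hmul H x z + Hmul H y z}.
Proof.
by apply: (ae_imp _ (vec_lin k x y)) => z h; rewrite /Hmul h mulmxDr scalemxAr.
Qed.

Lemma ipHE x y : ipH H x y = dot a b (vec x) (Hmul H y).
Proof. by []. Qed.

Lemma ipHC x y : ipH H x y = ipH H y x.
Proof.
rewrite ipHE dotC ipHE; apply: ae_eq_Rintegral.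
- by case/integrableP : (dot_integrable (Lfun2v_Hmul y) (Lfun2v_vec x)) => /measurable_EFinP.
- by case/integrableP : (dot_integrable (Lfun2v_vec y) (Lfun2v_Hmul x)) => /measurable_EFinP.
- apply: (ae_imp _ hH) => z [_ h _].
  by rewrite /Hmul [in LHS]h trmx_mul trmxK mulmxA.
Qed.

Lemma ipH_linl k x y z : ipH H (k *: x + y) z = k * ipH H x z + ipH H y z.
Proof.
rewrite !ipHE -(dot_lin k (Lfun2v_vec x) (Lfun2v_vec y) (Lfun2v_Hmul z)).
apply: dot_ae (vec_lin k x y) _.
- exact: Lfun2v_vec.
- exact: Lfun2v_Hmul.
- exact: (Lfun2v_lin k (Lfun2v_vec x) (Lfun2v_vec y)).
- exact: Lfun2v_Hmul.
- by apply: (ae_imp _ hH).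
Qed.

Lemma sqr_le_ipH x i : c0 * \int[mu]_z (vec x z i 0 ^+ 2) <= ipH H x x.
Proof.
have vL := Lfun2v_vec x i.
have /Lfun2P[_ vi] := vL.
have di := dot_integrable (Lfun2v_vec x) (Lfun2v_Hmul x).
rewrite -RintegralZl// -subr_ge0 /ipH -RintegralB//; last exact: integrable_scale.
apply: ae_Rintegral_ge0.
  apply: measurable_funB; first by case/integrableP : di => /measurable_EFinP.
  by case/integrableP : (integrable_scale c0 vi) => /measurable_EFinP.
apply: (ae_imp _ hH) => z [h1 _ _]; rewrite subr_ge0.
apply: le_trans (ler_wpM2l (ltW c00) (sqnorm_entry (vec x z) i)) _.
by rewrite /Hmul mulmxA; exact: lemx_lower.
Qed.

Lemma ipH_le_sqr x : ipH H x x <= c1 * \sum_i \int[mu]_z (vec x z i 0 ^+ 2).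
Proof.
have vi i : mu.-integrable setT (EFin \o (fun z => vec x z i 0 ^+ 2)).
  by have /Lfun2P[] := Lfun2v_vec x i.
have [si <-] := Rintegral_sum (index_enum 'I_N) vi.
have di := dot_integrable (Lfun2v_vec x) (Lfun2v_Hmul x).
rewrite -RintegralZl// -subr_ge0 /ipH -RintegralB//; last exact: integrable_scale.
apply: ae_Rintegral_ge0.
  apply: measurable_funB; last by case/integrableP : di => /measurable_EFinP.
  by case/integrableP : (integrable_scale c1 si) => /measurable_EFinP.
apply: (ae_imp _ hH) => z [_ _ h]; rewrite subr_ge0 -sqnormE.
by rewrite /Hmul mulmxA; exact: lemx_upper.
Qed.

Lemma inner_product_ipH : is_inner_product (@ipH R N a b H).
Proof.
split; [exact: ipHC | exact: ipH_linl | move=> x | move=> x x0].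
  apply: ae_Rintegral_ge0.
    by case/integrableP : (dot_integrable (Lfun2v_vec x) (Lfun2v_Hmul x)) => /measurable_EFinP.
  apply: (ae_imp _ hH) => z [h1 _ _]; rewrite /Hmul mulmxA.
  exact: le_trans (mulr_ge0 (ltW c00) (sqnorm_ge0 _)) (lemx_lower _ h1).
have xi i : {ae mu, forall z, vec x z i 0 = 0}.
  apply: (Rintegral_sqr_eq0 (Lfun2v_vec x i)); apply/eqP; rewrite eq_le.
  apply/andP; split; last by apply: Rintegral_ge0 => z _; exact: sqr_ge0.
  by have := sqr_le_ipH x i; rewrite x0 pmulr_rle0.
apply: vec_inj.
(* From [0 = (-1) *: 0 + 0], [vec_lin] gives [vec 0 = - vec 0 + vec 0]. *)
have h0 : {ae mu, forall z, vec (0 : L2N) z = 0}.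
  have := vec_lin (-1) (0 : L2N) 0; rewrite scaler0 addr0.
  by apply: ae_imp => z ->; rewrite scaleN1r addNr.
apply: ae_imp2 (ae_forall xi) h0 => z hz ->.
by apply/colP => i; rewrite hz mxE.
Qed.

(** By the bounds on [H] the norm is equivalent to that of [L^2], and [Lfun2_complete] applies to
    each component. *)
Lemma complete_ipH : ip_complete (@ipH R N a b H).
Proof.
have hip := inner_product_ipH.
move=> u cu.
have vB (x y : L2N) i : \int[mu]_z (vec (x - y) z i 0 ^+ 2) =
    \int[mu]_z ((vec x z i 0 - vec y z i 0) ^+ 2).
  have /Lfun2P[m1 _] := Lfun2v_vec (x - y) i.
  have /Lfun2P[m2 _] := Lfun2B (Lfun2v_vec x i) (Lfun2v_vec y i).
  apply: ae_eq_Rintegral; [exact: measurable_funX..|].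
  have := vec_lin (-1) y x; rewrite scaleN1r addrC.
  by apply: ae_imp => z ->; rewrite !mxE; congr (_ ^+ 2); ring.
have /boolp.choice[l hl] : forall i, exists li : R -> R, li \in Lfun mu 2%:E /\
    forall e : R, 0 < e -> exists n, forall k, (n <= k)%N ->
      \int[mu]_z ((vec (u k) z i 0 - li z) ^+ 2) <= e.
  move=> i.
  apply: (@Lfun2_complete _ _ R mu (fun k z => vec (u k) z i 0)) => [n|e e0].
    exact: Lfun2v_vec.
  have [|n hn] := cu (Num.sqrt (c0 * e)); first by rewrite sqrtr_gt0 mulr_gt0.
  exists n => p q np nq; rewrite -vB -(ler_pM2l c00).
  apply: le_trans (sqr_le_ipH _ i) _; rewrite -(nrm_sqr hip).
  have := hn p q np nq; rewrite -(ler_pXn2r (ltn0Sn 1)) ?nnegrE ?nrm_ge0 ?sqrtr_ge0//.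
  have ce : 0 <= c0 * e by apply: mulr_ge0; exact: ltW.
  by rewrite (sqr_sqrtr ce).
have lL : Lfun2v a b (fun z => \col_i l i z).
  by move=> i; under eq_fun do rewrite mxE; have [] := hl i.
have [x xE] := Lfun2v_lift lL; exists x => e e0.
have [d d0 de] : exists2 d, 0 < d & c1 * (N%:R * d) <= e ^+ 2.
  have N0 : 0 < N.+1%:R :> R by rewrite ltr0n.
  (* [N.+1] keeps the denominator positive when [N = 0]. *)
  exists (e ^+ 2 / (c1 * N.+1%:R)); first by rewrite divr_gt0 ?exprn_gt0 ?mulr_gt0.
  rewrite mulrA mulrCA ger_pMr ?exprn_gt0// ler_pdivrMr ?mulr_gt0// mul1r.
  by rewrite ler_pM2l// ler_nat.
have /boolp.choice[n hn] : forall i, exists n, forall k, (n <= k)%N ->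
      \int[mu]_z ((vec (u k) z i 0 - l i z) ^+ 2) <= d.
  by move=> i; have [_] := hl i; exact.
exists (\max_i n i)%N => k nk.
rewrite -(ler_pXn2r (ltn0Sn 1)) ?nnegrE ?nrm_ge0 ?(ltW e0)// nrm_sqr//.
apply: le_trans (ipH_le_sqr _) (le_trans _ de); rewrite ler_pM2l//.
rewrite -[N in N%:R]card_ord -sum1_card natr_sum mulr_suml; apply: ler_sum => i _.
rewrite mul1r vB; apply: le_trans (hn i k _); last first.
  by apply: leq_trans nk; exact: leq_bigmax.
rewrite le_eqVlt; apply/orP; left; apply/eqP; apply: ae_eq_Rintegral.
- by have /Lfun2P[m _] := Lfun2B (Lfun2v_vec (u k) i) (Lfun2v_vec x i); exact: measurable_funX.
- have [lLi _] := hl i; have /Lfun2P[m _] := Lfun2B (Lfun2v_vec (u k) i) lLi.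
  exact: measurable_funX.
- by apply: (ae_imp _ xE) => z ->; rewrite [in X in _ - X]mxE.
Qed.

End energy_space.

(** * Functions with trace zero *)

Section trace_zero.
Context (R : realType) (a b : R) (ab : a < b).
Local Notation mu := (leb_itv a b).
Implicit Types (u v w phi : R -> R).

Lemma ae_imp3 (P Q S W : R -> Prop) : (forall x, P x -> Q x -> S x -> W x) ->
  {ae mu, forall x, P x} -> {ae mu, forall x, Q x} -> {ae mu, forall x, S x} ->
  {ae mu, forall x, W x}.
Proof.
move=> h hP hQ; apply: ae_imp2 (ae_imp2 (fun x => @conj (P x) (Q x)) hP hQ).
by move=> x []; exact: h.
Qed.

Lemma test_function_lin k phi psi : test_function a b phi -> test_function a b psi ->
  test_function a b (fun z => k * phi z + psi z).
Proof.
move=> tf tg; have [_ cf sf] := tf; have [_ cg sg] := tg.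
have sub : closure [set z | k * phi z + psi z != 0] `<=`
    closure [set z | phi z != 0] `|` closure [set z | psi z != 0].
  rewrite -closureU; apply: closure_subset => z /= h; apply: contrapT => /not_orP[].
  move=> /negP; rewrite negbK => /eqP f0 /negP; rewrite negbK => /eqP g0.
  by rewrite f0 g0 mulr0 addr0 eqxx in h.
split.
- have -> : (fun z => k * phi z + psi z) = (fun z => k * phi z + 1 * psi z).
    by apply/funext => z; rewrite mul1r.
  exact: smooth_lin (test_function_smooth tf) (test_function_smooth tg).
- apply: subclosed_compact sub; first exact: closed_closure.
  exact: compactU.
- by move=> z /sub [/sf|/sg].
Qed.

Lemma test_function_lin_derive k phi psi : test_function a b phi -> test_function a b psi ->
  (fun z => k * phi z + psi z)^`()%classic = (fun z => k * phi^`()%classic z + psi^`()%classic z).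
Proof.
move=> tf tg; apply: is_derive_funE => z.
have h1 := derivable_is_derive1 (smooth_derivable (test_function_smooth tf) (z := z)).
have h2 := derivable_is_derive1 (smooth_derivable (test_function_smooth tg) (z := z)).
by apply: is_derive_congr (is_deriveD (is_deriveZ k h1) h2) _ _.
Qed.

Lemma derive0 : (fun=> 0 : R)^`()%classic = (fun=> 0).
Proof. by apply: is_derive_funE => z; exact: (is_derive_cst 0 z 1). Qed.

Lemma test_function0 : test_function a b (fun=> 0).
Proof.
have h : [set z : R | (0 : R) != 0] = set0 by apply/seteqP; split => // z /=; rewrite eqxx.
split; last by rewrite h closure0.
  apply: (@smooth_stable _ [set fun=> 0]) => // f ->; last exact: derive0.
  by move=> z; exact: derivable_cst.
by rewrite h closure0; exact: compact0.
Qed.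

(* The orthogonal complement of the derivatives of the test functions consists
   of the constants. *)
Lemma derivative_dense v : v \in Lfun mu 2%:E -> \int[mu]_z v z = 0 ->
  exists phi : nat -> R -> R, (forall n, test_function a b (phi n)) /\
    forall e : R, 0 < e -> exists n, forall k, (n <= k)%N ->
      \int[mu]_z (((phi k)^`()%classic z - v z) ^+ 2) <= e.
Proof.
(* Scalar [L^2] is taken as the energy space with [N = 1] and identity weight, so that
   [dense_of_orthogonal] applies. *)
move=> vL v0; pose H1 (z : R) : 'M[R]_1 := 1%:M.
have mH i j : measurable_fun setT (fun z => H1 z i j) by exact: measurable_cst.
have hH : {ae mu, forall z, [/\ lemx 1%:M (H1 z), H1 z = (H1 z)^T & lemx (H1 z) 1%:M]}.
  have ll : lemx (1%:M : 'M[R]_1) 1%:M.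
    rewrite /lemx subrr; split; first by rewrite trmx0.
    by move=> x; rewrite mulmx0 mul0mx mxE.
  by apply: aeW => z; split => //; rewrite trmx1.
have hip := inner_product_ipH mH ltr01 hH.
have cpl := complete_ipH mH ltr01 ltr01 hH.
pose c1 (f : R -> R) (z : R) : 'cV[R]_1 := const_mx (f z).
have c1L f : f \in Lfun mu 2%:E -> Lfun2v a b (c1 f).
  by move=> fL i; under eq_fun do rewrite mxE.
have ipE (s t : L2N 1 a b) f : f \in Lfun mu 2%:E -> {ae mu, forall z, vec s z = c1 f z} ->
    ipH H1 s t = \int[mu]_z (vec t z 0 0 * f z).
  move=> fL sf; apply: ae_eq_Rintegral.
  - by case/integrableP : (dot_integrable (Lfun2v_vec s) (Lfun2v_Hmul mH ltr01 hH t)) => /measurable_EFinP.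
  - by case/integrableP : (Lfun2_integrableM (Lfun2v_vec t 0) fL) => /measurable_EFinP.
  - by apply: (ae_imp _ sf) => z ->; rewrite /Hmul mul1mx mxE big_ord1 !mxE mulrC.
have [x xE] := Lfun2v_lift (c1L _ vL).
pose S : set (L2N 1 a b) := [set s | exists2 phi, test_function a b phi &
  {ae mu, forall z, vec s z = c1 phi^`()%classic z}].
have [||w wS|u uS ux] := @dense_of_orthogonal _ _ _ hip S x cpl.
- exists (fun=> 0); first exact: test_function0.
  have := vec_lin (-1) (0 : L2N 1 a b) 0; rewrite scaler0 addr0; apply: ae_imp => z ->.
  by rewrite scaleN1r addNr derive0; apply/colP => i; rewrite !mxE.
- move=> k s t [phi tphi sE] [psi tpsi tE].
  exists (fun z => k * phi z + psi z); first exact: test_function_lin.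
  rewrite test_function_lin_derive//; apply: ae_imp3 (vec_lin k s t) sE tE => z -> -> ->.
  by apply/colP => i; rewrite !mxE.
- have wL := Lfun2v_vec w 0.
  have [phi tphi|k wk] := @du_Bois_Reymond _ _ _ ab (fun z => vec w z 0 0) wL.
    have dL := test_function_derive_Lfun2 ab tphi.
    have [s sE] := Lfun2v_lift (c1L _ dL).
    by rewrite -(ipE s w _ dL sE); apply: wS; exists phi.
  rewrite (ipE x w v)// (@ae_eq_Rintegral _ _ R mu _ (fun z => k * v z)).
  + by rewrite RintegralZl ?v0 ?mulr0//; exact: Lfun2_integrable.
  + by case/integrableP : (Lfun2_integrableM wL vL) => /measurable_EFinP.
  + by apply: measurable_funM => //; exact: Lfun_measurable vL.
  + by apply: (ae_imp _ wk) => z ->.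
- have /boolp.choice[phi hphi] : forall n, exists phi, test_function a b phi /\
      {ae mu, forall z, vec (u n) z = c1 phi^`()%classic z}.
    by move=> n; have [phi] := uS n; exists phi.
  exists phi; split=> [n|e e0]; first by have [] := hphi n.
  have se : 0 < Num.sqrt e by rewrite sqrtr_gt0.
  have [n hn] := ux _ se; exists n => k /hn hk.
  have : ip_norm (@ipH R 1 a b H1) (u k - x) ^+ 2 <= Num.sqrt e ^+ 2.
    by apply: lerXn2r hk; rewrite nnegrE; exact: sqrtr_ge0.
  rewrite (nrm_sqr hip) (sqr_sqrtr (ltW e0)); apply: le_trans.
  have [tk uk] := hphi k.
  have := sqr_le_ipH mH ltr01 hH (u k - x) 0; rewrite mul1r; apply: le_trans.
  rewrite le_eqVlt; apply/orP; left; apply/eqP; apply: ae_eq_Rintegral.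
  + apply: measurable_funX; apply: Lfun_measurable (Lfun2B _ vL).
    exact: test_function_derive_Lfun2.
  + by apply: measurable_funX; exact: Lfun_measurable (Lfun2v_vec (u k - x) 0).
  + have := vec_lin (-1) x (u k); rewrite scaleN1r addrC => h.
    by apply: ae_imp3 h uk xE => z -> -> ->; rewrite !mxE mulN1r addrC.
Qed.

Lemma Lnorm2E (f : R -> R) : f \in Lfun mu 2%:E ->
  Lnorm mu 2%:E (EFin \o f) = (Num.sqrt (\int[mu]_z (f z ^+ 2)))%:E.
Proof.
move=> /Lfun2P[mf fi]; rewrite unlock.
have -> : (\int[mu]_x (`|(EFin \o f) x| `^ 2))%E = (\int[mu]_z (f z ^+ 2))%:E.
  rewrite /Rintegral fineK; last exact: integrable_fin_num.
  apply: eq_integral => z _; rewrite /= powR_mulrn// -normrX ger0_norm ?sqr_ge0//.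
rewrite poweR_EFin powR12_sqrt//; apply: Rintegral_ge0 => z _; exact: sqr_ge0.
Qed.

Lemma Lnorm2_cvg0 (f : nat -> R -> R) : (forall n, f n \in Lfun mu 2%:E) ->
  (forall e : R, 0 < e -> exists n, forall k, (n <= k)%N -> \int[mu]_z (f k z ^+ 2) <= e) ->
  Lnorm mu 2%:E (EFin \o f n) @[n --> \oo] --> 0%E.
Proof.
move=> fL f0; under eq_fun do rewrite Lnorm2E//.
apply: cvg_EFin; first exact: nearW.
apply/cvgrPdist_le => e e0; have [n hn] := f0 (e ^+ 2) (exprn_gt0 _ e0).
exists n => // k /= nk; rewrite sub0r normrN ger0_norm ?sqrtr_ge0//.
by rewrite -(ler_pXn2r (ltn0Sn 1)) ?nnegrE ?sqrtr_ge0 ?(ltW e0)// sqr_sqrtr ?hn// Rintegral_ge0// => z _; exact: sqr_ge0.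
Qed.

(** A Poincare inequality: [prim v] is bounded by the [L^1] norm of [v], hence by its [L^2] norm. *)
Lemma prim_sqr_le v : v \in Lfun mu 2%:E ->
  \int[mu]_z (prim a b v z ^+ 2) <= (b - a) ^+ 2 * \int[mu]_z (v z ^+ 2).
Proof.
move=> vL; have /Lfun2P[mv v2i] := vL; have vi := Lfun2_integrable vL.
have ai : mu.-integrable setT (EFin \o (fun z => `|v z|)) by exact: integrable_norm.
have cst k : \int[mu]_z (k : R) = k * (b - a).
  have -> : b - a = fine (mu setT) by rewrite leb_itvT.
  exact: Rintegral_cst.
set A := \int[mu]_z `|v z|.
have ba : 0 < b - a by rewrite subr_gt0.
have AE : A ^+ 2 <= (b - a) * \int[mu]_z (v z ^+ 2).
  (* The mean of [|v|], for which the nonnegative integral of [(|v| - t)^2] yields Cauchy-Schwarz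
     against [1]. *)
  pose t := A / (b - a).
  have : 0 <= \int[mu]_z (`|v z| - t) ^+ 2 by apply: Rintegral_ge0 => z _; exact: sqr_ge0.
  have oi : mu.-integrable setT (EFin \o (fun=> 1)).
    by apply/Lfun2_integrable/continuous_Lfun2 => // z; exact: cvg_cst.
  have -> : \int[mu]_z (`|v z| - t) ^+ 2 = \int[mu]_z (v z ^+ 2) + (- (2 * t) * A + t ^+ 2 * (b - a)).
    rewrite -[b - a]mul1r -cst -!RintegralZl// -RintegralD//; [|exact: integrable_scale..].
    rewrite -RintegralD//; last exact: integrable_lin.
    apply: eq_Rintegral => z _; rewrite -(real_normK (num_real (v z))).
    by move: `|v z| => y; ring.
  move=> h; have := mulr_ge0 (ltW ba) h.
  have tA : t * (b - a) = A by rewrite /t divfK// gt_eqF.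
  move: (\int[mu]_z _) => V.
  have -> : (b - a) * (V + (- (2 * t) * A + t ^+ 2 * (b - a))) = (b - a) * V - (t * (b - a)) * (2 * A - t * (b - a)) by ring.
  by rewrite tA; clearbody A; move: ((b - a) * V) => W; clear; rewrite expr2; lra.
apply: (@le_trans _ _ (A ^+ 2 * (b - a))); last first.
  by rewrite expr2 mulrC -mulrA ler_pM2l.
rewrite -cst; apply: le_Rintegral => //.
- by have /Lfun2P[_] := prim_Lfun2 0 ab vL; apply: eq_integrable => // z _; rewrite /= add0r.
- by apply: (bounded_integrable (C := `|A ^+ 2|)) => // x _; exact: lexx.
- move=> z _; rewrite -(real_normK (num_real (prim a b v z))).
  by rewrite lerXn2r ?nnegrE//; [exact: le_trans (prim_bound z vi) | exact: prim_bound].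
Qed.

(** Trace zero means a primitive of a function with integral zero. Only the derivatives have to be
    approximated: [prim_sqr_le] then controls the functions. *)
Lemma H10_prim u v : measurable_fun setT u -> v \in Lfun mu 2%:E ->
  {ae mu, forall z, u z = prim a b v z} -> \int[mu]_z v z = 0 -> H10 a b u.
Proof.
move=> mu_ vL uE v0; have [phi [tphi hphi]] := derivative_dense vL v0.
have uH : H1_with_derivative a b u v.
  by apply: (H1_prim (c := 0)) => //; apply: (ae_imp _ uE) => z ->; rewrite add0r.
have uL : u \in Lfun mu 2%:E by case: uH.
exists v; split=> //; exists phi; split=> //.
- apply: Lnorm2_cvg0 => [n|e e0].
    by apply: Lfun2B => //; exact: test_function_Lfun2.
  have c0 : 0 < (b - a) ^+ 2 by rewrite exprn_gt0// subr_gt0.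
  have [|n hn] := hphi (e / (b - a) ^+ 2); first exact: divr_gt0.
  exists n => k /hn; rewrite ler_pdivlMr// mulrC; apply: le_trans.
  have dL : (fun z => (phi k)^`()%classic z - v z) \in Lfun mu 2%:E.
    by apply: Lfun2B => //; exact: test_function_derive_Lfun2.
  apply: le_trans (prim_sqr_le dL); rewrite le_eqVlt; apply/orP; left; apply/eqP.
  apply: ae_eq_Rintegral.
  + apply: measurable_funX; apply: Lfun_measurable (Lfun2B _ uL).
    exact: test_function_Lfun2.
  + apply: measurable_funX; have := Lfun_measurable (prim_Lfun2 0 ab dL).
    by under eq_fun do rewrite add0r.
  + apply: (ae_imp _ uE) => z /= ->; rewrite [in LHS](test_function_prim ab (tphi k)).
    have := @prim_lin _ a b 1 (-1) (phi k)^`()%classic v z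
      (Lfun2_integrable (test_function_derive_Lfun2 ab (tphi k))) (Lfun2_integrable vL).
    rewrite mul1r mulN1r => <-; congr (prim _ _ _ _ ^+ 2).
    by apply/funext => y; rewrite mul1r mulN1r.
- apply: Lnorm2_cvg0 => [n|e e0]; last exact: hphi.
  by apply: Lfun2B => //; exact: test_function_derive_Lfun2.
Qed.

End trace_zero.

(** * Vector-valued primitives *)

Section vector_primitives.
Context (R : realType) (a b : R) (ab : a < b).
Local Notation mu := (leb_itv a b).

Definition vprim n (w : R -> 'cV[R]_n) (z : R) : 'cV[R]_n :=
  \col_i prim a b (fun t => w t i 0) z.

Lemma Lfun2v_integrable n (w : R -> 'cV[R]_n) i : Lfun2v a b w ->
  mu.-integrable setT (EFin \o (fun t => w t i 0)).
Proof. by move=> wL; exact/Lfun2_integrable. Qed.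

Lemma vprim_a n (w : R -> 'cV[R]_n) : vprim w a = 0.
Proof. by apply/colP => i; rewrite !mxE prim_a. Qed.

Lemma vprim_lin n k (v w : R -> 'cV[R]_n) z : Lfun2v a b v -> Lfun2v a b w ->
  vprim (fun t => k *: v t + w t) z = k *: vprim v z + vprim w z.
Proof.
move=> vL wL; apply/colP => i; rewrite !mxE -[prim a b (fun t => w t i 0) z]mul1r -prim_lin.
- by congr (prim a b _ z); apply/funext => t; rewrite !mxE mul1r.
- exact: Lfun2v_integrable.
- exact: Lfun2v_integrable.
Qed.

Lemma prim_sum (I : Type) (s : seq I) (k : I -> R) (f : I -> R -> R) z :
  (forall i, mu.-integrable setT (EFin \o f i)) ->
  mu.-integrable setT (EFin \o (fun t => \sum_(i <- s) k i * f i t)) /\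
  prim a b (fun t => \sum_(i <- s) k i * f i t) z = \sum_(i <- s) k i * prim a b (f i) z.
Proof.
move=> fi; elim: s => [|i s [IHi IH]].
  under eq_fun do rewrite big_nil.
  have zi : mu.-integrable setT (EFin \o (fun=> 0 : R)) by exact: integrable0.
  split => //; rewrite big_nil primE//.
  by under eq_Rintegral do rewrite mul0r; rewrite Rintegral_cst ?mul0r.
have e : (fun t => \sum_(j <- i :: s) k j * f j t) =
    (fun t => k i * f i t + 1 * \sum_(j <- s) k j * f j t).
  by apply/funext => t; rewrite big_cons mul1r.
rewrite {}e; split; first exact: integrable_lin.
by rewrite prim_lin// big_cons IH mul1r.
Qed.

Lemma vprim_mulmx n m (M : 'M[R]_(m, n)) (w : R -> 'cV[R]_n) z : Lfun2v a b w ->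
  vprim (fun t => M *m w t) z = M *m vprim w z.
Proof.
move=> wL; apply/colP => i; rewrite !mxE.
have [_ e] := prim_sum (index_enum 'I_n) (fun j => M i j) z (fun j => Lfun2v_integrable j wL).
rewrite (_ : (fun t => (M *m w t) i 0) = (fun t => \sum_j M i j * w t j 0)); last first.
  by apply/funext => t; rewrite mxE.
by rewrite e; apply: eq_bigr => j _; rewrite mxE.
Qed.

Lemma Lfun2v_prim n (c : 'cV[R]_n) (w : R -> 'cV[R]_n) : Lfun2v a b w ->
  Lfun2v a b (fun z => c + vprim w z).
Proof.
move=> wL i; under eq_fun do rewrite !mxE.
exact: prim_Lfun2.
Qed.

Lemma vparts n (c c' : 'cV[R]_n) (w w' : R -> 'cV[R]_n) : Lfun2v a b w -> Lfun2v a b w' ->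
  dot a b w (fun z => c' + vprim w' z) + dot a b w' (fun z => c + vprim w z) =
  ((c + vprim w b)^T *m (c' + vprim w' b)) 0 0 - (c^T *m c') 0 0.
Proof.
move=> wL wL'; rewrite !dotE//; [|exact: Lfun2v_prim..].
rewrite -big_split/= ![in RHS]mxE -sumrB; apply: eq_bigr => i _.
rewrite !mxE -prim_parts//; [|exact: Lfun2v_integrable..].
by congr (_ + _); apply: eq_Rintegral => z _; rewrite !mxE.
Qed.

Lemma H1_vprim n (f w : R -> 'cV[R]_n) :
  (forall i, H1_with_derivative a b (fun z => f z i 0) (fun z => w z i 0)) ->
  Lfun2v a b w /\ exists c, {ae mu, forall z, f z = c + vprim w z}.
Proof.
move=> h; split; first by move=> i; have [] := h i.
have /boolp.choice[c hc] : forall i, exists c, {ae mu, forall z, f z i 0 = c + prim a b (fun t => w t i 0) z}.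
  by move=> i; exact: H1_is_prim ab _ _ (h i).
exists (\col_i c i); apply: ae_imp (ae_forall hc) => z hz.
by apply/colP => i; rewrite hz !mxE.
Qed.

Lemma vprim_H1 n (f w : R -> 'cV[R]_n) c : Lfun2v a b f -> Lfun2v a b w ->
  {ae mu, forall z, f z = c + vprim w z} ->
  forall i, H1_with_derivative a b (fun z => f z i 0) (fun z => w z i 0).
Proof.
move=> fL wL fE i; apply: (H1_prim (c := c i 0)) => //.
  exact: Lfun_measurable (fL i).
by apply: ae_imp fE => z ->; rewrite !mxE.
Qed.

(** Continuity upgrades the equality to all of [[a, b]], endpoints included, so that traces are well
    defined. *)
Lemma vprim_unique n (w w' : R -> 'cV[R]_n) c c' : Lfun2v a b w -> Lfun2v a b w' ->
  {ae mu, forall z, c + vprim w z = c' + vprim w' z} ->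
  [/\ c = c', vprim w b = vprim w' b & {ae mu, forall z, w z = w' z}].
Proof.
move=> wL wL' h.
have cE z : z \in `[a, b] -> c + vprim w z = c' + vprim w' z.
  move=> zab; apply/colP => i; apply/eqP; rewrite -subr_eq0; apply/eqP.
  move: z zab; apply: (continuous_ae_eq0 ab); last first.
    by apply: ae_imp h => z ->; rewrite subrr.
  apply: continuous_subspaceT => z.
  under eq_fun do rewrite !mxE.
  apply: cvgB; apply: cvgD; do ?exact: cvg_cst.
    exact: prim_continuous (Lfun2v_integrable i wL) z.
  exact: prim_continuous (Lfun2v_integrable i wL') z.
have ce : c = c'.
  by have := cE a; rewrite !vprim_a !addr0; apply; rewrite in_itv/= lexx ltW.
split => //.
  have := cE b; rewrite ce in_itv/= lexx (ltW ab) => /(_ isT).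
  exact: addrI.
have : {ae mu, forall z, forall i, w z i 0 - w' z i 0 = 0}.
  apply: ae_forall => i; apply: (weak_derivative0 ab); first exact: Lfun2B.
  move=> phi tphi; have tL := test_function_Lfun2 ab tphi.
  have h1 := weak_derivative_prim (c i 0) ab (wL i) tphi.
  have h2 := weak_derivative_prim (c' i 0) ab (wL' i) tphi.
  under eq_Rintegral do rewrite mulrBl.
  rewrite RintegralB//; [|exact: Lfun2_integrableM..].
  apply/eqP; rewrite subr_eq0 -eqr_opp -h1 -h2; apply/eqP.
  apply: ae_eq_Rintegral.
  - by case/integrableP : (Lfun2_integrableM (prim_Lfun2 (c i 0) ab (wL i)) (test_function_derive_Lfun2 ab tphi)) => /measurable_EFinP.
  - by case/integrableP : (Lfun2_integrableM (prim_Lfun2 (c' i 0) ab (wL' i)) (test_function_derive_Lfun2 ab tphi)) => /measurable_EFinP.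
  - by apply: (ae_imp _ h) => z /colP/(_ i); rewrite !mxE => ->.
by apply: ae_imp => z hz; apply/colP => i; apply/eqP; rewrite -subr_eq0 hz.
Qed.

End vector_primitives.

(** * Boundary forms and port-Hamiltonian operators *)

Section boundary_matrices.
Context (R : realType) (N : nat) (P1 : 'M[R]_N) (symP1 : P1 = P1^T) (uP1 : P1 \in unitmx).

(** The negative of the boundary form; this is the sign that the block [- P1] of [effort] produces
    in [effort_form]. *)
Definition bmx : 'M[R]_(N + N) := block_mx (- P1) 0 0 P1.
Definition effort : 'M[R]_(N + N) := block_mx (- P1) P1 1%:M 1%:M.
Definition swap : 'M[R]_(N + N) := block_mx 0 1%:M 1%:M 0.

Lemma bmx_sym : bmx^T = bmx.
Proof. by rewrite /bmx tr_block_mx !trmx0 linearN/= -symP1. Qed.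

Lemma bmx_unit : bmx \in unitmx.
Proof.
suff /mulmx1_unit[] : bmx *m block_mx (- invmx P1) 0 0 (invmx P1) = 1%:M by [].
rewrite mulmx_block !mulmx0 !mul0mx !addr0 !add0r mulmxN mulNmx opprK mulmxV//.
by rewrite -scalar_mx_block.
Qed.

Lemma effort_unit : effort \in unitmx.
Proof.
suff /mulmx1_unit[] : effort *m (2^-1 *: block_mx (- invmx P1) 1%:M (invmx P1) 1%:M) = 1%:M by [].
rewrite -scalemxAr mulmx_block mulmxN mulNmx opprK mulmxV// !mul1mx !mulmx1.
rewrite !addNr scale_block_mx !scaler0.
have -> : 2^-1 *: (1%:M + 1%:M) = 1%:M :> 'M[R]_N.
  by rewrite -[X in X + X]scale1r -scalerDl scalerA mulVf ?scale1r// pnatr_eq0.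
by rewrite -scalar_mx_block.
Qed.

Lemma effort_form : effort^T *m swap *m effort = 2 *: bmx.
Proof.
rewrite /effort /swap tr_block_mx !trmx1 linearN/= -symP1 !mulmx_block.
rewrite !mulmx0 !mulmx1 !addr0 !add0r ?mul1mx ?mulmx1.
rewrite /bmx scale_block_mx !scaler0 !scaler_nat !mulr2n.
by rewrite addNr subrr.
Qed.

Lemma swapK : swap *m swap = 1%:M.
Proof.
rewrite /swap mulmx_block !mulmx0 !mul0mx !mulmx1 !addr0 !add0r.
by rewrite -scalar_mx_block.
Qed.

(** The form [swap] is positive on the vectors [(c, c)] and negative on [(c, - c)]; both subspaces
    are carried over to [bmx] by [effort]. *)
Definition posmx : 'M[R]_(N, N + N) := row_mx 1%:M 1%:M *m (invmx effort)^T.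
Definition negmx : 'M[R]_(N, N + N) := row_mx 1%:M (- 1%:M) *m (invmx effort)^T.

Lemma rform_effort (v : 'rV[R]_(N + N)) :
  rform bmx (v *m (invmx effort)^T) (v *m (invmx effort)^T) = 2^-1 * (v *m swap *m v^T) 0 0.
Proof.
have -> : bmx = 2^-1 *: (effort^T *m swap *m effort).
  by rewrite effort_form scalerA mulVf ?scale1r// pnatr_eq0.
rewrite /rform -scalemxAr -scalemxAl mxE trmx_mul trmxK !mulmxA.
rewrite -[v *m (invmx effort)^T *m effort^T]mulmxA -trmx_mul mulmxV ?effort_unit// trmx1 mulmx1.
by rewrite mulmxK ?effort_unit.
Qed.

Lemma sqnorm_tr_gt0 (c : 'rV[R]_N) : c != 0 -> 0 < (c *m c^T) 0 0.
Proof.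
move=> c0; have -> : (c *m c^T) 0 0 = sqnorm c^T by rewrite /sqnorm trmxK.
rewrite ltNge; apply: contra c0 => /sqnorm_eq0 /(congr1 trmx).
by rewrite trmxK trmx0 => ->.
Qed.

Lemma posmx_pos (c : 'rV[R]_N) : c != 0 -> 0 < rform bmx (c *m posmx) (c *m posmx).
Proof.
move=> c0; rewrite /posmx mulmxA rform_effort mulr_gt0 ?invr_gt0//.
rewrite mul_mx_row mulmx1 mul_row_block !mulmx0 !mulmx1 addr0 add0r tr_row_mx mul_row_col mxE.
by rewrite addr_gt0// sqnorm_tr_gt0.
Qed.

Lemma negmx_neg (c : 'rV[R]_N) : c != 0 -> rform bmx (c *m negmx) (c *m negmx) < 0.
Proof.
move=> c0; rewrite /negmx mulmxA rform_effort pmulr_rlt0 ?invr_gt0//.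
rewrite mul_mx_row mulmxN mulmx1 mul_row_block !mulmx0 !mulmx1 addr0 add0r tr_row_mx mul_row_col.
rewrite linearN/= mulNmx mulmxN mxE [X in X + _]mxE [X in _ + X]mxE.
by have := sqnorm_tr_gt0 c0; rewrite -oppr_lt0 => h; rewrite -oppr_gt0 opprD addr_gt0// oppr_gt0.
Qed.

(** Inverting [effort_form], with [swap] its own inverse, shows that the two matrices agree up to a
    factor [2]. *)
Lemma psd_effort (WB : 'M[R]_(N, N + N)) :
  let V := WB *m invmx effort in
  psdmx (V *m swap *m V^T) <->
  forall c : 'rV[R]_N, 0 <= (c *m (WB *m invmx bmx *m WB^T) *m c^T) 0 0.
Proof.
move=> V.
have bi : invmx effort *m swap *m (invmx effort)^T = 2^-1 *: invmx bmx.
  have h : invmx effort *m swap *m (invmx effort)^T *m (2 *: bmx) = 1%:M.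
    rewrite -effort_form !mulmxA -(mulmxA _ _^T) -trmx_mul mulmxV ?effort_unit// trmx1 mulmx1.
    by rewrite -(mulmxA _ swap swap) swapK mulmx1 mulVmx ?effort_unit.
  rewrite -[RHS]mul1mx -h -scalemxAr -[X in _ *: (X *m _)]scalemxAr -scalemxAl scalerA mulVf ?pnatr_eq0// scale1r.
  by rewrite mulmxK ?bmx_unit.
have -> : V *m swap *m V^T = 2^-1 *: (WB *m invmx bmx *m WB^T).
  rewrite /V trmx_mul !mulmxA -(mulmxA WB) -(mulmxA WB) bi.
  by rewrite -scalemxAr -scalemxAl.
have q (c : 'rV[R]_N) : (c *m (2^-1 *: (WB *m invmx bmx *m WB^T)) *m c^T) 0 0 =
    2^-1 * (c *m (WB *m invmx bmx *m WB^T) *m c^T) 0 0.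
  by rewrite -scalemxAr -scalemxAl mxE.
split=> [[_ h] c|h].
  have := h c^T; rewrite trmxK q pmulr_rge0//.
split; last first.
  by move=> v; have := h v^T; have := q v^T; rewrite trmxK => -> h'; rewrite mulr_ge0.
by rewrite linearZ/= !trmx_mul trmxK trmx_inv bmx_sym mulmxA.
Qed.

(* [M = 0] always works: only the rank of [WB] matters. *)
Lemma rank_factorization (WB : 'M[R]_(N, N + N)) : \rank WB = N ->
  exists (C : 'M[R]_(N + N)) (M L : 'M[R]_N),
     [/\ C \in unitmx, lemx (M^T *m M) 1%:M, L \in unitmx &
         WB *m C = L *m row_mx M 1%:M].
Proof.
move=> rW; exists (invmx (row_ebase WB) *m swap), 0, (col_ebase WB); split.
- rewrite unitmx_mul unitmx_inv row_ebase_unit/=.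
  by have [] := mulmx1_unit swapK.
- rewrite mulmx0 /lemx subr0; split; first by rewrite trmx1.
  by move=> v; rewrite mulmx1; exact: sqnorm_ge0.
- exact: col_ebase_unit.
- rewrite -{1}(mulmx_ebase WB) !mulmxA mulmxK ?row_ebase_unit// -mulmxA; congr (_ *m _).
  rewrite rW pid_mx_row.
  by rewrite mul_row_block !mulmx0 !mulmx1 !addr0.
Qed.

End boundary_matrices.

Lemma cvg_colP (R : realType) (T : Type) (F : set_system T) {FF : Filter F} n
  (f : T -> 'cV[R]_n) (l : 'cV[R]_n) :
  f @ F --> l <-> forall i, (fun t => f t i 0) @ F --> l i 0.
Proof.
split=> [/cvg_ballP h i|h]; apply/cvg_ballP => e e0.
  by apply: filterS (h e e0) => t [_ ht]; exact: (ht i 0).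
have : \forall t \near F, forall i, ball (l i 0) e (f t i 0).
  by apply: filter_forall => i; have /cvg_ballP/(_ e e0) := h i.
by apply: filterS => t ht; split => // i j; rewrite ord1; exact: ht.
Qed.

(** * Operators restricted by conditions on the trace *)

Section port_hamiltonian_operators.
Context (R : realType) (N : nat) (a b : R) (ab : a < b).
Local Notation mu := (leb_itv a b).
Context (P1 P0 : 'M[R]_N) (symP1 : P1 = P1^T) (uP1 : P1 \in unitmx) (skewP0 : P0 = - P0^T).
Context (H : R -> 'M[R]_N).
Context (mH : forall i j, measurable_fun setT (fun z => H z i j)).
Context (c0 c1 : R) (c00 : 0 < c0) (c10 : 0 < c1)
  (hH : {ae mu, forall z, [/\ lemx c0%:M (H z), H z = (H z)^T & lemx (H z) c1%:M]}).
Local Notation L2N := (L2N N a b).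
Local Notation ip := (@ipH R N a b H).
Local Notation hip := (inner_product_ipH mH c00 hH).
Local Notation HL x := (Lfun2v_Hmul mH c00 hH x).
Implicit Types (x y z r : L2N) (w : R -> 'cV[R]_N) (c : 'cV[R]_N) (tau : 'cV[R]_(N + N)).

(* [H x] has derivative [w] and value [c] at [a], and [y = P1 (H x)' + P0 H x]. *)
Definition graph x y w c :=
  [/\ Lfun2v a b w, {ae mu, forall t, Hmul H x t = c + vprim a b w t} &
      {ae mu, forall t, vec y t = P1 *m w t + P0 *m Hmul H x t}].

Definition trace w c : 'cV[R]_(N + N) := col_mx (c + vprim a b w b) c.

Definition boundary_form tau tau' : R :=
  (tau^T *m block_mx P1 0 0 (- P1) *m tau') 0 0.

Definition restriction (D : set 'cV[R]_(N + N)) : set (L2N * L2N) :=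
  [set p | exists w c, graph p.1 p.2 w c /\ D (trace w c)].

Lemma acts_asP x y : acts_as P1 P0 H x y <-> exists w c, graph x y w c.
Proof.
split=> [[w [wd yE]]|[w [c [wL xE yE]]]].
  by have [wL [c xE]] := H1_vprim ab wd; exists w, c.
exists w; split => //; exact: vprim_H1 (HL x) wL xE.
Qed.

Lemma boundary_domainP WB x : boundary_domain H WB x <->
  exists w c, [/\ Lfun2v a b w, {ae mu, forall t, Hmul H x t = c + vprim a b w t} &
    WB *m trace w c = 0].
Proof.
have vc w c : Lfun2v a b w -> {within `[a, b], continuous (fun t => c + vprim a b w t)}.
  move=> wL; apply: continuous_subspaceT => t; apply/cvg_colP => i.
  under eq_fun do rewrite !mxE.
  rewrite !mxE; apply: cvgD; first exact: cvg_cst.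
  exact: prim_continuous (Lfun2v_integrable i wL) t.
split=> [[xH1 [u [[uc uE] Wu]]]|[w [c [wL xE Wt]]]].
  have /boolp.choice[w wd] : forall i, exists wi, H1_with_derivative a b (fun t => Hmul H x t i 0) wi.
    by move=> i; exact: xH1.
  have [wL [c xE]] := @H1_vprim _ _ _ ab _ (Hmul H x) (fun t => \col_i w i t)
    (fun i => ltac:(by under [X in H1_with_derivative _ _ _ X]eq_fun do rewrite mxE; exact: wd)).
  exists (fun t => \col_i w i t), c; split => //.
  (* Two continuous representatives of [H x] agree at every point, in particular at [a] and [b]. *)
  have ue t : t \in `[a, b] -> c + vprim a b (fun t => \col_i w i t) t = u t.
    move=> tab; apply/colP => i; apply/eqP; rewrite -subr_eq0; apply/eqP.
    move: t tab; apply: (continuous_ae_eq0 ab); last first.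
      by apply: ae_imp2 xE uE => t -> /(_ Logic.I) ->; rewrite subrr.
    move=> t; apply: cvgB; have /cvg_colP/(_ i) := vc _ c wL t; first exact.
    by move=> _; have /cvg_colP/(_ i) := uc t.
  rewrite -[RHS]Wu; congr (WB *m col_mx _ _).
    by apply: ue; rewrite in_itv/= lexx ltW.
  by rewrite -ue ?vprim_a ?addr0// in_itv/= lexx ltW.
split; first by move=> i; exists (fun t => w t i 0); exact: vprim_H1 (HL x) wL xE i.
exists (fun t => c + vprim a b w t); split; last by rewrite vprim_a addr0.
by split; [exact: vc | apply: ae_imp xE => t <-].
Qed.

Lemma graph_lin k x y w c x' y' w' c' : graph x y w c -> graph x' y' w' c' ->
  graph (k *: x + x') (k *: y + y') (fun t => k *: w t + w' t) (k *: c + c').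
Proof.
move=> [wL xE yE] [wL' xE' yE']; split.
- exact: Lfun2v_lin.
- apply: ae_imp3 (Hmul_lin H k x x') xE xE' => t -> -> ->.
  by rewrite vprim_lin// scalerDr addrACA.
- apply: ae_imp3 (ae_imp2 (fun t => @conj _ _) (Hmul_lin H k x x') (vec_lin k y y')) yE yE'.
  move=> t [-> ->] -> ->.
  by rewrite !mulmxDr -!scalemxAr scalerDr addrACA.
Qed.

Lemma trace_lin k w c w' c' : Lfun2v a b w -> Lfun2v a b w' ->
  trace (fun t => k *: w t + w' t) (k *: c + c') = k *: trace w c + trace w' c'.
Proof.
move=> wL wL'; rewrite /trace vprim_lin// scale_col_mx add_col_mx.
by rewrite scalerDr addrACA.
Qed.

Lemma graph_unique x y w c y' w' c' : graph x y w c -> graph x y' w' c' ->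
  y = y' /\ trace w c = trace w' c'.
Proof.
move=> [wL xE yE] [wL' xE' yE'].
have [|-> e we] := vprim_unique ab (c := c) (c' := c') wL wL'.
  by apply: ae_imp2 xE xE' => t <- <-.
split; last by rewrite /trace e.
by apply: vec_inj; apply: ae_imp3 yE yE' we => t -> -> ->.
Qed.

Lemma graph_exists w c : Lfun2v a b w -> exists x y, graph x y w c.
Proof.
move=> wL; have uL := Lfun2v_prim ab c wL.
have [x xE] := Hmul_lift mH c00 hH uL.
have [y yE] := Lfun2v_lift (Lfun2v_add (Lfun2v_mulmx P1 wL) (Lfun2v_mulmx P0 (HL x))).
by exists x, y.
Qed.

(** Take [H x] affine: its derivative [w] is the slope between the two prescribed values. *)
Lemma trace_surjective tau : exists x y w c, graph x y w c /\ trace w c = tau.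
Proof.
have ba : b - a != 0 by rewrite subr_eq0 gt_eqF.
pose w (t : R) : 'cV[R]_N := (b - a)^-1 *: (usubmx tau - dsubmx tau).
have oL : (fun=> 1 : R) \in Lfun mu 2%:E.
  by apply: continuous_Lfun2 => // t; exact: cvg_cst.
have wL : Lfun2v a b w.
  by move=> i; apply: continuous_Lfun2 => // t; exact: cvg_cst.
have [x [y g]] := graph_exists (dsubmx tau) wL; exists x, y, w, (dsubmx tau).
split => //; rewrite /trace -[RHS]vsubmxK; congr col_mx.
have -> : vprim a b w b = usubmx tau - dsubmx tau.
  apply/colP => i; rewrite mxE prim_b; last exact: Lfun2v_integrable.
  rewrite (_ : \int[mu]_z w z i 0 = w 0 i 0 * (b - a)).
    by rewrite /w mxE mulrAC mulVf// mul1r.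
  have -> : b - a = fine (mu setT) by rewrite leb_itvT.
  exact: Rintegral_cst.
by rewrite addrC subrK.
Qed.

(** The weight puts [H z] next to [y] and [H x] next to [r]. The [P0] terms cancel by skewness, and
    those with [P1] are integrated by parts. *)
Lemma green x y w c z r w' c' : graph x y w c -> graph z r w' c' ->
  ip y z + ip x r = boundary_form (trace w c) (trace w' c').
Proof.
move=> [wL xE yE] [wL' zE rE].
have uL := Lfun2v_prim ab c wL; have uL' := Lfun2v_prim ab c' wL'.
pose u t := c + vprim a b w t; pose u' t := c' + vprim a b w' t.
have half x1 y1 z1 w1 (u1 v1 : R -> 'cV[R]_N) : Lfun2v a b w1 -> Lfun2v a b u1 -> Lfun2v a b v1 ->
    {ae mu, forall t, Hmul H x1 t = u1 t} -> {ae mu, forall t, Hmul H z1 t = v1 t} ->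
    {ae mu, forall t, vec y1 t = P1 *m w1 t + P0 *m Hmul H x1 t} ->
    ip y1 z1 = dot a b (fun t => P1 *m w1 t) v1 + dot a b (fun t => P0 *m u1 t) v1.
  move=> w1L u1L v1L x1E z1E y1E.
  have e1 : {ae mu, forall t, vec y1 t = 1 *: (P1 *m w1 t) + P0 *m u1 t}.
    by apply: ae_imp2 y1E x1E => t -> ->; rewrite scale1r.
  rewrite ipHE (dot_ae (Lfun2v_vec y1) (HL z1) _ v1L e1 z1E); last first.
    exact: Lfun2v_lin (Lfun2v_mulmx P1 w1L) (Lfun2v_mulmx P0 u1L).
  by rewrite (dot_lin 1 (Lfun2v_mulmx P1 w1L) (Lfun2v_mulmx P0 u1L) v1L) mul1r.
rewrite (half x y z w u u')// (ipC hip x r) (half z r x w' u' u)//.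
have -> : dot a b (fun t => P0 *m u' t) u = - dot a b (fun t => P0 *m u t) u'.
  rewrite dot_mulmx dotC.
  (* The sign is written as [-2 + 1] to fit the shape [k *: f + g] of [dot_lin]. *)
  have -> : (fun t => P0^T *m u t) = (fun t => (-2) *: (P0 *m u t) + P0 *m u t).
    apply/funext => t; rewrite -{2}[P0 *m u t]scale1r -scalerDl [in RHS]skewP0.
    by rewrite mulNmx scalerN -scaleNr -[LHS]scale1r; congr (_ *: _); ring.
  have pL := Lfun2v_mulmx P0 uL.
  by rewrite (dot_lin (-2) pL pL uL'); ring.
rewrite addrACA subrr addr0.
have -> : dot a b (fun t => P1 *m w' t) u = dot a b w' (fun t => P1 *m c + vprim a b (fun t => P1 *m w t) t).
  rewrite dot_mulmx -symP1; congr dot; apply/funext => t.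
  by rewrite vprim_mulmx// -mulmxDr.
rewrite vparts//; last exact: Lfun2v_mulmx.
rewrite vprim_mulmx// -mulmxDr /boundary_form /trace tr_col_mx mul_row_block !mulmx0 addr0 add0r.
rewrite mul_row_col mulmxN mulNmx !trmx_mul -symP1.
by rewrite [RHS]mxE [X in _ = _ + X]mxE.
Qed.

Lemma dot_delta i (f : R -> R) (g : R -> 'cV[R]_N) :
  dot a b (fun t => f t *: delta_mx i 0) g = \int[mu]_t (g t i 0 * f t).
Proof.
apply: eq_Rintegral => t _.
by rewrite linearZ/= trmx_delta -scalemxAl mxE -rowE mxE mulrC.
Qed.

Lemma Lfun2v_scale (f : R -> R) (p : 'cV[R]_N) : f \in Lfun mu 2%:E ->
  Lfun2v a b (fun t => f t *: p).
Proof.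
move=> fL j; have := Lfun2Z (p j 0) fL.
by under eq_fun do rewrite mulrC; under [X in _ -> X \in _]eq_fun do rewrite mxE.
Qed.

Lemma test_graph (p : 'cV[R]_N) phi : test_function a b phi -> exists z r,
  [/\ graph z r (fun t => phi^`()%classic t *: p) 0,
      trace (fun t => phi^`()%classic t *: p) 0 = 0 &
      {ae mu, forall t, Hmul H z t = phi t *: p}].
Proof.
move=> tphi; pose dphi := phi^`()%classic.
have dL := test_function_derive_Lfun2 ab tphi.
have pw t : vprim a b (fun t => dphi t *: p) t = phi t *: p.
  apply/colP => j; rewrite [LHS]mxE [RHS]mxE.
  rewrite [in RHS](test_function_prim ab tphi) mulrC.
  have di := Lfun2_integrable dL.
  have := @prim_lin _ a b (p j 0) 0 dphi dphi t di di.
  rewrite mul0r addr0 => <-; congr (prim a b _ t); apply/funext => t'.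
  by rewrite mul0r addr0 !mxE mulrC.
have [z [r zr]] := graph_exists 0 (Lfun2v_scale p dL); exists z, r; split => //.
  by rewrite /trace pw (test_function_b tphi) scale0r addr0 col_mx0.
by have [_ zE _] := zr; apply: ae_imp zE => t ->; rewrite pw add0r.
Qed.

(* Testing against the [z] with [H z = phi e_i] shows that [P1 H x] has a weak
   derivative; Green's identity then gives the condition on the trace. *)
Lemma weak_identity_graph (D : set 'cV[R]_(N + N)) x y : D 0 ->
  (forall z r, restriction D (z, r) -> ip y z + ip x r = 0) ->
  exists w c, graph x y w c /\ forall tau, D tau -> boundary_form (trace w c) tau = 0.
Proof.
move=> D0 xy0; set u := Hmul H x; have uL : Lfun2v a b u := HL x.
have yL := Lfun2v_vec y.
pose v t := (-1) *: (P0 *m u t) + vec y t.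
have vL : Lfun2v a b v by exact: Lfun2v_lin (Lfun2v_mulmx P0 uL) yL.
have wd i : H1_with_derivative a b (fun t => (P1 *m u t) i 0) (fun t => v t i 0).
  split; [exact: (Lfun2v_mulmx P1 uL i) | exact: vL | move=> phi tphi].
  have tL := test_function_Lfun2 ab tphi; have dL := test_function_derive_Lfun2 ab tphi.
  have [z [r [zr tz zE]]] := test_graph (delta_mx i 0) tphi.
  have : restriction D (z, r).
    by exists (fun t => phi^`()%classic t *: delta_mx i 0), 0; rewrite tz.
  move=> /xy0; have [wL _ rE] := zr; have pL := Lfun2v_scale (delta_mx i 0) tL.
  rewrite ipHE (dot_ae yL (HL z) yL pL (aeW _ (fun=> erefl)) zE) dotC dot_delta.
  have rE' : {ae mu, forall t, vec r t =
      1 *: (P1 *m (phi^`()%classic t *: delta_mx i 0)) + P0 *m (phi t *: delta_mx i 0)}.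
    by apply: ae_imp2 rE zE => t -> ->; rewrite scale1r.
  have P1wL := Lfun2v_mulmx P1 wL; have P0pL := Lfun2v_mulmx P0 pL.
  rewrite (ipC hip) ipHE (dot_ae (Lfun2v_vec r) uL (Lfun2v_lin 1 P1wL P0pL) uL rE' (aeW _ (fun=> erefl))).
  rewrite (dot_lin 1 P1wL P0pL uL) mul1r !dot_mulmx -symP1 !dot_delta => h.
  have -> : \int[mu]_t (v t i 0 * phi t) = \int[mu]_t (vec y t i 0 * phi t) +
      \int[mu]_t ((P0^T *m u t) i 0 * phi t).
    have P0tL := Lfun2v_mulmx P0^T uL.
    rewrite -RintegralD//; [|exact: Lfun2_integrableM (yL i) tL|exact: Lfun2_integrableM (P0tL i) tL].
    apply: eq_Rintegral => t _; rewrite -mulrDl; congr (_ * _).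
    by rewrite /v scaleN1r [in LHS]skewP0 mulNmx opprK mxE addrC.
  by move: h; rewrite addrCA => /eqP; rewrite addr_eq0 => /eqP.
have [_ [c uE]] := H1_vprim ab wd.
pose w t := invmx P1 *m v t; have wL : Lfun2v a b w by exact: Lfun2v_mulmx.
have g : graph x y w (invmx P1 *m c).
  split => //.
  - apply: ae_imp uE => t; rewrite vprim_mulmx// -mulmxDr => <-.
    by rewrite mulKmx.
  - by apply: aeW => t; rewrite /w mulKVmx// /v scaleN1r addrAC addNr add0r.
exists w, (invmx P1 *m c); split => // tau Dtau.
have [z [r [w' [c' [gz tE]]]]] := trace_surjective tau.
rewrite -tE -(green g gz); apply: xy0.
by exists w', c'; split => //; rewrite tE.
Qed.

Lemma boundary_formE tau tau' : boundary_form tau tau' = - rform (bmx P1) tau^T tau'^T.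
Proof.
rewrite /boundary_form -rform_opp /rform !trmxK /bmx opp_block_mx !oppr0 opprK.
by [].
Qed.

Lemma boundary_form_linl k tau tau' eta :
  boundary_form (k *: tau + tau') eta = k * boundary_form tau eta + boundary_form tau' eta.
Proof. by rewrite !boundary_formE linearP/= rform_linl opprD mulrN. Qed.

Lemma boundary_formC tau tau' : boundary_form tau tau' = boundary_form tau' tau.
Proof. by rewrite !boundary_formE rform_sym// bmx_sym. Qed.

Definition subspace (D : set 'cV[R]_(N + N)) :=
  D 0 /\ forall k tau tau', D tau -> D tau' -> D (k *: tau + tau').

Lemma subspace_ker m (K : 'M[R]_(m, N + N)) : subspace [set tau | K *m tau = 0].
Proof.
split; first by rewrite /= mulmx0.
by move=> k tau tau' /= h h'; rewrite mulmxDr -scalemxAr h h' scaler0 addr0.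
Qed.

Lemma restriction_graph D x y w c : restriction D (x, y) -> graph x y w c -> D (trace w c).
Proof. by move=> [w' [c' [/= g Dt]]] g'; have [_ ->] := graph_unique g' g. Qed.

Lemma restriction_operator D : subspace D -> linear_operator (restriction D).
Proof.
move=> [D0 Dlin]; split; last first.
  by move=> x y y' [w [c [g _]]] [w' [c' [g' _]]]; have [] := graph_unique g g'.
have lin k x y x' y' : restriction D (x, y) -> restriction D (x', y') ->
    restriction D (k *: x + x', k *: y + y').
  move=> [w [c [g Dt]]] [w' [c' [g' Dt']]].
  exists (fun t => k *: w t + w' t), (k *: c + c'); split; first exact: graph_lin.
  by case: g g' => wL _ _ [wL' _ _]; rewrite trace_lin//; exact: Dlin.
split; last by move=> k [x y] [x' y'] h h'; exact: lin.
have [x [y [w [c [g t0]]]]] := trace_surjective 0.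
have xy : restriction D (x, y) by exists w, c; rewrite t0.
by have := lin (-1) _ _ _ _ xy xy; rewrite !scaleN1r !addNr.
Qed.

Lemma restriction_accretive D :
  accretive ip (restriction D) <-> forall tau, D tau -> 0 <= boundary_form tau tau.
Proof.
have self x y w c : graph x y w c -> boundary_form (trace w c) (trace w c) = 2 * ip y x.
  by move=> g; rewrite -(green g g) (ipC hip x) mulr2n mulrDl mul1r.
split=> [acc tau Dt|h x y [w [c [/= g /h]]]]; last by rewrite (self _ _ _ _ g) pmulr_rge0.
have [x [y [w [c [g tE]]]]] := trace_surjective tau.
rewrite -tE (self _ _ _ _ g) mulr_ge0//; apply: acc.
by exists w, c; rewrite tE.
Qed.

Lemma ip_cvg_add_eq0 (u w : nat -> L2N) x y z r : (forall n : nat, ip (w n) z + ip (u n) r = 0) ->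
  ip_cvg ip u x -> ip_cvg ip w y -> ip y z + ip x r = 0.
Proof.
move=> h0 ux wy; apply/eqP; rewrite -normr_le0; apply/ler_addgt0Pr => e e0; rewrite add0r.
pose m := ip_norm ip z + ip_norm ip r + 1.
have m0 : 0 < m by rewrite ltr_wpDl// addr_ge0// nrm_ge0.
have [n1 h1] := ux _ (divr_gt0 e0 m0); have [n2 h2] := wy _ (divr_gt0 e0 m0).
have := h1 _ (leq_maxl n1 n2); have := h2 _ (leq_maxr n1 n2).
set n := maxn n1 n2 => wn un.
have -> : ip y z + ip x r = - (ip (w n - y) z + ip (u n - x) r).
  rewrite !(ipBl hip); move: (h0 n); move: (ip (w n) z) (ip (u n) r) (ip y z) (ip x r).
  by clear => p q s t h; rewrite -[LHS]subr0 -h; ring.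
rewrite normrN; apply: le_trans (ler_normD _ _) _.
have e1 := le_trans (cauchy_schwarz hip (w n - y) z) (ler_wpM2r (nrm_ge0 _ _) wn).
have e2 := le_trans (cauchy_schwarz hip (u n - x) r) (ler_wpM2r (nrm_ge0 _ _) un).
apply: le_trans (lerD e1 e2) _; rewrite -mulrDr mulrAC ler_pdivrMr// ler_pM2l//.
by rewrite lerDl.
Qed.

Definition perp (D : set 'cV[R]_(N + N)) : set 'cV[R]_(N + N) :=
  [set tau | forall eta, D eta -> boundary_form eta tau = 0].

Lemma perp0 D : perp D 0.
Proof. by move=> eta _; rewrite /boundary_form mulmx0 mxE. Qed.

(** The vector [Q^-1 (row i K)^T] lies in [perp] of the kernel, and pairing with it reads off the
    entry [i] of [K *m tau]. *)
Lemma perp_perp_ker m (K : 'M[R]_(m, N + N)) tau :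
  (forall eta, perp [set t | K *m t = 0] eta -> boundary_form tau eta = 0) -> K *m tau = 0.
Proof.
move=> h; apply/colP => i; rewrite [RHS]mxE.
pose Q := block_mx P1 0 0 (- P1).
have uQ : Q \in unitmx.
  by rewrite -[Q]opprK /Q opp_block_mx !oppr0 opprK -/(bmx P1) -scaleN1r unitmxZ ?unitrN1 ?bmx_unit.
have bf eta : boundary_form eta (invmx Q *m (row i K)^T) = (K *m eta) i 0.
  rewrite /boundary_form -/Q mulmxA mulmxK// -trmx_mul mxE.
  by rewrite -row_mul mxE.
rewrite -bf; apply: h => eta /= Ke.
by rewrite bf Ke mxE.
Qed.

(** Green's identity against the restriction to [perp D] passes to the limit; by
    [weak_identity_graph] the limit then has a trace in [D^perp^perp = D]. *)
Lemma restriction_closed m (K : 'M[R]_(m, N + N)) (u w : nat -> L2N) x y :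
  (forall n, restriction [set tau | K *m tau = 0] (u n, w n)) ->
  ip_cvg ip u x -> ip_cvg ip w y -> restriction [set tau | K *m tau = 0] (x, y).
Proof.
move=> Kn ux wy; set D := [set tau | _].
have [|w' [c [g gp]]] := @weak_identity_graph (perp D) x y (@perp0 D).
  move=> z r [w' [c' [/= g' Dt]]]; apply: ip_cvg_add_eq0 ux wy => n.
  have [wn [cn [/= gn Dn]]] := Kn n.
  by rewrite (green gn g'); exact: Dt.
by exists w', c; split => //; exact: perp_perp_ker.
Qed.

(** Orthogonality says that [(v, la^-1 *: v)] satisfies the weak identity, so its trace [tau] lies
    in [perp D], and [boundary_form tau tau = 2 * la^-1 * |v|^2]. *)
Lemma range_orthogonal D la v : 0 < la -> subspace D ->
  (forall tau, perp D tau -> boundary_form tau tau <= 0) ->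
  (forall x y, restriction D (x, y) -> ip (x + la *: y) v = 0) -> v = 0.
Proof.
move=> la0 [D0 _] Dp vp.
have [|w [c [g gp]]] := @weak_identity_graph D v (la^-1 *: v) D0.
  move=> z r /vp; rewrite (ipDl hip) !(ipZl hip) (ipC hip z) (ipC hip r) => h.
  apply: (mulfI (lt0r_neq0 la0)).
  by rewrite mulrDr mulr0 mulrA mulfV ?lt0r_neq0// mul1r.
have := Dp (trace w c); rewrite -(green g g) (ipC hip v) !(ipZl hip) => h.
apply: (ip_eq0 hip); apply/eqP; rewrite eq_le (ip_ge0 hip) andbT.
have /h : perp D (trace w c) by move=> eta /gp; rewrite boundary_formC.
by rewrite -mulr2n -mulr_natl mulrA pmulr_rle0// mulr_gt0// invr_gt0.
Qed.

Lemma restriction_generates m (K : 'M[R]_(m, N + N)) :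
  (forall tau, K *m tau = 0 -> 0 <= boundary_form tau tau) ->
  (forall tau, perp [set t | K *m t = 0] tau -> boundary_form tau tau <= 0) ->
  generates_C0_contraction_semigroup ip (opp_rel (restriction [set tau | K *m tau = 0])).
Proof.
move=> Kge Kle; have sK := subspace_ker K; have opK := restriction_operator sK.
have acc : accretive ip (restriction [set tau | K *m tau = 0]) by exact/restriction_accretive.
have cpl := complete_ipH mH c00 c10 hH.
apply: (lumer_phillips hip opK acc cpl) => la z la0.
apply: (closed_accretive_onto hip cpl la0 _ acc); first by case: opK.
  by move=> u w x y; exact: restriction_closed.
by move=> v; exact: range_orthogonal.
Qed.

Lemma dom_dense D v : D 0 -> (forall x y, restriction D (x, y) -> ip x v = 0) -> v = 0.
Proof.
move=> D0 h; have vL := Lfun2v_vec v.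
have v0 i : {ae mu, forall t, vec v t i 0 = 0}.
  apply: (weak_derivative0 ab (vL i)) => phi tphi.
  have [z [r [zr tz zE]]] := test_graph (delta_mx i 0) tphi.
  have pL := Lfun2v_scale (delta_mx i 0) (test_function_Lfun2 ab tphi).
  rewrite -dot_delta dotC -(dot_ae vL (HL z) vL pL (aeW _ (fun=> erefl)) zE) -ipHE (ipC hip).
  by apply: (h z r); exists (fun t => phi^`()%classic t *: delta_mx i 0), 0; rewrite tz.
apply: (ip_eq0 hip); rewrite ipHE.
have zL : Lfun2v a b (fun=> 0 : 'cV[R]_N).
  by move=> i; under eq_fun do rewrite mxE; exact: Lfun2_cst0.
have vE : {ae mu, forall t, vec v t = 0}.
  by apply: ae_imp (ae_forall v0) => t ht; apply/colP => i; rewrite ht mxE.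
rewrite (dot_ae vL (HL v) zL (HL v) vE (aeW _ (fun=> erefl))).
rewrite /dot; under eq_Rintegral do rewrite trmx0 mul0mx mxE.
by rewrite Rintegral_cst// mul0r.
Qed.

(** It suffices that [1 + A] is onto. A vector orthogonal to its range is orthogonal to the domain
    by [generator_range_orthogonal], hence zero. *)
Lemma generates_maximal m (K : 'M[R]_(m, N + N)) :
  let A := restriction [set tau | K *m tau = 0] in
  generates_C0_contraction_semigroup ip (opp_rel A) -> maximal_accretive ip A.
Proof.
move=> A [T sgT gE]; have cpl := complete_ipH mH c00 c10 hH.
have AE x y : A (x, y) <-> generator ip T (x, - y).
  by rewrite gE /opp_rel/= opprK.
have acc : accretive ip A.
  by move=> x y /AE/(generator_dissipative hip sgT); rewrite (ipNl hip) oppr_le0.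
apply: (onto_maximal_accretive hip acc) => z.
have [[linA _] _] := restriction_operator (subspace_ker K).
have [||x [y [Axy ->]]] := closed_accretive_onto hip cpl ltr01 (restriction_operator (subspace_ker K)).1 acc _ _ z.
- by move=> u w x y; exact: restriction_closed.
- move=> v vp; apply: (@dom_dense [set tau | K *m tau = 0]); first by rewrite /= mulmx0.
  move=> x y /AE; apply: (generator_range_orthogonal hip sgT) => {}x {}y g.
  by have := vp x (- y); rewrite scale1r; apply; apply/AE; rewrite opprK.
- by exists x, y; rewrite scale1r.
Qed.

(** Adjoining [tau] keeps the form nonnegative, because the cross terms vanish; maximality then
    forces the larger restriction to be [A] itself. *)
Lemma maximal_subspace D tau : subspace D -> maximal_accretive ip (restriction D) ->
  perp D tau -> 0 <= boundary_form tau tau -> D tau.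
Proof.
move=> sD [acc maxD] pt t0; have [D0 Dlin] := sD.
pose D' : set 'cV[R]_(N + N) := [set eta | exists k d, D d /\ eta = k *: tau + d].
have sD' : subspace D'.
  split; first by exists 0, 0; rewrite scale0r addr0.
  move=> k _ _ [l [d [Dd ->]]] [l' [d' [Dd' ->]]].
  exists (k * l + l'), (k *: d + d'); split; first exact: Dlin.
  by rewrite scalerDr scalerDl scalerA addrACA.
have acc' : accretive ip (restriction D').
  apply/restriction_accretive => _ [k [d [Dd ->]]].
  rewrite boundary_form_linl (boundary_formC tau) (boundary_formC d) !boundary_form_linl.
  rewrite (boundary_formC tau d) (pt _ Dd) addr0 mulr0 add0r.
  by rewrite addr_ge0 ?(iffLR (restriction_accretive D) acc)// mulrA mulr_ge0// -expr2 sqr_ge0.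
have [x [y [w [c [g tE]]]]] := trace_surjective tau.
have : restriction D' (x, y).
  by exists w, c; split => //; exists 1, 0; split => //; rewrite scale1r addr0.
rewrite (maxD _ (restriction_operator sD').1 acc').
  by move=> /restriction_graph/(_ g); rewrite tE.
move=> [x' y'] [w' [c' [/= g' Dt]]]; exists w', c'; split => //.
by exists 0, (trace w' c'); rewrite scale0r add0r.
Qed.

End port_hamiltonian_operators.

(** * From the operator [A] to its boundary subspace and back *)

Section characterizations.
Context (R : realType) (N : nat) (a b : R) (ab : a < b).
Local Notation mu := (leb_itv a b).
Context (P1 P0 : 'M[R]_N) (symP1 : P1 = P1^T) (uP1 : P1 \in unitmx) (skewP0 : P0 = - P0^T).
Context (H : R -> 'M[R]_N).
Context (mH : forall i j, measurable_fun setT (fun z => H z i j)).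
Context (c0 c1 : R) (c00 : 0 < c0) (c10 : 0 < c1)
  (hH : {ae mu, forall z, [/\ lemx c0%:M (H z), H z = (H z)^T & lemx (H z) c1%:M]}).
Local Notation L2N := (L2N N a b).
Local Notation ip := (@ipH R N a b H).
Local Notation restriction := (restriction P1 P0 H).
Local Notation ker K := [set tau | K *m tau = 0].
Context (A : set (L2N * L2N)) (opA : linear_operator A)
  (actA : forall x y, A (x, y) -> acts_as P1 P0 H x y).

Local Notation act := (acts_asP ab P1 P0 mH c00 hH).

Lemma mulmx_tr_eq0 m (K : 'M[R]_(m, N + N)) (tau : 'cV[R]_(N + N)) :
  tau^T *m K^T = 0 <-> K *m tau = 0.
Proof.
rewrite -trmx_mul; split=> [/(congr1 trmx)|->]; last by rewrite trmx0.
by rewrite trmxK trmx0.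
Qed.

Lemma subspace_eq_ker (D : set 'cV[R]_(N + N)) : subspace D ->
  exists m (K : 'M[R]_(m, N + N)), D = ker K.
Proof.
move=> [D0 Dlin].
have [||M DM] := @subspace_matrix R (N + N) [set v | D v^T].
- by rewrite /= trmx0.
- by move=> k v w /= Dv Dw; rewrite linearP; exact: Dlin.
have [K hK] := @subspace_kernel R (N + N) _ M erefl; exists (N + N - \rank M)%N, K.
apply/seteqP; split=> tau /=.
  by move=> Dt; apply/mulmx_tr_eq0/hK/DM; rewrite /= trmxK.
by move=> /mulmx_tr_eq0/hK/DM; rewrite /= trmxK.
Qed.

(** Here [D] collects the traces of [A]. An [x] with trace in [D] differs from some element of
    [dom A] by one with trace zero, which [dom A] contains by hypothesis. *)
Lemma operator_restriction : Hmul_in H (H10 a b) `<=` dom A ->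
  exists2 D, subspace D & A = restriction D.
Proof.
move=> hAmin; have [[A0 Alin] Afun] := opA.
pose D : set 'cV[R]_(N + N) := [set tau | exists x y w c,
  [/\ A (x, y), graph P1 P0 H x y w c & trace a b w c = tau]].
have Dlin k tau tau' : D tau -> D tau' -> D (k *: tau + tau').
  move=> [x [y [w [c [Axy g <-]]]]] [x' [y' [w' [c' [Axy' g' <-]]]]].
  exists (k *: x + x'), (k *: y + y'), (fun t => k *: w t + w' t), (k *: c + c').
  split; [exact: (Alin k (x, y) (x', y')) | exact: graph_lin |].
  by case: g g' => wL _ _ [wL' _ _]; rewrite trace_lin.
have sD : subspace D.
  split=> //; have [w [c g]] := iffLR (act 0 0) (actA A0).
  have D0 : D (trace a b w c) by exists 0, 0, w, c.
  by have := Dlin (-1) _ _ D0 D0; rewrite scaleN1r addNr.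
exists D => //; apply/seteqP; split=> [[x y] Axy|[x y] [w [c [/= g]]]].
  have [w [c g]] := iffLR (act x y) (actA Axy); exists w, c; split => //.
  by exists x, y, w, c.
move=> [x' [y' [w' [c' [Axy' g' tE]]]]].
have [vL vE _] := graph_lin (-1) g' g.
have : trace a b (fun t => (-1) *: w' t + w t) ((-1) *: c' + c) = 0.
  by case: g' g => wL' _ _ [wL _ _]; rewrite trace_lin// tE scaleN1r addNr.
set v := (fun t => _) in vL vE *; set d := (_ + _ : 'cV_N) in vE *.
rewrite /trace -[RHS](col_mx0 _ N N) => /eq_col_mx[vb d0].
have : dom A ((-1) *: x' + x).
  apply: hAmin => i; apply: (H10_prim ab (v := fun t => v t i 0)).
  - exact: Lfun_measurable (Lfun2v_Hmul mH c00 hH _ i).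
  - exact: vL.
  - by apply: ae_imp vE => t ->; rewrite d0 add0r mxE.
  - rewrite -prim_b; last exact: Lfun2v_integrable.
    by move/colP : vb => /(_ i); rewrite d0 add0r !mxE.
move=> [z Az]; have := linear_relationP 1 (conj A0 Alin) Axy' Az.
rewrite !scale1r scaleN1r addrA subrr add0r => Ax.
have [w1 [c1' g1]] := iffLR (act x _) (actA Ax).
by have [-> _] := graph_unique ab g g1.
Qed.

Lemma dom_boundary_domain (WB : 'M[R]_(N, N + N)) :
  dom A = boundary_domain H WB <-> A = restriction (ker WB).
Proof.
split=> [domA|->].
  apply/seteqP; split=> [[x y] Axy|[x y] [w [c [/= g Wt]]]].
    have [w [c g]] := iffLR (act x y) (actA Axy).
    have : dom A x by exists y.
    rewrite domA => /(boundary_domainP ab mH c00 hH)[w' [c' [wL' xE' Wt]]].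
    have [wL xE yE] := g; exists w, c; split => //=.
    have [|ce we _] := vprim_unique ab (c := c) (c' := c') wL wL'.
      by apply: ae_imp2 xE xE' => t <- <-.
    by rewrite /trace ce we.
  have : dom A x.
    rewrite domA; apply/(boundary_domainP ab mH c00 hH); exists w, c.
    by case: g => wL xE _; split.
  move=> [y' Axy']; have [w' [c' g']] := iffLR (act x y') (actA Axy').
  by have [-> _] := graph_unique ab g g'.
apply/seteqP; split=> x.
  move=> [y [w [c [/= [wL xE _] Wt]]]]; apply/(boundary_domainP ab mH c00 hH).
  by exists w, c.
move=> /(boundary_domainP ab mH c00 hH)[w [c [wL xE Wt]]].
have [y yE] := Lfun2v_lift (Lfun2v_add (Lfun2v_mulmx P1 wL) (Lfun2v_mulmx P0 (Lfun2v_Hmul mH c00 hH x))).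
by exists y, w, c.
Qed.

(** The rank is a conclusion: a kernel of dimension above [N] would carry a vector of negative
    boundary form. *)
Lemma accretive_kernel (WB : 'M[R]_(N, N + N)) : dom A = boundary_domain H WB ->
  accretive ip A ->
  \rank WB = N /\ psdmx (WB *m invmx (effort P1) *m swap R N *m (WB *m invmx (effort P1))^T).
Proof.
move=> /dom_boundary_domain AE; rewrite AE.
move=> /(restriction_accretive ab symP1 skewP0 mH c00 hH) acc.
have [|rW Wp] := nonpos_kernel (bmx_sym symP1) (bmx_unit uP1) (posmx_pos symP1 uP1) (WB := WB).
  move=> v; rewrite -[v]trmxK => /mulmx_tr_eq0 /acc.
  by rewrite boundary_formE oppr_ge0 !trmxK.
by split => //; apply/(psd_effort symP1 uP1).
Qed.

Lemma psd_generates (WB : 'M[R]_(N, N + N)) : dom A = boundary_domain H WB ->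
  \rank WB = N ->
  psdmx (WB *m invmx (effort P1) *m swap R N *m (WB *m invmx (effort P1))^T) ->
  generates_C0_contraction_semigroup ip (opp_rel A).
Proof.
move=> /dom_boundary_domain AE rW /(psd_effort symP1 uP1) Wp; rewrite AE.
apply: (restriction_generates ab symP1 uP1 skewP0 mH c00 c10 hH) => tau.
  move=> /mulmx_tr_eq0 Wt; rewrite boundary_formE oppr_ge0.
  exact: (nonneg_inv_kernel (bmx_sym symP1) (bmx_unit uP1) (negmx_neg symP1 uP1) rW Wp Wt).
move=> tp; rewrite boundary_formE oppr_le0.
apply: (nonneg_inv_perp (bmx_sym symP1) (bmx_unit uP1) Wp) => v.
rewrite -[v]trmxK => /mulmx_tr_eq0 /tp /eqP.
by rewrite boundary_formE oppr_eq0 => /eqP.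
Qed.

Lemma maximal_boundary D : subspace D -> A = restriction D -> maximal_accretive ip A ->
  exists WB : 'M[R]_(N, N + N), dom A = boundary_domain H WB.
Proof.
move=> sD AE maxA; have [D0 Dlin] := sD.
have [acc _] := maxA.
rewrite AE in maxA acc; move/(restriction_accretive ab symP1 skewP0 mH c00 hH) in acc.
have [||||WB DW] := @maximal_nonpos_kernel R N (bmx P1)
  (bmx_sym symP1) _ _ [set v | D v^T] (posmx_pos symP1 uP1) (negmx_neg symP1 uP1).
- by rewrite /= trmx0.
- by move=> k v w /= Dv Dw; rewrite linearP; exact: Dlin.
- by move=> v /= /acc; rewrite boundary_formE oppr_ge0 trmxK.
- move=> y yp y0 /=.
  apply: (maximal_subspace ab symP1 skewP0 mH c00 hH sD maxA).
    move=> eta De; rewrite boundary_formE trmxK yp ?oppr0//=.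
    by rewrite trmxK.
  by rewrite boundary_formE trmxK oppr_ge0 ltW.
exists WB; apply/dom_boundary_domain; rewrite AE; congr restriction.
apply/seteqP; split=> tau /=.
  by move=> Dt; apply/mulmx_tr_eq0/DW; rewrite /= trmxK.
by move=> /mulmx_tr_eq0/DW; rewrite /= trmxK.
Qed.

End characterizations.

Theorem theorem4p1 (R : realType) (N : nat) (a b : R) (hab : a < b)
  (P1 : 'M[R]_N) (hP1 : P1 = P1^T) (hP1inv : P1 \in unitmx)
  (P0 : 'M[R]_N) (hP0 : P0 = - P0^T)
  (H : R -> 'M[R]_N)
  (hHLinfty : forall i j, (fun z => H z i j) \in Lfun (leb_itv a b) +oo%E)
  (c0 c1 : R) (hc0 : 0 < c0) (hc1 : 0 < c1)
  (hH : {ae leb_itv a b, forall z,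
          [/\ lemx c0%:M (H z), H z = (H z)^T & lemx (H z) c1%:M]})
  (A : set (L2N N a b * L2N N a b))
  (hA : linear_operator A)
  (hAact : forall x y, A (x, y) -> acts_as P1 P0 H x y)
  (hAmin : Hmul_in H (H10 a b) `<=` dom A)
  (hAmax : dom A `<=` Hmul_in H (H1 a b)) :
  let ip := @ipH R N a b H in
  let generates :=
    generates_C0_contraction_semigroup ip (opp_rel A) in
  let maximal := maximal_accretive ip A in
  let accretive_with_boundary :=
    accretive ip A /\
    exists WB : 'M[R]_(N, N + N), dom A = boundary_domain H WB in
  let rank_and_definiteness :=
    exists WB : 'M[R]_(N, N + N),
      [/\ dom A = boundary_domain H WB,
          \rank WB = N &
          let V := WB *m invmx (block_mx (- P1) P1 1%:M 1%:M) in
          psdmx (V *m block_mx 0 1%:M 1%:M 0 *m V^T)] in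
  [<-> generates; maximal; accretive_with_boundary; rank_and_definiteness] /\
  ([\/ generates, maximal, accretive_with_boundary | rank_and_definiteness] ->
   forall WB : 'M[R]_(N, N + N), dom A = boundary_domain H WB ->
   exists (C : 'M[R]_(N + N)) (M L : 'M[R]_N),
     [/\ C \in unitmx, lemx (M^T *m M) 1%:M, L \in unitmx &
         WB *m C = L *m row_mx M 1%:M]).
Proof.
move=> ip generates maximal accretive_with_boundary rank_and_definiteness.
have mH i j : measurable_fun setT (fun z => H z i j) := Lfun_measurable (hHLinfty i j).
have [D sD AD] := operator_restriction hab mH hc0 hH hA hAact hAmin.
have gen_max : generates -> maximal.
  (* The number [m] of boundary conditions is not yet known to be [N]. *)
  have [m [K DK]] := subspace_eq_ker sD.
  rewrite /generates /maximal AD DK.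
  exact: (generates_maximal hab hP1 hP1inv hP0 mH hc0 hc1 hH).
have max_acc : maximal -> accretive_with_boundary.
  move=> maxA; split; first by case: maxA.
  exact: (maximal_boundary hab hP1 hP1inv hP0 mH hc0 hH hAact sD AD maxA).
have acc_rank WB : accretive ip A -> dom A = boundary_domain H WB -> \rank WB = N /\
    psdmx (WB *m invmx (effort P1) *m swap R N *m (WB *m invmx (effort P1))^T).
  by move=> acc domA; exact: (accretive_kernel hab hP1 hP1inv hP0 mH hc0 hH hAact domA acc).
have acc_rank' : accretive_with_boundary -> rank_and_definiteness.
  move=> [acc [WB domA]]; have [rW pW] := acc_rank WB acc domA.
  by exists WB.
have rank_gen : rank_and_definiteness -> generates.
  move=> [WB [domA rW pW]].
  exact: (psd_generates hab hP1 hP1inv hP0 mH hc0 hc1 hH hAact domA rW pW).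
split; first by tfae.
(* Each condition implies accretivity, which gives rank [N] to every [WB] that describes the domain,
   not only to the one of the rank condition. *)
move=> any WB domA; have [acc _] : accretive_with_boundary.
  by case: any => h; [apply/max_acc/gen_max | apply: max_acc | | apply/max_acc/gen_max/rank_gen].
by have [rW _] := acc_rank WB acc domA; exact: rank_factorization.
Qed.
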